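(* Let $S$ be a closed oriented surface of genus $g\geq 2$, let $h$ be a hyperbolic metric on $S$ with holonomy representation $\rho:\pi_1(S)\to\mathrm{SO}_0(2,1)$, and let $\mathcal{BG}_{(S,h)}$ be the vector space of (equivalence classes of) balanced geodesic graphs on $(S,h)$. Then the map $\Phi:\mathcal{BG}_{(S,h)}\to H^1_{\mathrm{Ad}\rho}(\pi_1(S),\mathfrak{so}(2,1))$ defined in the context is surjective.
   Context: **Balanced geodesic graphs.** A balanced geodesic graph $(\mathcal G,\mathbf w)$ on $(S,h)$ consists of a finite embedded graph $\mathcal G=(\mathcal E,\mathcal V)$ in $S$ (unoriented edges $\mathcal E$, vertices $\mathcal V$; the two endpoints of an edge may coincide) and real weights $w_e$, $e\in\mathcal E$ (of any sign), such that every edge is a geodesic interval between its endpoints and, for every $p\in\mathcal V$, $\sum_{p\in e}w_ev_e=0$ in $T_pS$. Here the sum is over the edges $e$ having $p$ as an endpoint, and $v_e$ is the unit tangent vector at $p$ to $e$, pointing from $p$ into $e$ (an edge with both endpoints at $p$ contributes two terms). $\mathcal{BG}_{(S,h)}$ is the set of balanced geodesic graphs modulo the equivalence relation generated by adding or deleting (i) vertices which are endpoints of only two edges (possibly coincident) and (ii) edges of weight zero. It is a vector space: scalars multiply the weights, and the sum of two graphs is the union graph (with intersection points added as vertices), with weights added on overlapping segments and kept elsewhere. **Group cohomology.** $\mathbb H^2$ is the hyperboloid $\{x\in\mathbb R^{2,1}:\langle x,x\rangle=-1,\ x_3>0\}$ in Minkowski space $\mathbb R^{2,1}$ with $\langle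 x,x'\rangle=x_1x'_1+x_2x'_2-x_3x'_3$. Its group of orientation-preserving isometries is $\mathrm{SO}_0(2,1)$, with Lie algebra $\mathfrak{so}(2,1)$. Let $\pi:\widetilde S\to S$ be the universal cover and $\mathrm{dev}:(\widetilde S,\pi^*h)\to\mathbb H^2$ an orientation-preserving isometry, equivariant for $\rho$. $H^1_{\mathrm{Ad}\rho}(\pi_1(S),\mathfrak{so}(2,1))$ is the quotient of the space of cocycles, i.e. maps $\tau:\pi_1(S)\to\mathfrak{so}(2,1)$ with $\tau(\gamma\eta)=\mathrm{Ad}\rho(\gamma)\cdot\tau(\eta)+\tau(\gamma)$, by the space of coboundaries $\tau(\gamma)=\mathrm{Ad}\rho(\gamma)\cdot\tau_0-\tau_0$, $\tau_0\in\mathfrak{so}(2,1)$. **The map $\Phi$.** For an oriented geodesic $\ell$ of $\mathbb H^2$, let $T_t(\ell)$ be the hyperbolic isometry preserving $\ell$ and translating its points by signed length $t$ along its orientation, and let $\mathfrak t(\ell)=\frac{d}{dt}|_{t=0}T_t(\ell)\in\mathfrak{so}(2,1)$. Given $(\mathcal G,\mathbf w)$, let $\widetilde{\mathcal G}=\pi^{-1}(\mathcal G)$ with lifted weights $\widetilde w_{\widetilde e}=w_{\pi(\widetilde e)}$, and fix $x_0\in\widetilde S\setminus\widetilde{\mathcal G}$. For $\gamma\in\pi_1(S)$, choose a path $\sigma$ in $\widetilde S$ from $x_0$ to $\gamma\cdot x_0$ that meets $\widetilde{\mathcal G}$ in finitely many points, none of them vertices, and crosses $\widetilde{\mathcal G}$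 from one side to the other at each of these points. Put $$\tau(\gamma)=\sum_{p\in \mathrm{Im}\,\sigma\cap\widetilde e}\widetilde w_{\widetilde e}\,\mathfrak t(\mathrm{dev}(\widetilde e)),$$ where the sum is over all crossing points $p$ of $\sigma$ with edges $\widetilde e$ of $\widetilde{\mathcal G}$. At each crossing, $\widetilde e$ is oriented towards the left as seen when travelling along $\sigma$, and $\mathfrak t(\mathrm{dev}(\widetilde e))$ denotes $\mathfrak t(\ell)$ for the correspondingly oriented geodesic $\ell$ containing $\mathrm{dev}(\widetilde e)$. Then $\tau$ is a cocycle whose class does not depend on the choices of $\sigma$ and $x_0$, and $\Phi(\mathcal G,\mathbf w)=[\tau]$. *)

(* Defs.v *)
From HB Require Import structures.
From Stdlib Require Import Relation_Operators.
From mathcomp Require Import all_boot all_order all_algebra.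
From mathcomp Require Import ring lra.
From mathcomp Require Import all_classical all_reals all_analysis.

Set Implicit Arguments.
Unset Strict Implicit.
Unset Printing Implicit Defensive.

Import Order.TTheory GRing.Theory Num.Theory.
Import numFieldNormedType.Exports.

Local Open Scope classical_set_scope.
Local Open Scope ring_scope.

(* The set of classes [r x]; used below only for equivalence relations. *)
Definition quotient (T : Type) (r : T -> T -> Prop) : Type :=
  {C : set T | exists x, C = r x}.

Definition class_of (T : Type) (r : T -> T -> Prop) (x : T) : quotient r :=
  exist _ (r x) (ex_intro _ x erefl).

Section Minkowski.
Variable R : realType.
Implicit Types (p u x y : 'cV[R]_3) (A X : 'M[R]_3) (t : R).

Definition Jmx : 'M[R]_3 := diag_mx (\row_i (if i == ord_max then -1 else 1)).

Definition mink x y : R := (x^T *m Jmx *m y) 0 0.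

Definition hyperboloid : set 'cV[R]_3 :=
  [set x | mink x x = -1 /\ 0 < x ord_max 0].

Definition SO21 : set 'M[R]_3 :=
  [set A | [/\ A^T *m Jmx *m A = Jmx, \det A = 1 & 0 < A ord_max ord_max]].

Definition so21 : set 'M[R]_3 := [set X | X^T *m Jmx + Jmx *m X = 0].

Definition Ad A X : 'M[R]_3 := A *m X *m invmx A.

Definition cosh t : R := (expR t + expR (- t)) / 2.
Definition sinh t : R := (expR t - expR (- t)) / 2.

(* [unit_tangent p u]: u is a unit vector in the tangent plane at p.  Such a
   pair encodes the oriented geodesic [geodesic p u] through p. *)
Definition unit_tangent p u : Prop :=
  [/\ hyperboloid p, mink p u = 0 & mink u u = 1].

Definition geodesic p u t : 'cV[R]_3 := cosh t *: p + sinh t *: u.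

(* [side p u x] is positive (negative) when x lies on the left (right) of the
   oriented geodesic (p, u).  The hyperboloid is oriented so that its
   projection to the (x_1, x_2)-plane preserves orientation. *)
Definition side p u x : R := \det (row_mx u (row_mx x p) : 'M[R]_3).

(* The isometry translating along the oriented geodesic (p, u) by t: it acts
   by a boost on the plane spanned by p and u, and fixes its orthogonal (see
   [translation_SO21] and [translation_geodesic]). *)
Definition translation p u t : 'M[R]_3 :=
  1%:M + (cosh t - 1) *: (u *m (u^T *m Jmx) - p *m (p^T *m Jmx))
       + sinh t *: (p *m (u^T *m Jmx) - u *m (p^T *m Jmx)).

Definition inf_translation p u : 'M[R]_3 :=
  \matrix_(i, j) derive1 (fun t => translation p u t i j) 0.

Lemma minkE x y :
  mink x y = x 0 0 * y 0 0 + x 1 0 * y 1 0 - x ord_max 0 * y ord_max 0.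
Proof.
rewrite /mink /Jmx mul_mx_diag !mxE !big_ord_recl big_ord0 !mxE /= addr0 addrA.
have -> : lift ord0 ord0 = 1 :> 'I_3 by exact/val_inj.
have -> : lift ord0 (lift ord0 ord0) = ord_max :> 'I_3 by exact/val_inj.
rewrite -[_ ord_max 0]/(_ ord_max 0) !mulr1 mulrN1 mulNr.
by [].
Qed.

Lemma minkC x y : mink x y = mink y x.
Proof. by rewrite !minkE; ring. Qed.

Lemma cosh2_sinh2 t : cosh t ^+ 2 - sinh t ^+ 2 = 1.
Proof.
have : expR t * expR (- t) = 1 by rewrite -expRD subrr expR0.
by rewrite /cosh /sinh => e; lra.
Qed.

Lemma coshD s t : cosh (s + t) = cosh s * cosh t + sinh s * sinh t.
Proof. by rewrite /cosh /sinh opprD !expRD; field. Qed.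

Lemma sinhD s t : sinh (s + t) = sinh s * cosh t + cosh s * sinh t.
Proof. by rewrite /cosh /sinh opprD !expRD; field. Qed.

Lemma translationE p u t x : translation p u t *m x =
  x + (cosh t - 1) *: (mink u x *: u - mink p x *: p)
    + sinh t *: (mink u x *: p - mink p x *: u).
Proof.
have E (a b : 'cV[R]_3) : a *m (b^T *m Jmx) *m x = mink b x *: a.
  by rewrite -mulmxA (mx11_scalar (_ *m x)) -/(mink b x) mul_mx_scalar.
by rewrite !mulmxDl mul1mx -!scalemxAl !mulmxBl !E.
Qed.

Lemma translation_geodesic p u s t : unit_tangent p u ->
  translation p u t *m geodesic p u s = geodesic p u (s + t).
Proof.
move=> [[pp _] pu uu].
have E a : mink a (geodesic p u s) = cosh s * mink a p + sinh s * mink a u.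
  by rewrite /mink /geodesic mulmxDr -!scalemxAr !mxE.
rewrite translationE !E pp uu (minkC u p) !pu /geodesic coshD sinhD.
by apply/matrixP => i j; rewrite !mxE; ring.
Qed.

Lemma translation_mink p u t x y : unit_tangent p u ->
  mink (translation p u t *m x) (translation p u t *m y) = mink x y.
Proof.
move=> [[pp _] pu uu]; rewrite !translationE.
have DL (a b c : 'cV[R]_3) : mink (a + b) c = mink a c + mink b c.
  by rewrite /mink raddfD /= !mulmxDl mxE.
have ZL k (a c : 'cV[R]_3) : mink (k *: a) c = k * mink a c.
  by rewrite /mink linearZ /= -!scalemxAl mxE.
have DR (a b c : 'cV[R]_3) : mink c (a + b) = mink c a + mink c b.
  by rewrite minkC DL !(minkC c).
have ZR k (a c : 'cV[R]_3) : mink c (k *: a) = k * mink c a.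
  by rewrite minkC ZL minkC.
have NL (a c : 'cV[R]_3) : mink (- a) c = - mink a c.
  by rewrite -scaleN1r ZL mulN1r.
have NR (a c : 'cV[R]_3) : mink c (- a) = - mink c a.
  by rewrite minkC NL minkC.
rewrite !(DL, NL, ZL) !(DR, NR, ZR) pp pu uu (minkC u p) pu.
rewrite (minkC x p) (minkC x u).
move: (cosh t) (sinh t) (cosh2_sinh2 t) (mink x y) (mink p x) (mink u x)
  (mink p y) (mink u y) => c s /eqP; rewrite -subr_eq0 => /eqP cs m a b a' b'.
transitivity (m + (c ^+ 2 - s ^+ 2 - 1) * (b * b' - a * a')); first by ring.
by rewrite cs mul0r addr0.
Qed.

Lemma translation_form p u t : unit_tangent p u ->
  (translation p u t)^T *m Jmx *m translation p u t = Jmx.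
Proof.
move=> pu; set A := translation p u t.
have E (B : 'M[R]_3) i j : B i j = ((delta_mx 0 i : 'rV_3) *m B *m (delta_mx j 0 : 'cV_3)) 0 0.
  by rewrite -rowE -colE !mxE.
apply/matrixP => i j; rewrite E [RHS]E.
have := translation_mink t (delta_mx i 0) (delta_mx j 0) pu.
by rewrite /mink -/A !trmx_mul !trmx_delta !mulmxA.
Qed.

Lemma translationD p u s t : unit_tangent p u ->
  translation p u (s + t) = translation p u s *m translation p u t.
Proof.
move=> pu; have [[pp _] pu0 uu] := pu.
suff H x : translation p u (s + t) *m x = translation p u s *m translation p u t *m x.
  by apply/matrixP => i j; have /matrixP /(_ i 0) := H (delta_mx j 0); rewrite -!colE !mxE.
rewrite -mulmxA !translationE coshD sinhD.
have DR (a b c : 'cV[R]_3) : mink c (a + b) = mink c a + mink c b.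
  by rewrite /mink mulmxDr mxE.
have ZR k (a c : 'cV[R]_3) : mink c (k *: a) = k * mink c a.
  by rewrite /mink -scalemxAr mxE.
have NR (a c : 'cV[R]_3) : mink c (- a) = - mink c a.
  by rewrite -scaleN1r ZR mulN1r.
rewrite !(DR, NR, ZR) pp pu0 uu (minkC u p) pu0.
by apply/matrixP => i j; rewrite !mxE; ring.
Qed.

Lemma translation_SO21 p u t : unit_tangent p u -> SO21 (translation p u t).
Proof.
move=> pu; split; first exact: translation_form.
  have dJ : \det (Jmx) ^+ 2 = 1.
    rewrite /Jmx det_diag !big_ord_recl big_ord0 !mxE /=; ring.
  have /(congr1 determinant) := translation_form (t / 2) pu.
  rewrite !det_mulmx det_tr => /(congr1 ( *%R (\det (Jmx)))) d2.
  have <- : t / 2 + t / 2 = t by field.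
  rewrite translationD // det_mulmx; move: dJ d2.
  move: (\det (translation p u (t / 2))) (\det (Jmx)) => d j j2 d2.
  transitivity (j ^+ 2 * (d * d)); first by rewrite j2 mul1r.
  by rewrite -j2 [RHS]expr2 -d2; ring.
have c1 : 1 <= cosh t.
  have : expR t * expR (- t) = 1 by rewrite -expRD subrr expR0.
  have := expR_gt0 t; have := expR_gt0 (- t); rewrite /cosh.
  move: (expR t) (expR (- t)) => a b b0 a0 ab; have := sqr_ge0 (a - b).
  case: (lerP 1 ((a + b) / 2)) => // lt1.
  have l2 : a + b < 2 by lra.
  have : (a + b) ^+ 2 < 2 ^+ 2 by rewrite ltrXn2r // ?nnegrE; lra.
  rewrite sqrrB sqrrD; nra.
have -> : translation p u t ord_max ord_max =
    1 + (cosh t - 1) * (p ord_max 0 ^+ 2 - u ord_max 0 ^+ 2).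
  have := congr1 (fun y : 'cV_3 => y ord_max 0) (translationE p u t (delta_mx ord_max 0)).
  rewrite -colE !minkE !mxE !eqxx /= !mulr0 !addr0 ?sub0r !mulr1 => ->.
  by rewrite /=; ring.
have [[pp p0] pu0 uu] := pu; move: pp p0 pu0 uu; rewrite !minkE.
move: (p 0 0) (p 1 0) (p ord_max 0) (u 0 0) (u 1 0) (u ord_max 0).
move=> p1 p2 p3 u1 u2 u3 pp p0 pu0 uu.
suff : u3 ^+ 2 <= p3 ^+ 2 by move=> ?; rewrite ltr_wpDr // mulr_ge0 // subr_ge0.
have : (p1 * u1 + p2 * u2) ^+ 2 <= (p1 ^+ 2 + p2 ^+ 2) * (u1 ^+ 2 + u2 ^+ 2).
  have := sqr_ge0 (p1 * u2 - p2 * u1); nra.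
have -> : p1 * u1 + p2 * u2 = p3 * u3 by lra.
have -> : p1 ^+ 2 + p2 ^+ 2 = p3 ^+ 2 - 1 by lra.
have -> : u1 ^+ 2 + u2 ^+ 2 = u3 ^+ 2 + 1 by lra.
nra.
Qed.

End Minkowski.

Section Surface.
Variable R : realType.

(* The model of the surface of genus g: the closed unit disc, its boundary
   being divided into 4g sides, with the side pairings of the word
   a_1 b_1 a_1^-1 b_1^-1 ... a_g b_g a_g^-1 b_g^-1. *)
Definition disc : set (R * R) := [set x | x.1 ^+ 2 + x.2 ^+ 2 <= 1].

Definition side_point (g : nat) (t : R) : R * R :=
  (cos (2 * pi * t / (4 * g)%:R), sin (2 * pi * t / (4 * g)%:R)).

Definition side_pairing (g : nat) (x y : R * R) : Prop :=
  exists j s, [/\ (j < g)%N, 0 <= s <= 1 &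
    (x = side_point g ((4 * j)%:R + s) /\
     y = side_point g ((4 * j + 2)%:R + (1 - s))) \/
    (x = side_point g ((4 * j + 1)%:R + s) /\
     y = side_point g ((4 * j + 3)%:R + (1 - s)))].

(* As the disc is compact and S is Hausdorff, the map q below is a quotient
   map, i.e. S is homeomorphic to the model. *)
Definition closed_surface_of_genus (g : nat) (S : topologicalType) : Prop :=
  hausdorff_space S /\
  exists q : R * R -> S,
    [/\ {within disc, continuous q},
        forall p, exists2 x, disc x & q x = p
      & forall x y, disc x -> disc y ->
          (q x = q y <-> clos_refl_sym_trans _ (side_pairing g) x y)].

(* A hyperbolic metric on an oriented surface, as an atlas of
   orientation-preserving local isometries to the hyperbolic plane. *)
Record hyperbolic_structure (S : topologicalType) := HyperbolicStructure {
  chart_index : Type;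
  chart_dom : chart_index -> set S;
  chart : chart_index -> S -> 'cV[R]_3;
  chart_cover : forall p, exists i, chart_dom i p;
  chart_dom_open : forall i, open (chart_dom i);
  chart_hyperboloid : forall i p,
    chart_dom i p -> hyperboloid (chart i p);
  chart_inj : forall i p q, chart_dom i p -> chart_dom i q ->
    chart i p = chart i q -> p = q;
  chart_continuous : forall i p, chart_dom i p ->
    {for p, continuous (chart i)};
  chart_open : forall i (W : set S), open W -> W `<=` chart_dom i ->
    exists2 O : set 'cV[R]_3, open O &
      chart i @` W = O `&` @hyperboloid R;
  chart_transition : forall i j p, chart_dom i p -> chart_dom j p ->
    exists2 A, SO21 A & \forall q \near p, chart j q = A *m chart i q
}.

Definition covering_map (X Y : topologicalType) (f : X -> Y) : Prop :=
  [/\ continuous f,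
      forall y, exists x, f x = y
    & forall y, exists U : set Y, [/\ open U, U y &
        exists (I : Type) (V : I -> set X), [/\
          forall x, U (f x) <-> exists i, V i x,
          forall i j x, V i x -> V j x -> i = j
        & forall i, [/\ open (V i), set_bij (V i) U f
            & forall W : set X, open W -> W `<=` V i -> open (f @` W)]]]].

Definition simply_connected (X : topologicalType) : Prop :=
  (forall x y : X, exists f : R -> X,
     [/\ {within `[0, 1]%classic, continuous f}, f 0 = x & f 1 = y]) /\
  (forall f : R -> X, {within `[0, 1]%classic, continuous f} -> f 0 = f 1 ->
     exists H : R * R -> X,
       [/\ {within `[0, 1]%classic `*` `[0, 1]%classic, continuous H},
           forall t, 0 <= t <= 1 -> H (t, 0) = f t,
           forall t, 0 <= t <= 1 -> H (t, 1) = f 0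
         & forall s, 0 <= s <= 1 -> H (0, s) = f 0 /\ H (1, s) = f 0]).

(* The universal cover, with the fundamental group acting on it as the group
   of deck transformations (simply transitively on the fibres). *)
Record universal_cover (S : topologicalType) := UniversalCover {
  cover_space : topologicalType;
  proj : cover_space -> S;
  proj_covering : covering_map proj;
  cover_simply_connected : simply_connected cover_space;
  pi1 : groupType;
  deck : pi1 -> cover_space -> cover_space;
  deck1 : forall x, deck 1%g x = x;
  deckM : forall a b x, deck (a * b)%g x = deck a (deck b x);
  deck_continuous : forall a, continuous (deck a);
  proj_deck : forall a x, proj (deck a x) = proj x;
  deck_transitive : forall x y, proj x = proj y -> exists a, y = deck a x;
  deck_free : forall a x, deck a x = x -> a = 1%g
}.

(* dev is an orientation-preserving isometry from the universal cover, with
   the lifted hyperbolic structure, onto the hyperbolic plane. *)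
Definition developing_map (S : topologicalType) (h : hyperbolic_structure S)
    (C : universal_cover S) (dev : cover_space C -> 'cV[R]_3) : Prop :=
  set_bij setT (@hyperboloid R) dev /\
  forall x i, chart_dom (h := h) i (proj x) ->
    exists2 A, SO21 A &
      \forall y \near x, dev y = A *m chart (h := h) i (proj y).

Definition holonomy (S : topologicalType) (C : universal_cover S)
    (dev : cover_space C -> 'cV[R]_3) (rho : pi1 C -> 'M[R]_3) : Prop :=
  [/\ forall a, SO21 (rho a),
      forall a b, rho (a * b)%g = rho a *m rho b
    & forall a x, dev (deck a x) = rho a *m dev x].

End Surface.

Section Cohomology.
Variables (R : realType) (Gam : groupType) (rho : Gam -> 'M[R]_3).

Definition is_cocycle (tau : Gam -> 'M[R]_3) : Prop :=
  (forall a, so21 (tau a)) /\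
  (forall a b, tau (a * b)%g = Ad (rho a) (tau b) + tau a).

Definition cocycle : Type := {tau : Gam -> 'M[R]_3 | is_cocycle tau}.

Definition cohomologous (tau tau' : cocycle) : Prop :=
  exists2 tau0 : 'M[R]_3, so21 tau0 &
    forall a, sval tau' a - sval tau a = Ad (rho a) tau0 - tau0.

Definition H1 : Type := quotient cohomologous.

End Cohomology.


(* A weighted edge, parametrized on [0, elen]; values of the curve outside this
   interval are irrelevant. *)
Record edge (R : realType) (S : topologicalType) := Edge {
  elen : R;
  ecurve : R -> S;
  eweight : R
}.

HB.instance Definition _ (R : realType) (S : topologicalType) :=
  gen_eqMixin (edge R S).

Section Graphs.
Variables (R : realType) (S : topologicalType) (h : hyperbolic_structure R S).
Implicit Types (e : edge R S) (G : seq (edge R S)) (b : bool).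

Definition endpoint e b : S := ecurve e (if b then elen e else 0).

(* The curve of e started at its endpoint b. *)
Definition curve_from e b (s : R) : S :=
  ecurve e (if b then elen e - s else s).

Definition geodesic_edge e : Prop :=
  0 < elen e /\
  forall t i, 0 <= t <= elen e -> chart_dom (h := h) i (ecurve e t) ->
    exists2 u, unit_tangent (chart (h := h) i (ecurve e t)) u &
      \forall s \near t, 0 <= s <= elen e ->
        chart_dom (h := h) i (ecurve e s) /\
        chart (h := h) i (ecurve e s) =
          geodesic (chart (h := h) i (ecurve e t)) u (s - t).

(* v is the tangent vector (in the chart i) to e at its endpoint b, pointing
   into e; it has norm 1 as geodesic edges have unit speed. *)
Definition edge_tangent i e b (v : 'cV[R]_3) : Prop :=
  (fun s : R => s^-1 *: (chart (h := h) i (curve_from e b s) -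
                         chart (h := h) i (endpoint e b))) @ 0^'+ --> v.

(* The vertices of a graph are the endpoints of its edges. *)
Definition embedded G : Prop :=
  uniq G /\
  forall e e' t t', e \in G -> e' \in G ->
    0 < t < elen e -> 0 <= t' <= elen e' ->
    ecurve e t = ecurve e' t' -> e = e' /\ t = t'.

Definition balanced G : Prop :=
  forall p i (v : edge R S -> bool -> 'cV[R]_3), chart_dom i p ->
    (forall e b, e \in G -> endpoint e b = p -> edge_tangent i e b (v e b)) ->
    \sum_(e <- G) \sum_(b : bool | endpoint e b == p) eweight e *: v e b = 0.

Definition balanced_geodesic_graph G : Prop :=
  [/\ forall e, e \in G -> geodesic_edge e, embedded G & balanced G].

Definition bgraph : Type := {G : seq (edge R S) | balanced_geodesic_graph G}.

Definition same_unoriented_edge e e' : Prop :=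
  [/\ elen e = elen e', eweight e = eweight e'
    & (forall t, 0 <= t <= elen e -> ecurve e' t = ecurve e t) \/
      (forall t, 0 <= t <= elen e -> ecurve e' t = ecurve e (elen e - t))].

(* The first two moves only change the description of a graph. *)
Inductive move : seq (edge R S) -> seq (edge R S) -> Prop :=
| MovePerm G G' : perm_eq G G' -> move G G'
| MoveUnoriented e e' G : same_unoriented_edge e e' -> move (e :: G) (e' :: G)
| MoveVertex e t G : 0 < t < elen e ->
    move (e :: G)
         [:: Edge t (ecurve e) (eweight e),
             Edge (elen e - t) (fun s => ecurve e (t + s)) (eweight e) & G]
| MoveZeroEdge e G : eweight e = 0 -> move (e :: G) G.

Definition bgraph_equiv : bgraph -> bgraph -> Prop :=
  clos_refl_sym_trans bgraph
    (fun G0 G1 : bgraph => move (sval G0) (sval G1)).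

Definition BG : Type := quotient bgraph_equiv.

End Graphs.

Section Phi.
Variables (R : realType) (S : topologicalType) (h : hyperbolic_structure R S).
Variables (C : universal_cover R S) (dev : cover_space C -> 'cV[R]_3).
Variable (rho : pi1 C -> 'M[R]_3).
Implicit Types (G : seq (edge R S)) (e : edge R S) (sigma : R -> cover_space C).

Definition lifted_graph G : set (cover_space C) :=
  [set x | exists e t, [/\ e \in G, 0 <= t <= elen e & proj x = ecurve e t]].

Definition lift_of e (c : R -> cover_space C) : Prop :=
  {within `[0, elen e]%classic, continuous c} /\
  forall t, 0 <= t <= elen e -> proj (c t) = ecurve e t.

(* At time t, sigma crosses an interior point of a lift c of e.  The geodesic
   (p, u) containing dev(c) is oriented towards the left as seen when
   travelling along sigma; equivalently, sigma goes from the left to the right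
   of (p, u). *)
Definition crossing sigma (t : R) e (p u : 'cV[R]_3) : Prop :=
  exists c s,
    [/\ lift_of e c, 0 < s < elen e, c s = sigma t,
        unit_tangent p u /\
        (forall r, 0 <= r <= elen e -> exists r', dev (c r) = geodesic p u r')
      & (\forall r \near t^'-, 0 < side p u (dev (sigma r))) /\
        (\forall r \near t^'+, side p u (dev (sigma r)) < 0)].

(* sigma is an admissible path from x to y, meeting the lifted graph exactly at
   the times [ts k], k < n, and X is its weighted sum of crossings. *)
Definition crossing_sum G (x y : cover_space C) (X : 'M[R]_3) : Prop :=
  exists sigma (n : nat) (ts : 'I_n -> R) (es : 'I_n -> edge R S)
         (ps us : 'I_n -> 'cV[R]_3),
    [/\ {within `[0, 1]%classic, continuous sigma},
        sigma 0 = x /\ sigma 1 = y,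
        injective ts /\
        (forall t, (0 <= t <= 1 /\ lifted_graph G (sigma t)) <->
                   exists k, t = ts k),
        forall k, es k \in G /\ crossing sigma (ts k) (es k) (ps k) (us k)
      & X = \sum_k eweight (es k) *: inf_translation (ps k) (us k)].

Definition crossing_cocycle G x0 (tau : pi1 C -> 'M[R]_3) : Prop :=
  ~ lifted_graph G x0 /\ forall a, crossing_sum G x0 (deck a x0) (tau a).

(* Phi(G) = c: choices of a base point and of paths exist, and the class of the
   resulting cocycle is c for all of them. *)
Definition Phi_graph G (c : H1 rho) : Prop :=
  (exists x0 tau, crossing_cocycle G x0 tau) /\
  (forall x0 tau, crossing_cocycle G x0 tau ->
     exists z : cocycle rho, sval z = tau /\ class_of (@cohomologous _ _ rho) z = c).

(* Phi(b) = c, computed on a representative of b. *)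
Definition Phi (b : BG h) (c : H1 rho) : Prop :=
  exists2 G0 : bgraph h, b = class_of (@bgraph_equiv _ _ h) G0 &
    Phi_graph (sval G0) c.

End Phi.

(* Main.v *)
Require Import Defs.
From mathcomp Require Import all_boot all_order all_algebra.
From mathcomp Require Import all_classical all_reals all_analysis.
From mathcomp Require Import ring lra.
Require Import Defs.

(** Identify so(2,1) with Minkowski space through the Lorentzian cross product:
    [hat v] is the matrix of the map sending [x] to [lcross v x]. Then
    [Ad A (hat v) = hat (A *m v)], the infinitesimal translation along the
    oriented geodesic [(p, u)] is [hat (lcross p u)], where [lcross p u] is the
    unit normal of the plane of the geodesic, and a cocycle becomes a map [v]
    with [v (a * b) = rho a *m v b + v a]. So it makes the group act on
    Minkowski space by affine maps.

    A graph together with a locally constant function [F] on its complement,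
    with values in Minkowski space and whose jump across each edge is the weight
    times the normal of the edge, is balanced: the jumps around a vertex cancel
    out. If moreover [F] is equivariant for the affine action, then the crossing
    sum along a path telescopes to the difference of the values of [F] at its
    ends, so that the class of the crossing cocycle is the class of [v]. It
    remains to find such an [F] for an arbitrary cocycle.

    The function [F] is found as the gradient of a convex function which is
    piecewise linear on the cone over the hyperbolic plane. Take the
    orbit of [K *: apex] under the affine action, that is, the sites
    [K *: (rho a *m apex) + v a], and let the cell of [a] consist of the points
    [x] where the pairing of [x] with the site of [a] is maximal; for [v = 0]
    this is the Voronoi diagram of an orbit. Neighbouring sites differ by a
    normal vector of the common boundary of their cells, and this is exactly the
    jump condition for the function [F] sending a point to the site of its cell.
    No control on the growth of [v] is needed: only sites at a bounded distance
    are compared, and [K] is chosen such that among those the winner is always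
    much closer than the bound ([site_domination]). Then the cells are convex
    and locally finite, and their common boundaries are geodesic segments
    ([coactive_edge], [edge_overlap]), of which there are finitely many modulo
    the group ([edge_orbits]).

    Around a vertex the balance condition is Minkowski's relation between the
    edges of the convex polygon spanned by the sites of the adjacent cells and
    the normals of these edges. It is proved by matching: each corner of the
    polygon ends one edge and starts the next one ([rotate_to_tie],
    [balanced_link]), so that the jumps add up to zero without any cyclic
    ordering.

    The crossing sum is computed by [crossing_sumE]. Admissible paths are made
    of two geodesic segments with a generic corner ([crossing_sum_ex]). *)

Set Implicit Arguments.
Unset Strict Implicit.
Unset Printing Implicit Defensive.

Import Order.TTheory GRing.Theory Num.Theory.
Import numFieldNormedType.Exports.

Local Open Scope classical_set_scope.
Local Open Scope ring_scope.

(** * Lorentzian linear algebra *)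

Section Lorentz.
Variable R : realType.
Implicit Types (p u v w x y z : 'cV[R]_3) (A X : 'M[R]_3) (s t : R).

Definition vec3 (a b c : R) : 'cV[R]_3 :=
  \col_i (if i == 0 then a else if i == 1 then b else c).

Lemma vec3E a b c : (vec3 a b c 0 0 = a) * (vec3 a b c 1 0 = b) *
  (vec3 a b c ord_max 0 = c).
Proof. by rewrite !mxE. Qed.

Lemma vec3P x y : x 0 0 = y 0 0 -> x 1 0 = y 1 0 ->
  x ord_max 0 = y ord_max 0 -> x = y.
Proof.
move=> e0 e1 e2; apply/matrixP => i j; rewrite (ord1 j).
case: i => [[|[|[|//]]] hi].
- by rewrite (_ : Ordinal hi = 0) //; exact: val_inj.
- by rewrite (_ : Ordinal hi = 1) //; exact: val_inj.
- by rewrite (_ : Ordinal hi = ord_max) //; exact: val_inj.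
Qed.

Lemma minkDl x y z : mink (x + y) z = mink x z + mink y z.
Proof. by rewrite !minkE !mxE; ring. Qed.
Lemma minkDr x y z : mink z (x + y) = mink z x + mink z y.
Proof. by rewrite !minkE !mxE; ring. Qed.
Lemma minkZl s x y : mink (s *: x) y = s * mink x y.
Proof. by rewrite !minkE !mxE; ring. Qed.
Lemma minkZr s x y : mink x (s *: y) = s * mink x y.
Proof. by rewrite !minkE !mxE; ring. Qed.
Lemma minkNl x y : mink (- x) y = - mink x y.
Proof. by rewrite !minkE !mxE; ring. Qed.
Lemma minkNr x y : mink x (- y) = - mink x y.
Proof. by rewrite !minkE !mxE; ring. Qed.
Lemma mink0l y : mink 0 y = 0.
Proof. by rewrite !minkE !mxE; ring. Qed.
Definition minklin := (minkDl, minkDr, minkNl, minkNr, minkZl, minkZr).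

Lemma mink_nondeg x y : (forall z, mink x z = mink y z) -> x = y.
Proof.
move=> H; have := (H (vec3 1 0 0), H (vec3 0 1 0), H (vec3 0 0 1)).
rewrite !minkE !vec3E => -[[e0 e1] e2].
by apply: vec3P; lra.
Qed.

(** The Lorentzian cross product, for which [mink (lcross x y) z] is the
    determinant of [(x, y, z)]. *)
Definition lcross x y : 'cV[R]_3 :=
  vec3 (x 1 0 * y ord_max 0 - x ord_max 0 * y 1 0)
       (x ord_max 0 * y 0 0 - x 0 0 * y ord_max 0)
       (x 1 0 * y 0 0 - x 0 0 * y 1 0).

Lemma lcrossDl x y z : lcross (x + y) z = lcross x z + lcross y z.
Proof. by apply: vec3P; rewrite !(vec3E, mxE) /=; ring. Qed.
Lemma lcrossDr x y z : lcross z (x + y) = lcross z x + lcross z y.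
Proof. by apply: vec3P; rewrite !(vec3E, mxE) /=; ring. Qed.
Lemma lcrossZl s x y : lcross (s *: x) y = s *: lcross x y.
Proof. by apply: vec3P; rewrite !(vec3E, mxE) /=; ring. Qed.
Lemma lcrossZr s x y : lcross x (s *: y) = s *: lcross x y.
Proof. by apply: vec3P; rewrite !(vec3E, mxE) /=; ring. Qed.
Lemma lcrossNl x y : lcross (- x) y = - lcross x y.
Proof. by apply: vec3P; rewrite !(vec3E, mxE) /=; ring. Qed.
Lemma lcrossNr x y : lcross x (- y) = - lcross x y.
Proof. by apply: vec3P; rewrite !(vec3E, mxE) /=; ring. Qed.
Lemma lcrossC x y : lcross x y = - lcross y x.
Proof. by apply: vec3P; rewrite !(vec3E, mxE) /=; ring. Qed.
Lemma lcrossxx x : lcross x x = 0.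
Proof. by apply: vec3P; rewrite !(vec3E, mxE) /=; ring. Qed.
Definition lcrosslin :=
  (lcrossDl, lcrossDr, lcrossNl, lcrossNr, lcrossZl, lcrossZr).

Lemma mink_lcrossC x y z : mink (lcross x y) z = mink x (lcross y z).
Proof. by rewrite !minkE !vec3E; ring. Qed.

Lemma mink_lcrossl x y : mink (lcross x y) x = 0.
Proof. by rewrite !minkE !vec3E; ring. Qed.
Lemma mink_lcrossr x y : mink (lcross x y) y = 0.
Proof. by rewrite !minkE !vec3E; ring. Qed.

Lemma lcrossA x y z :
  lcross (lcross x y) z = mink y z *: x - mink x z *: y.
Proof. by apply: vec3P; rewrite ?minkE !(vec3E, mxE) /=; ring. Qed.

Lemma mink_lcross2 x y z w : mink (lcross x y) (lcross z w) =
  mink x w * mink y z - mink x z * mink y w.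
Proof. by rewrite !minkE !vec3E; ring. Qed.


Lemma det3 (M : 'M[R]_3) : \det M =
  M 0 0 * (M 1 1 * M ord_max ord_max - M 1 ord_max * M ord_max 1)
  - M 0 1 * (M 1 0 * M ord_max ord_max - M 1 ord_max * M ord_max 0)
  + M 0 ord_max * (M 1 0 * M ord_max 1 - M 1 1 * M ord_max 0).
Proof.
have E f g : \det (mxsub f g M : 'M[R]_2) =
    M (f 0) (g 0) * M (f 1) (g 1) - M (f 0) (g 1) * M (f 1) (g 0).
  rewrite (expand_det_row _ 0) (bigD1 0) // (bigD1 1) //= big1 ?addr0; last first.
    by move=> [[|[|]]].
  rewrite /cofactor !det_mx11 !mxE /= expr1 expr0.
  have -> : lift 0 (0 : 'I_1) = 1 :> 'I_2 by exact: val_inj.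
  have -> : lift 1 (0 : 'I_1) = 0 :> 'I_2 by exact: val_inj.
  ring.
have l0 (i : 'I_2) : lift (0 : 'I_3) i = if i == 0 then 1 else ord_max.
  by apply: val_inj; case: i => [[|[]]].
have l1 (i : 'I_2) : lift (1 : 'I_3) i = if i == 0 then 0 else ord_max.
  by apply: val_inj; case: i => [[|[]]].
have l2 (i : 'I_2) : lift (ord_max : 'I_3) i = if i == 0 then 0 else 1.
  by apply: val_inj; case: i => [[|[]]].
rewrite (expand_det_row _ ord0) (bigD1 0) // (bigD1 1) // (bigD1 ord_max) //=.
rewrite big1 ?addr0; last by move=> [[|[|[|]]]].
have rc i j : row' i (col' j M) = mxsub (lift i) (lift j) M.
  by apply/matrixP => a b; rewrite !mxE.
rewrite /cofactor !rc !E !(l0, l1, l2) /=.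
rewrite expr2 expr1 expr0; ring.
Qed.

Lemma det_lcross x y z :
  \det (row_mx x (row_mx y z) : 'M[R]_3) = mink (lcross x y) z.
Proof.
rewrite det3; set M : 'M[R]_3 := row_mx x (row_mx y z).
have M0 i : M i 0 = x i 0.
  rewrite -(row_mxEl x (row_mx y z) i 0) /M; congr (fun_of_matrix _ _ _).
  exact: val_inj.
have M1 i : M i 1 = y i 0.
  rewrite -(row_mxEl y z i 0) -(row_mxEr x (row_mx y z) i).
  by rewrite /M; congr (fun_of_matrix _ _ _); exact: val_inj.
have M2 i : M i ord_max = z i 0.
  rewrite -(row_mxEr y z i 0) -(row_mxEr x (row_mx y z) i).
  by rewrite /M; congr (fun_of_matrix _ _ _); exact: val_inj.
by rewrite !(M0, M1, M2) minkE !vec3E; ring.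
Qed.

Lemma sideE p u x : side p u x = mink (lcross p u) x.
Proof. by rewrite /side det_lcross !minkE !vec3E; ring. Qed.

(** ** The Lie algebra as Minkowski space *)

Definition hat v : 'M[R]_3 := \matrix_(i, j) (lcross v (delta_mx j 0)) i 0.

Lemma mx3P (A B : 'M[R]_3) : (forall x : 'cV[R]_3, A *m x = B *m x) -> A = B.
Proof.
move=> H; apply/matrixP => i j.
by have /matrixP/(_ i 0) := H (delta_mx j 0); rewrite -!colE !mxE.
Qed.

Lemma hatE v x : hat v *m x = lcross v x.
Proof.
have -> : lcross v x = \sum_j x j 0 *: lcross v (delta_mx j 0).
  rewrite {1}(_ : x = \sum_j x j 0 *: delta_mx j 0); last first.
    rewrite [LHS]matrix_sum_delta; apply: eq_bigr => i _.
    by rewrite big_ord1.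
  rewrite (big_morph (lcross v) (id1 := 0) (op1 := +%R)).
  - by apply: eq_bigr => i _; rewrite lcrossZr.
  - by move=> a b; rewrite lcrossDr.
  - by rewrite -[X in lcross v X](scale0r v) lcrossZr scale0r.
apply/matrixP => i j; rewrite (ord1 j) !mxE summxE.
by apply: eq_bigr => k _; rewrite !mxE mulrC.
Qed.

Lemma hatD v w : hat (v + w) = hat v + hat w.
Proof. by apply: mx3P => x; rewrite mulmxDl !hatE lcrossDl. Qed.
Lemma hatN v : hat (- v) = - hat v.
Proof. by apply: mx3P => x; rewrite mulNmx !hatE lcrossNl. Qed.
Lemma hatZ s v : hat (s *: v) = s *: hat v.
Proof. by apply: mx3P => x; rewrite -scalemxAl !hatE lcrossZl. Qed.

Lemma mink_mul A x y : mink (A *m x) y = (x^T *m A^T *m @Jmx R *m y) 0 0.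
Proof. by rewrite /mink trmx_mul. Qed.

Lemma so21P X : so21 X <-> forall x y, mink (X *m x) y = - mink x (X *m y).
Proof.
have E x y : mink (X *m x) y + mink x (X *m y) =
    (x^T *m (X^T *m @Jmx R + @Jmx R *m X) *m y) 0 0.
  by rewrite mink_mul /mink mulmxDr mulmxDl [RHS]mxE !mulmxA.
split=> [X0 x y|H].
  by apply/eqP; rewrite -addr_eq0 E X0 mulmx0 mul0mx mxE.
rewrite /so21 /=; apply/matrixP => i j; rewrite [RHS]mxE.
have := E (delta_mx i 0) (delta_mx j 0).
rewrite H addNr trmx_delta -rowE -colE => e.
by rewrite [RHS]e [RHS]mxE [RHS]mxE.
Qed.

Lemma so21_hat v : so21 (hat v).
Proof. by apply/so21P => x y; rewrite !hatE !minkE !vec3E; ring. Qed.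

(** The columns of an antisymmetric map are determined by three numbers. *)
Lemma so21_hatP X : so21 X -> exists v, X = hat v.
Proof.
move=> /so21P H.
pose e0 := vec3 1 0 0; pose e1 := vec3 0 1 0; pose e2 := vec3 0 0 1.
have X00 := H e0 e0; have X11 := H e1 e1; have X22 := H e2 e2.
have X01 := H e0 e1; have X12 := H e1 e2; have X02 := H e0 e2.
pose X0 := X *m e0; pose X1 := X *m e1; pose X2 := X *m e2.
exists (vec3 (- X1 ord_max 0) (X0 ord_max 0) (X0 1 0)).
have E x : x = x 0 0 *: e0 + x 1 0 *: e1 + x ord_max 0 *: e2.
  by apply: vec3P; rewrite !mxE /=; ring.
apply: mx3P => x; rewrite (E x) !mulmxDr -!scalemxAr -/X0 -/X1 -/X2 !hatE.
move: X00 X11 X22 X01 X12 X02; rewrite -/X0 -/X1 -/X2 !minkE /e0 /e1 /e2 !vec3E.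
move: X0 X1 X2 => X0 X1 X2 h00 h11 h22 h01 h12 h02.
have e10 : X1 0 0 = - X0 1 0 by lra.
have e20 : X2 0 0 = X0 ord_max 0 by lra.
have e21 : X2 1 0 = X1 ord_max 0 by lra.
have e00 : X0 0 0 = 0 by lra.
have e11 : X1 1 0 = 0 by lra.
have e22 : X2 ord_max 0 = 0 by lra.
apply: vec3P; rewrite !(vec3E, mxE) /= ?e00 ?e11 ?e22 ?e10 ?e20 ?e21; ring.
Qed.

Lemma inf_translationE p u : inf_translation p u = hat (lcross p u).
Proof.
have dc : is_derive (0 : R) 1 (@cosh R) 0.
  rewrite /cosh; apply: is_derive_eq.
  rewrite !(oppr0, expR0); rewrite /GRing.scale /=; ring.
have ds : is_derive (0 : R) 1 (@sinh R) 1.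
  rewrite /sinh; apply: is_derive_eq.
  by rewrite !(oppr0, expR0) /GRing.scale /=; field.
apply: (@mx3P (inf_translation p u)) => x; rewrite hatE lcrossA.
set M := u *m (u^T *m Jmx R) - p *m (p^T *m Jmx R).
set N := p *m (u^T *m Jmx R) - u *m (p^T *m Jmx R).
have -> : inf_translation p u = N.
  apply/matrixP => i j; rewrite mxE derive1E.
  have -> : (fun t => translation p u t i j) =
     cst ((1%:M : 'M[R]_3) i j) + (@cosh R - cst 1) * cst (M i j) + @sinh R * cst (N i j).
    apply/funext => t; rewrite /translation -/M -/N.
    by rewrite !fctE !mxE.
  apply: derive_val; apply: is_derive_eq.
  by rewrite /cst /GRing.scale /=; ring.
have E (a b : 'cV[R]_3) : a *m (b^T *m Jmx R) *m x = mink b x *: a.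
  by rewrite -mulmxA (mx11_scalar (_ *m x)) -/(mink b x) mul_mx_scalar.
by rewrite /N mulmxBl !E.
Qed.

(** ** Isometries *)

Section Isometry.
Variable A : 'M[R]_3.
Hypothesis SA : SO21 A.

Lemma SO21_mink x y : mink (A *m x) (A *m y) = mink x y.
Proof.
by case: SA => e _ _; rewrite /mink trmx_mul -[in RHS]e !mulmxA.
Qed.

Lemma SO21_unit : A \in unitmx.
Proof. by case: SA => _ d _; rewrite unitmxE d unitr1. Qed.

Lemma SO21_lcross x y : lcross (A *m x) (A *m y) = A *m lcross x y.
Proof.
apply: mink_nondeg => z.
have -> : z = A *m (invmx A *m z) by rewrite mulKVmx // SO21_unit.
rewrite SO21_mink -!det_lcross -!mul_mx_row det_mulmx.
by case: SA => _ -> _; rewrite mul1r.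
Qed.

Lemma Ad_hat v : Ad A (hat v) = hat (A *m v).
Proof.
apply: mx3P => x; rewrite /Ad -!mulmxA !hatE -SO21_lcross.
by rewrite mulKVmx // SO21_unit.
Qed.

End Isometry.

(** ** The hyperboloid and the cone over it *)

Definition cone : set 'cV[R]_3 := [set x | mink x x < 0 /\ 0 < x ord_max 0].

Lemma hyp_cone x : hyperboloid x -> cone x.
Proof. by move=> [xx x0]; split => //; rewrite xx; lra. Qed.

Lemma cauchy2 (a b c d : R) : (a * c + b * d) ^+ 2 <=
  (a ^+ 2 + b ^+ 2) * (c ^+ 2 + d ^+ 2).
Proof. by have := sqr_ge0 (a * d - b * c); nra. Qed.

Lemma cone_mink_lt0 x y : cone x -> cone y -> mink x y < 0.
Proof.
rewrite /cone /= !minkE; have := cauchy2 (x 0 0) (x 1 0) (y 0 0) (y 1 0).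
move: (x 0 0) (x 1 0) (x ord_max 0) (y 0 0) (y 1 0) (y ord_max 0).
move=> a b c d e f h [h1 c0] [h2 f0].
have cf : 0 < c * f by exact: mulr_gt0.
rewrite subr_lt0; case: (ltrP (a * d + b * e) (c * f)) => // le.
have : (c * f) ^+ 2 <= (a * d + b * e) ^+ 2 by rewrite lerXn2r // nnegrE; lra.
have : (a ^+ 2 + b ^+ 2) * (d ^+ 2 + e ^+ 2) < c ^+ 2 * f ^+ 2.
  apply: ltr_pM; rewrite ?addr_ge0 ?sqr_ge0 //; lra.
by rewrite exprMn; lra.
Qed.

Lemma coneZ s x : 0 < s -> cone x -> cone (s *: x).
Proof.
move=> s0 [xx x0]; split; last by rewrite mxE mulr_gt0.
by rewrite !minklin !pmulr_rlt0.
Qed.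

Lemma coneD x y : cone x -> cone y -> cone (x + y).
Proof.
move=> cx cy; have xy := cone_mink_lt0 cx cy.
case: cx cy => xx x0 [yy y0]; split; last by rewrite mxE addr_gt0.
by rewrite !minklin (minkC y x); lra.
Qed.

Lemma cone_conv s t x y : 0 <= s -> 0 <= t -> 0 < s + t -> cone x -> cone y ->
  cone (s *: x + t *: y).
Proof.
rewrite !le_eqVlt => /predU1P[<-|s0] /predU1P[<-|t0] st cx cy.
- by move: st; rewrite addr0 ltxx.
- by rewrite scale0r add0r; exact: coneZ.
- by rewrite scale0r addr0; exact: coneZ.
- by apply: coneD; exact: coneZ.
Qed.

(** Orthogonality to the timelike vector [y] bounds the last coordinate of [w]
    by the horizontal ones, by the Cauchy-Schwarz inequality in the plane. *)
Lemma mink_orth_ge0 y w : cone y -> mink w y = 0 -> 0 <= mink w w.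
Proof.
rewrite /cone /= !minkE; have := cauchy2 (w 0 0) (w 1 0) (y 0 0) (y 1 0).
move: (w 0 0) (w 1 0) (w ord_max 0) (y 0 0) (y 1 0) (y ord_max 0).
move=> a b c d e f h [h1 f0] h2.
have e1 : a * d + b * e = c * f by lra.
rewrite e1 in h.
have [ab|ab] := lerP (c ^+ 2) (a ^+ 2 + b ^+ 2); first lra.
exfalso; have : (a ^+ 2 + b ^+ 2) * (d ^+ 2 + e ^+ 2) < c ^+ 2 * f ^+ 2.
  by apply: ltr_pM; rewrite ?addr_ge0 ?sqr_ge0 //; lra.
by move: h; rewrite exprMn; lra.
Qed.

Lemma mink_orth_eq0 y w : cone y -> mink w y = 0 -> mink w w = 0 -> w = 0.
Proof.
rewrite /cone /= !minkE; have := cauchy2 (w 0 0) (w 1 0) (y 0 0) (y 1 0).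
move=> h [h1 f0] h2 h3.
have e1 : w 0 0 * y 0 0 + w 1 0 * y 1 0 = w ord_max 0 * y ord_max 0 by lra.
have c0 : w ord_max 0 = 0.
  apply/eqP; rewrite -sqrf_eq0 eq_le sqr_ge0 andbT.
  rewrite e1 in h.
  move: (w 0 0) (w 1 0) (w ord_max 0) (y 0 0) (y 1 0) (y ord_max 0) h h1 h3 f0 {e1 h2}.
  move=> a b c d e f h h1 h3 f0.
  rewrite (_ : a ^+ 2 + b ^+ 2 = c ^+ 2) in h; last by lra.
  have : 0 < f ^+ 2 - (d ^+ 2 + e ^+ 2) by lra.
  move=> k0; rewrite -(pmulr_lle0 _ k0); nra.
by apply: vec3P; rewrite mxE //; move: h3; rewrite c0 => h3; apply/eqP;
  rewrite -sqrf_eq0 eq_le sqr_ge0 andbT; have := sqr_ge0 (w 0 0);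
  have := sqr_ge0 (w 1 0); lra.
Qed.

(** Up to sign, the left-hand side is the hyperbolic cosine of a distance. The
    component of [y] orthogonal to [x] is spacelike. *)
Lemma hyp_mink_le x y : hyperboloid x -> hyperboloid y -> mink x y <= -1.
Proof.
move=> hx hy; have xy := cone_mink_lt0 (hyp_cone hx) (hyp_cone hy).
have := @mink_orth_ge0 x (y + mink x y *: x) (hyp_cone hx).
case: hx hy => xx x0 [yy y0]; rewrite !minklin xx yy (minkC y x) => H.
have /H : mink x y + mink x y * -1 = 0 by ring.
by nra.
Qed.

(** The triangle inequality, in the form [cosh (a + b) <= 2 * cosh a * cosh b]
    which avoids distances. The components [x'] and [z'] orthogonal to [y] live
    in a definite plane, and the norm of [b *: x' + a *: z'] is nonnegative. *)
Lemma hyp_triangle x y z : hyperboloid x -> hyperboloid y -> hyperboloid z ->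
  - mink x z <= 2 * (- mink x y) * (- mink y z).
Proof.
move=> hx hy hz; have hxy := hyp_mink_le hx hy; have hyz := hyp_mink_le hy hz.
set a := mink x y in hxy *; set b := mink y z in hyz *.
have cy := hyp_cone hy.
pose x' := x + a *: y; pose z' := z + b *: y.
have [xx _] := hx; have [yy _] := hy; have [zz _] := hz.
have x'y : mink x' y = 0 by rewrite !minklin yy -/a; ring.
have z'y : mink z' y = 0 by rewrite !minklin yy (minkC z y) -/b; ring.
have xx' : mink x' x' = a ^+ 2 - 1.
  by rewrite /x' !minklin xx yy (minkC y x) -/a; ring.
have zz' : mink z' z' = b ^+ 2 - 1.
  by rewrite /z' !minklin zz yy (minkC z y) -/b; ring.
have xz' : mink x' z' = mink x z + a * b.
  by rewrite /x' /z' !minklin yy -/a -/b; ring.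
clearbody x' z'.
have := @mink_orth_ge0 y (b *: x' + a *: z') cy.
rewrite !minklin (minkC z' x') x'y z'y xx' zz' xz' !mulr0 addr0 => /(_ erefl) H; clearbody a b; set m := mink x z in H *; clearbody m.
have ab : 1 <= a * b by nra.
rewrite -(@ler_pM2l _ (2 * (a * b))); last lra.
have := sqr_ge0 a; have := sqr_ge0 b; nra.
Qed.

Lemma hyp_conv_le1 s t x y : hyperboloid x -> hyperboloid y -> 0 <= s -> 0 <= t ->
  hyperboloid (s *: x + t *: y) -> s + t <= 1.
Proof.
move=> hx hy s0 t0 hz; have xy := hyp_mink_le hx hy.
have := hz.1; rewrite !minklin hx.1 hy.1 (minkC y x) => e.
have : (s + t) ^+ 2 <= 1 by have := mulr_ge0 s0 t0; nra.
by rewrite -[X in _ <= X](expr1n _ 2) ler_pXn2r ?nnegrE ?addr_ge0.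
Qed.

Lemma hyp_lcross_neq0 x y : hyperboloid x -> hyperboloid y -> x <> y -> lcross x y <> 0.
Proof.
move=> hx hy xy c0; apply: xy; apply/eqP; rewrite -subr_eq0; apply/eqP.
have := hyp_mink_le hx hy => xy1.
have := mink_lcross2 x y x y; rewrite c0 mink0l hx.1 hy.1 (minkC y x) => e.
have exy : mink x y = -1 by nra.
have cxy : cone (x + y) by apply: coneD; exact: hyp_cone.
apply: (mink_orth_eq0 cxy); rewrite !minklin (minkC y x) hx.1 hy.1 ?exy; ring.
Qed.

Definition normalize x := (Num.sqrt (- mink x x))^-1 *: x.

Lemma normalize_gt0 x : cone x -> 0 < (Num.sqrt (- mink x x))^-1.
Proof. by move=> [xx _]; rewrite invr_gt0 sqrtr_gt0; lra. Qed.

Lemma normalize_hyp x : cone x -> hyperboloid (normalize x).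
Proof.
move=> cx; have := normalize_gt0 cx; case: cx => xx x0 n0; split.
  rewrite !minklin mulrA -expr2 exprVn sqr_sqrtr; last lra.
  by rewrite -[X in _ * X]opprK mulrN mulVf //; apply/eqP; lra.
by rewrite !mxE mulr_gt0.
Qed.

Lemma normalize_id x : hyperboloid x -> normalize x = x.
Proof. by move=> [xx _]; rewrite /normalize xx opprK sqrtr1 invr1 scale1r. Qed.

(** A conic which is contained in no plane meets each plane in at most two
    points, so some point of it avoids all the given planes. *)
Lemma generic_point (ms : seq 'cV[R]_3) : (forall m, m \in ms -> m != 0) ->
  exists z, [/\ hyperboloid z, z ord_max 0 <= 2 & forall m, m \in ms -> mink m z != 0].
Proof.
move=> ms0.
pose P (m : 'cV[R]_3) : {poly R} := (m 0 0)%:P * 'X + (m 1 0)%:P * 'X^2 - (2 * m ord_max 0)%:P.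
have P0 m : m != 0 -> P m != 0.
  apply: contra_neq => e; have c i : (P m)`_i = 0 by rewrite e coef0.
  have := c 0; have := c 1%N; have := c 2.
  rewrite /P !(coefD, coefN, coefCM, coefC, coefX, coefXn) /= => *.
  by apply: vec3P; rewrite mxE; lra.
pose Q := \prod_(m <- ms) P m.
have Q0 : Q != 0.
  by rewrite prodf_seq_neq0; apply/allP => m mm; exact/P0/ms0.
pose f (i : nat) : R := (i.+2%:R)^-1.
have finj : injective f.
  by move=> i j /invr_inj/eqP; rewrite eqr_nat => /eqP[].
have [i Qi] : exists i, ~~ root Q (f i).
  apply: contrapT => H.
  have all_roots : all (root Q) [seq f i | i <- iota 0 (size Q)].
    by apply/allP => _ /mapP[i _ ->]; apply: contrapT => /negP ri; apply: H; exists i.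
  have := max_poly_roots Q0 all_roots.
  by rewrite map_inj_uniq // iota_uniq size_map size_iota ltnn => /(_ isT).
set t := f i in Qi.
have t0 : 0 < t by rewrite invr_gt0 ltr0n.
have t1 : t < 1 by rewrite invf_lt1 ?ltr0n // ltr1n.
pose z := vec3 t (t ^+ 2) 2.
have tt : t ^+ 2 < 1 by rewrite expr_lt1 // ltW.
have tt0 : 0 < t ^+ 2 by rewrite exprn_gt0.
have tt4 : t ^+ 2 * t ^+ 2 < 1 by nra.
have zz : - mink z z = 4 - t ^+ 2 - t ^+ 2 * t ^+ 2.
  by rewrite minkE !vec3E; ring.
have cz : cone z by split; rewrite ?vec3E //; lra.
have n0 := normalize_gt0 cz.
exists (normalize z); split; first exact: normalize_hyp.
  rewrite mxE vec3E -[X in _ <= X]mul1r ler_pM2r // invf_le1 ?sqrtr_gt0; last lra.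
  by rewrite -[X in X <= _]sqrtr1 ler_sqrt; lra.
move=> m mm; rewrite minkZr mulf_eq0 negb_or gt_eqF //=.
move: Qi; apply: contra => /eqP e.
rewrite /Q /root horner_prod prodf_seq_eq0; apply/hasP; exists m => //=.
have -> : (P m).[t] = mink m z; last by apply/eqP.
by rewrite /P !(hornerD, hornerN, hornerM, hornerC, hornerXn, hornerX) minkE !vec3E; ring.
Qed.

Definition apex : 'cV[R]_3 := vec3 0 0 1.

Lemma apex_hyp : hyperboloid apex.
Proof. by rewrite /hyperboloid /= minkE !vec3E; split; [ring|lra]. Qed.

Lemma mink_apex x : mink apex x = - x ord_max 0.
Proof. by rewrite minkE !vec3E; ring. Qed.

(** A timelike vector is in the cone or opposite to a vector of the cone, and
    pairings of vectors of the cone are negative. *)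
Lemma mink_lt0_cone y z : cone z -> mink y y < 0 -> mink z y < 0 -> cone y.
Proof.
move=> cz yy zy; split=> //; rewrite ltNge; apply/negP => y0.
have [y00|y00] := eqVneq (y ord_max 0) 0.
  by move: yy; rewrite minkE y00; nra.
suff /(cone_mink_lt0 cz) : cone (- y) by rewrite !minklin; lra.
by split; [rewrite !minklin; lra | rewrite mxE oppr_gt0 lt_neqAle y00].
Qed.

(** Preserving the form leaves the choice of a sheet of the hyperboloid, which is
    decided at the apex by the sign of the last diagonal entry. *)
Lemma hyp_mul A x : SO21 A -> hyperboloid x -> hyperboloid (A *m x).
Proof.
move=> SA hx; have Axx : mink (A *m x) (A *m x) = -1.
  by rewrite SO21_mink //; case: hx.
have cA : cone (A *m apex).
  split; first by rewrite SO21_mink //; have [-> _] := apex_hyp; lra.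
  have [_ _] := SA; congr (0 < _).
  rewrite mxE (bigD1 ord_max) //= big1 ?addr0 ?vec3E ?mulr1 //.
  by move=> [[|[|[|//]]] ?] // _; rewrite mxE /= mulr0.
suff : cone (A *m x) by move=> [].
apply: (mink_lt0_cone cA); first by rewrite Axx; lra.
by rewrite SO21_mink //; apply: cone_mink_lt0; apply: hyp_cone => //; exact: apex_hyp.
Qed.

Lemma SO21_inv A : SO21 A -> SO21 (invmx A).
Proof.
move=> SA; have [e d A0] := SA; have uA := SO21_unit SA.
have JJ : Jmx R *m Jmx R = 1%:M.
  apply/matrixP => i j; rewrite /Jmx mul_diag_mx !mxE.
  by case: (i == j); case: (i == ord_max); rewrite /= ?mulr1n ?mulr0n ?mulr0 ?mulr1 ?mulN1r ?opprK.
have iA : invmx A = Jmx R *m A^T *m Jmx R.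
  apply: (can_inj (mulmxK uA)).
  by rewrite mulVmx // -!mulmxA [A^T *m _]mulmxA e JJ.
split; last 2 first.
- by rewrite det_inv d invr1.
- by rewrite iA /Jmx mul_mx_diag mxE mul_diag_mx !mxE eqxx mulrN1 mulN1r opprK.
rewrite -[in LHS]e -!mulmxA mulmxV // mulmx1 !mulmxA -trmx_mul mulmxV //.
by rewrite trmx1 mul1mx.
Qed.

(** ** Geodesics *)

Lemma coshN t : cosh (- t) = cosh t :> R.
Proof. by rewrite /cosh opprK addrC. Qed.
Lemma sinhN t : sinh (- t) = - sinh t :> R.
Proof. by rewrite /sinh opprK; field. Qed.
Lemma cosh0 : cosh 0 = 1 :> R.
Proof. by rewrite /cosh oppr0 expR0; field. Qed.
Lemma sinh0 : sinh 0 = 0 :> R.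
Proof. by rewrite /sinh oppr0 expR0; field. Qed.
Lemma cosh_ge1 t : 1 <= cosh t :> R.
Proof.
have := cosh2_sinh2 t; have : 0 < cosh t :> R.
  by rewrite /cosh divr_gt0 // addr_gt0 // expR_gt0.
have := sqr_ge0 (sinh t); nra.
Qed.
Lemma sinh_gt0 t : (0 < sinh t :> R) = (0 < t).
Proof.
rewrite /sinh pmulr_lgt0 ?invr_gt0 // subr_gt0 ltr_expR.
by apply/idP/idP; lra.
Qed.

Lemma sinh_eq0 t : sinh t = 0 :> R -> t = 0.
Proof.
move=> t0; case: (ltgtP t 0) => // [lt|].
  by have := sinh_gt0 (- t); rewrite sinhN t0 oppr0 ltxx; lra.
by rewrite -sinh_gt0 t0 ltxx.
Qed.

Lemma is_derive_cosh0 : is_derive (0 : R) 1 (@cosh R) 0.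
Proof.
rewrite /cosh; apply: is_derive_eq.
by rewrite !(oppr0, expR0) /GRing.scale /=; ring.
Qed.

Lemma is_derive_sinh0 : is_derive (0 : R) 1 (@sinh R) 1.
Proof.
rewrite /sinh; apply: is_derive_eq.
by rewrite !(oppr0, expR0) /GRing.scale /=; field.
Qed.

Lemma continuous_cosh : continuous (@cosh R).
Proof.
move=> t; rewrite /cosh; apply: cvgM; last exact: cvg_cst.
apply: cvgD; first exact: continuous_expR.
apply: continuous_comp; [exact: opp_continuous | exact: continuous_expR].
Qed.

Lemma continuous_sinh : continuous (@sinh R).
Proof.
move=> t; rewrite /sinh; apply: cvgM; last exact: cvg_cst.
apply: cvgB; first exact: continuous_expR.
apply: continuous_comp; [exact: opp_continuous | exact: continuous_expR].
Qed.

Lemma sinh_sub0 s t : cosh s * sinh t - sinh s * cosh t = sinh (t - s).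
Proof. by rewrite sinhD coshN sinhN; ring. Qed.

(** The velocity of the geodesic at time [t]. *)
Definition gtan p u t : 'cV[R]_3 := sinh t *: p + cosh t *: u.

Section Geodesic.
Variables p u : 'cV[R]_3.
Hypothesis pu : unit_tangent p u.

Lemma ut_mink : (mink p p = -1) * (mink p u = 0) * (mink u p = 0) *
  (mink u u = 1).
Proof. by case: pu => [[pp _] p0 uu]; rewrite (minkC u p). Qed.

Lemma unit_tangent_N : unit_tangent p (- u).
Proof. by case: pu => [hp p0 uu]; split; rewrite ?minklin ?p0 ?uu ?oppr0 ?opprK. Qed.

Lemma gtan_ut t : unit_tangent (geodesic p u t) (gtan p u t).
Proof.
have c2 := cosh2_sinh2 t.
have gg : mink (geodesic p u t) (geodesic p u t) = -1.
  by rewrite /geodesic !minklin !ut_mink; lra.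
have [hp _ _] := pu; split.
- split=> //; have gp : mink p (geodesic p u t) < 0.
    by rewrite /geodesic !minklin !ut_mink; have := cosh_ge1 t; lra.
  suff : cone (geodesic p u t) by move=> [].
  by apply: (mink_lt0_cone (hyp_cone hp)) => //; rewrite gg; lra.
- by rewrite /geodesic /gtan !minklin !ut_mink; lra.
- by rewrite /gtan !minklin !ut_mink; lra.
Qed.

Lemma geodesic_hyp t : hyperboloid (geodesic p u t).
Proof. by case: (gtan_ut t). Qed.

Lemma geodesic0 : geodesic p u 0 = p.
Proof. by rewrite /geodesic cosh0 sinh0 scale1r scale0r addr0. Qed.

Lemma geodesicD s t :
  geodesic (geodesic p u s) (gtan p u s) t = geodesic p u (s + t).
Proof.
by rewrite /geodesic /gtan coshD sinhD; apply/matrixP => i j; rewrite !mxE; ring.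
Qed.

Lemma geodesicNE t : geodesic p (- u) t = geodesic p u (- t).
Proof. by rewrite /geodesic coshN sinhN scalerN scaleNr. Qed.

Lemma lcross_gtan t : lcross (geodesic p u t) (gtan p u t) = lcross p u.
Proof.
rewrite /geodesic /gtan !lcrosslin !lcrossxx (lcrossC u p).
transitivity ((cosh t ^+ 2 - sinh t ^+ 2) *: lcross p u).
  by apply/matrixP => i j; rewrite !mxE; ring.
by rewrite cosh2_sinh2 scale1r.
Qed.

Let n := lcross p u.

Lemma normal_mink : (mink n n = 1) * (mink n p = 0) * (mink n u = 0) *
  (mink p n = 0) * (mink u n = 0).
Proof.
have nn : mink n n = 1 by rewrite /n mink_lcross2 !ut_mink; ring.
have np : mink n p = 0 by exact: mink_lcrossl.
have nu : mink n u = 0 by exact: mink_lcrossr.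
by rewrite (minkC p n) (minkC u n).
Qed.

Lemma normal_geodesic t : mink n (geodesic p u t) = 0.
Proof. by rewrite /geodesic !minklin !normal_mink; ring. Qed.

(** Expand the triple product of [n], [w] and [n] in two ways. *)
Lemma frame_decomp w :
  w = - mink w p *: p + mink w u *: u + mink w n *: n.
Proof.
have := lcrossA n w n; rewrite (lcrossA p u w) !lcrosslin.
rewrite !(lcrossC _ n) /n !lcrossA -/n !ut_mink !normal_mink => e.
rewrite (minkC w p) (minkC w u).
have {e} : mink p w *: p - mink u w *: u = mink w n *: n - w.
  by rewrite -[RHS]/(_ - _) -[X in _ - X]scale1r -e; apply/matrixP => i j; rewrite !mxE; ring.
by move=> /matrixP e; apply/matrixP => i j; have := e i j; rewrite !mxE; lra.
Qed.

Lemma geodesicP x : hyperboloid x -> mink n x = 0 -> exists t, x = geodesic p u t.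
Proof.
move=> hx nx; have := frame_decomp x; rewrite (minkC x n) nx scale0r addr0.
set a := - mink x p; set b := mink x u => ex.
have [hp _ _] := pu.
have a1 : 1 <= a by have := hyp_mink_le hx hp; rewrite /a; lra.
have ab : a ^+ 2 - b ^+ 2 = 1.
  case: hx => xx _; move: xx; rewrite ex !minklin !ut_mink; lra.
have ab0 : 0 < a + b by nra.
have abV : (a + b)^-1 = a - b by apply: (mulfI (lt0r_neq0 ab0)); rewrite mulfV ?lt0r_neq0 //; lra.
exists (ln (a + b)); rewrite /geodesic /cosh /sinh expRN lnK ?posrE // abV ex.
by congr (_ *: _ + _ *: _); lra.
Qed.

Lemma geodesic_u t : mink (geodesic p u t) u = sinh t.
Proof. by rewrite /geodesic !minklin !ut_mink; ring. Qed.

Lemma geodesic_inj : injective (geodesic p u).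
Proof.
move=> s t e; have es : sinh s = sinh t by rewrite -!geodesic_u e.
have ec : cosh s = cosh t.
  by have := congr1 (mink p) e; rewrite /geodesic !minklin !ut_mink; lra.
suff /sinh_eq0 : sinh (t - s) = 0 :> R by move=> /eqP; rewrite subr_eq0 => /eqP.
by rewrite sinhD coshN sinhN es ec; ring.
Qed.

End Geodesic.

Lemma geodesic_mul A p u t : A *m geodesic p u t = geodesic (A *m p) (A *m u) t.
Proof. by rewrite /geodesic mulmxDr -!scalemxAr. Qed.

Lemma unit_tangent_mul A p u : SO21 A -> unit_tangent p u ->
  unit_tangent (A *m p) (A *m u).
Proof.
by move=> SA [hp pu uu]; split; rewrite ?SO21_mink //; exact: hyp_mul.
Qed.

(** Two points of a geodesic span its plane, which determines the unit normal up
    to sign. *)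
Lemma geodesic_normal p u q v s t s' t' : unit_tangent p u -> unit_tangent q v ->
  s != t -> geodesic p u s = geodesic q v s' -> geodesic p u t = geodesic q v t' ->
  lcross p u = lcross q v \/ lcross p u = - lcross q v.
Proof.
move=> pu qv st es et.
pose n := lcross p u; pose m := lcross q v.
have [ns nt] : mink m (geodesic p u s) = 0 /\ mink m (geodesic p u t) = 0.
  by rewrite es et !normal_geodesic.
have mp : mink m p = 0 /\ mink m u = 0.
  move: ns nt; rewrite /geodesic !minklin => ns nt.
  have d : cosh s * sinh t - sinh s * cosh t != 0.
    rewrite sinh_sub0; apply/eqP => /sinh_eq0 h.
    by move: st; rewrite -subr_eq0 -oppr_eq0 opprB h eqxx.
  split; apply: (mulfI d); rewrite mulr0.
    transitivity (sinh t * (cosh s * mink m p + sinh s * mink m u) -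
      sinh s * (cosh t * mink m p + sinh t * mink m u)); first ring.
    by rewrite ns nt; ring.
  transitivity (cosh s * (cosh t * mink m p + sinh t * mink m u) -
    cosh t * (cosh s * mink m p + sinh s * mink m u)); first ring.
  by rewrite ns nt; ring.
have := frame_decomp pu m; rewrite mp.1 mp.2 oppr0 !scale0r !add0r -/n => em.
have mm : mink m m = 1 by rewrite normal_mink.
have : (mink m n) ^+ 2 = 1.
  by have := mm; rewrite {2}em minkZr expr2.
move/eqP; rewrite sqrf_eq1 => /orP[] /eqP e; move: em; rewrite e ?scale1r ?scaleN1r -/m -/n.
  by left.
by move=> emn; right; rewrite emn opprK.
Qed.

(** In the cone, geodesic segments are the projections of line segments; this is
    how convexity in the hyperbolic plane is reduced to linear algebra. *)
Lemma geodesic_conv p u s t r : unit_tangent p u -> s <= r <= t -> s < t ->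
  exists a b, [/\ 0 <= a, 0 <= b, (s < r -> 0 < b), (r < t -> 0 < a) &
    geodesic p u r = a *: geodesic p u s + b *: geodesic p u t].
Proof.
move=> pu /andP[sr rt] st.
have d0 : 0 < sinh (t - s) by rewrite sinh_gt0 subr_gt0.
have sge0 (w : R) : 0 <= w -> 0 <= sinh w.
  by rewrite le_eqVlt => /predU1P[<-|w0]; rewrite ?sinh0 // ltW // sinh_gt0.
exists (sinh (t - r) / sinh (t - s)), (sinh (r - s) / sinh (t - s)); split.
- by apply: divr_ge0; apply: sge0; rewrite subr_ge0 // ltW.
- by apply: divr_ge0; apply: sge0; rewrite subr_ge0 // ltW.
- by move=> ?; rewrite divr_gt0 // sinh_gt0 subr_gt0.
- by move=> ?; rewrite divr_gt0 // sinh_gt0 subr_gt0.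
apply: (scalerI (lt0r_neq0 d0)); rewrite [RHS]scalerDr !scalerA.
have E (w : R) : sinh (t - s) * (w / sinh (t - s)) = w.
  by rewrite mulrC divfK // lt0r_neq0.
rewrite !E /geodesic.
apply/matrixP => i j; rewrite !mxE !sinhD !coshN !sinhN.
ring.
Qed.

End Lorentz.

(** * Continuity in Minkowski space *)

Section Continuity.
Variable R : realType.
Implicit Types (x y v : 'cV[R]_3) (A : 'M[R]_3).

#[local] Instance vec3_filter x : Filter (nbhs x).
Proof. exact: nbhs_filter. Qed.

Lemma cvg_vec3 (T : Type) (F : set_system T) {FF : Filter F} (f : T -> 'cV[R]_3) x :
  (forall i, (fun t => f t i 0) @ F --> x i 0) -> f @ F --> x.
Proof.
move=> H A /= [P Px PA].
have : \forall t \near F, forall i, P i 0 (f t i 0).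
  have h0 : \forall t \near F, P 0 0 (f t 0 0) by apply: (H 0); exact: Px.
  have h1 : \forall t \near F, P 1 0 (f t 1 0) by apply: (H 1); exact: Px.
  have h2 : \forall t \near F, P ord_max 0 (f t ord_max 0) by apply: (H ord_max); exact: Px.
  apply: filterS3 h0 h1 h2 => t h0 h1 h2 [[|[|[|//]]] hi].
  - by rewrite (_ : Ordinal hi = 0) //; exact: val_inj.
  - by rewrite (_ : Ordinal hi = 1) //; exact: val_inj.
  - by rewrite (_ : Ordinal hi = ord_max) //; exact: val_inj.
by apply: filterS => t ht; apply: PA => i j /=; rewrite (ord1 j).
Qed.

Lemma coord_cvg (T : Type) (F : set_system T) {FF : Filter F} (f : T -> 'cV[R]_3) x i :
  f @ F --> x -> (fun t => f t i 0) @ F --> x i 0.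
Proof. by move=> fx; exact: (cvg_comp _ _ fx (@coord_continuous R 3 1 i 0 x)). Qed.

Lemma mink_cvg (T : Type) (F : set_system T) {FF : Filter F} (f g : T -> 'cV[R]_3) x y :
  f @ F --> x -> g @ F --> y -> (fun t => mink (f t) (g t)) @ F --> mink x y.
Proof.
move=> fx gy; rewrite minkE; under eq_fun do rewrite minkE.
apply: cvgB; first apply: cvgD.
- by apply: cvgM; exact: coord_cvg.
- by apply: cvgM; exact: coord_cvg.
- by apply: cvgM; exact: coord_cvg.
Qed.

Lemma continuous_mink v : continuous (mink v).
Proof.
move=> x; have := @mink_cvg _ (nbhs x) _ (fun=> v) id v x (cvg_cst _) cvg_id.
exact.
Qed.

Lemma continuous_mulmx A : continuous (fun x => A *m x).
Proof.
move=> x; apply: (@cvg_vec3 _ (nbhs x)) => i; rewrite mxE.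
under eq_fun do rewrite mxE.
apply: cvg_big => [|j _]; [exact: add_continuous|apply: cvgM; first exact: cvg_cst].
exact: coord_continuous.
Qed.

Lemma cvg_scale (T : Type) (F : set_system T) {FF : Filter F} (k : T -> R)
    (f : T -> 'cV[R]_3) (a : R) x :
  k @ F --> a -> f @ F --> x -> (fun t => k t *: f t) @ F --> a *: x.
Proof.
move=> ka fx; apply: cvg_vec3 => i; rewrite mxE; under eq_fun do rewrite mxE.
by apply: cvgM => //; exact: coord_cvg.
Qed.

Lemma cvg_add (T : Type) (F : set_system T) {FF : Filter F}
    (f g : T -> 'cV[R]_3) x y :
  f @ F --> x -> g @ F --> y -> (fun t => f t + g t) @ F --> x + y.
Proof.
move=> fx gy; apply: cvg_vec3 => i; rewrite mxE; under eq_fun do rewrite mxE.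
by apply: cvgD => //; exact: coord_cvg.
Qed.

Lemma continuous_geodesic p u : continuous (@geodesic R p u).
Proof.
move=> t; apply: cvg_add; apply: cvg_scale; try exact: cvg_cst.
- exact: continuous_cosh.
- exact: continuous_sinh.
Qed.

Lemma continuous_normalize x : cone x -> {for x, continuous (@normalize R)}.
Proof.
move=> cx; have h := normalize_gt0 cx.
have c1 : mink y y @[y --> x] --> mink x x.
  exact: (@mink_cvg _ (nbhs x) _ id id x x cvg_id cvg_id).
have c2 : (fun y => Num.sqrt (- mink y y) : R) @ x --> (Num.sqrt (- mink x x) : R).
  exact: (cvg_comp (fun y => - mink y y) (@Num.sqrt R) (cvgN c1) (@sqrt_continuous R (- mink x x))).
have c3 : (fun y => (Num.sqrt (- mink y y))^-1 : R) @ x --> ((Num.sqrt (- mink x x))^-1 : R).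
  by apply: cvgV => //; move: h; rewrite invr_gt0 => /lt0r_neq0.
exact: (@cvg_scale _ (nbhs x) _ _ id _ x c3 cvg_id).
Qed.

Lemma near_cone x : cone x -> \forall y \near x, cone y.
Proof.
move=> [xx x0].
have h1 : \forall y \near x, mink y y < 0.
  have : mink y y @[y --> x] --> mink x x by exact: (@mink_cvg _ (nbhs x) _ id id x x cvg_id cvg_id).
  by move=> /cvgr_lt/(_ _ xx).
have h2 : \forall y \near x, 0 < (y : 'cV[R]_3) ord_max 0.
  by have /cvgr_gt/(_ _ x0) := @coord_continuous R 3 1 ord_max 0 x.
by apply: filterS2 h1 h2.
Qed.

(** Inverting the vertical projection presents a ball as a continuous image of a
    square. *)
Lemma ball_compact (r : R) : exists K : set 'cV[R]_3,
  [/\ compact K, K `<=` @hyperboloid R &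
     forall x, hyperboloid x -> x ord_max 0 <= r -> K x].
Proof.
pose f (z : R * R) : 'cV[R]_3 := vec3 z.1 z.2 (Num.sqrt (1 + z.1 ^+ 2 + z.2 ^+ 2)).
have cf : continuous f.
  move=> z; apply: (@cvg_vec3 _ (nbhs z)) => i; rewrite /f !mxE.
  under eq_fun do rewrite mxE.
  have c1 : fst z' @[z' --> z] --> z.1 by exact: cvg_fst.
  have c2 : snd z' @[z' --> z] --> z.2 by exact: cvg_snd.
  case: (i == 0) => //; case: (i == 1) => //.
  apply: continuous_comp; last exact: sqrt_continuous.
  apply: cvgD; last by under eq_fun do rewrite expr2; rewrite expr2; exact: cvgM.
  apply: cvgD; first exact: cvg_cst.
  by under eq_fun do rewrite expr2; rewrite expr2; exact: cvgM.
exists (f @` (`[-r, r]%classic `*` `[-r, r]%classic)); split.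
  apply: continuous_compact; first exact: continuous_subspaceT.
  by apply: compact_setX; exact: segment_compact.
  move=> _ [z _ <-]; have z0 : 0 < 1 + z.1 ^+ 2 + z.2 ^+ 2.
    by have := sqr_ge0 z.1; have := sqr_ge0 z.2; lra.
  split; last by rewrite /f vec3E sqrtr_gt0.
  by rewrite minkE /f !vec3E -!expr2 sqr_sqrtr ?(ltW z0) //; ring.
move=> x [xx x0] xr; exists (x 0 0, x 1 0); last first.
  move: xx; rewrite minkE => xx; apply: vec3P; rewrite /f vec3E //=.
  rewrite (_ : 1 + _ + _ = x ord_max 0 ^+ 2); last lra.
  by rewrite sqrtr_sqr ger0_norm // ltW.
move: xx; rewrite minkE /= !in_itv /= -!ler_norml => xx.
have H (a b : R) : 0 <= b -> a ^+ 2 <= b ^+ 2 -> `|a| <= b.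
  by move=> b0; rewrite -[X in X <= _]real_normK ?num_real // ler_pXn2r ?nnegrE.
split=> /=; apply: le_trans xr; apply: H; rewrite ?ltW //.
  by have := sqr_ge0 (x 1 0); lra.
by have := sqr_ge0 (x 0 0); lra.
Qed.

(** Apply the near-covering form of compactness to the filter of the sets of
    indices which contain a given finite set. *)
Lemma compact_finite (T : Type) (X : topologicalType) (f : T -> X) (K : set X) :
  compact K -> (forall z, K z -> exists2 U, nbhs z U & finite_set [set t | U (f t)]) ->
  finite_set [set t | K (f t)].
Proof.
move=> /compact_near_coveringP cK H.
pose F : set_system (set T) := [set P | exists2 B, finite_set B &
  forall C, finite_set C -> B `<=` C -> P C].
have FF : Filter F.
  split.
  - by exists set0.
  - move=> P Q [B fB hB] [C fC hC]; exists (B `|` C).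
      by rewrite finite_setU.
    by move=> D fD sD; split; [apply: hB|apply: hC] => // t ?; apply: sD; [left|right].
  - by move=> P Q PQ [B fB hB]; exists B => // C fC BC; exact/PQ/hB.
have [x /H [U xU fU]|B fB /(_ B fB (@subset_refl _ B)) KB] :=
  cK _ F (fun C z => f @^-1` [set z] `<=` C) FF.
  exists (U, [set C | finite_set C /\ [set t | U (f t)] `<=` C]) => /=.
    by split=> //; exists [set t | U (f t)] => // C fC sC; split.
  by move=> [y C] /= [Uy [_ sC]] t /= fty; apply: sC; rewrite /= fty.
by apply: sub_finite_set fB => t /KB; apply.
Qed.

End Continuity.

(** * Orbits in the hyperbolic plane *)

Section Orbit.
Variables (R : realType) (Gam : groupType) (rho : Gam -> 'M[R]_3).
Hypothesis rho_SO : forall a, SO21 (rho a).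
Hypothesis rhoM : forall a b, rho (a * b)%g = rho a *m rho b.

Lemma rho1 : rho 1%g = 1%:M.
Proof.
apply: (can_inj (mulKmx (SO21_unit (rho_SO 1%g)))).
by rewrite mulmx1 -rhoM mulg1.
Qed.

Lemma rhoK a : cancel (mulmx (rho a) : 'cV_3 -> 'cV_3) (mulmx (rho a^-1%g)).
Proof. by move=> x; rewrite mulmxA -rhoM mulVg rho1 mul1mx. Qed.

Lemma rhoVK a : cancel (mulmx (rho a^-1%g) : 'cV_3 -> 'cV_3) (mulmx (rho a)).
Proof. by move=> x; rewrite mulmxA -rhoM mulgV rho1 mul1mx. Qed.

(** [cdist a x] is the hyperbolic cosine of the distance from [x] to the point
    of index [a] in the orbit of the apex. *)
Definition cdist a (x : 'cV[R]_3) : R := - mink (rho a *m @apex R) x.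

Lemma cdistM a b x : cdist (a * b)%g (rho a *m x) = cdist b x.
Proof. by rewrite /cdist rhoM -mulmxA SO21_mink //; exact: rho_SO. Qed.

Lemma cdist1 x : cdist 1%g x = x ord_max 0.
Proof. by rewrite /cdist rho1 mul1mx mink_apex opprK. Qed.

Lemma orbit_hyp a : hyperboloid (rho a *m @apex R).
Proof. by apply: hyp_mul; [exact: rho_SO | exact: apex_hyp]. Qed.

Lemma cdist_ge1 a x : hyperboloid x -> 1 <= cdist a x.
Proof. by move=> hx; have := hyp_mink_le (orbit_hyp a) hx; rewrite /cdist; lra. Qed.

Lemma cdist_triangle a x y : hyperboloid x -> hyperboloid y ->
  cdist a y <= 2 * cdist a x * (- mink x y).
Proof. by move=> hx hy; exact: hyp_triangle (orbit_hyp a) hx hy. Qed.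

End Orbit.

(** * The action of the fundamental group on the hyperbolic plane *)

Section Covering.
Variables (R : realType) (S : topologicalType) (h : hyperbolic_structure R S).
Variables (C : universal_cover R S) (dev : cover_space C -> 'cV[R]_3).
Hypothesis hdev : developing_map h dev.

Lemma dev_hyp x : hyperboloid (dev x).
Proof. by case: hdev => [[fun_dev _ _] _]; exact: fun_dev. Qed.

Lemma dev_inj : injective dev.
Proof.
by case: hdev => [[_ inj_dev _] _] x y; apply: inj_dev; rewrite inE.
Qed.

Lemma dev_surj y : hyperboloid y -> exists x, dev x = y.
Proof. by case: hdev => [[_ _ surj_dev] _] /surj_dev[x _ <-]; exists x. Qed.

Lemma cover_proj_continuous : continuous (@proj _ _ C).
Proof. by case: (proj_covering C). Qed.

Lemma sheet (x : cover_space C) : exists V : set (cover_space C),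
  [/\ open V, V x, {in V &, injective (@proj _ _ C)} &
      forall W, open W -> W `<=` V -> open (@proj _ _ C @` W)].
Proof.
case: (proj_covering C) => _ _ /(_ (proj x))[U [oU Ux [I [V [VU Vd Vo]]]]].
have [i Vix] : exists i, V i x by apply/VU.
have [oV [_ injV _] imV] := Vo i.
by exists (V i); split.
Qed.

Lemma proj_open (W : set (cover_space C)) : open W -> open (@proj _ _ C @` W).
Proof.
move=> oW; rewrite openE => _ [x Wx <-].
have [V [oV Vx _ imV]] := sheet x.
rewrite /interior; apply: (@filterS _ _ _ (@proj _ _ C @` (W `&` V))).
  by move=> _ [y [Wy _] <-]; exists y.
apply: open_nbhs_nbhs; split; last by exists x.
by apply: imV; [exact: openI | exact: subIsetr].
Qed.

Lemma dev_local x i : chart_dom (h := h) i (proj x) ->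
  exists2 A, SO21 A & \forall y \near x, dev y = A *m chart (h := h) i (proj y).
Proof. by case: hdev => _; apply. Qed.

Lemma dev_continuous : continuous dev.
Proof.
move=> x; have [i ix] := chart_cover h (proj x).
have [A SA dA] := dev_local ix.
have e : dev x = A *m chart (h := h) i (proj x) by exact: nbhs_singleton dA.
have c1 : chart (h := h) i \o @proj _ _ C @ x --> chart (h := h) i (proj x).
  by apply: continuous_comp; [exact: cover_proj_continuous | exact: chart_continuous].
have c2 : (fun y => A *m chart (h := h) i (proj y)) @ x --> dev x.
  by rewrite e; apply: (cvg_comp _ _ c1); exact: continuous_mulmx.
apply: cvg_trans c2; apply: near_eq_cvg.
by apply: filterS dA => y ->.
Qed.

(** Charts are open onto the hyperboloid, and the developing map is locally a chart
    composed with an isometry. *)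
Lemma dev_open x (W : set (cover_space C)) : nbhs x W ->
  exists2 O : set 'cV[R]_3, nbhs (dev x) O & forall y, O y -> hyperboloid y ->
    exists2 z, W z & dev z = y.
Proof.
move=> xW; have [i ix] := chart_cover h (proj x).
have [A SA dA] := dev_local ix.
have xi : \forall y \near x, chart_dom (h := h) i (proj y).
  by apply: cover_proj_continuous; apply: open_nbhs_nbhs; split=> //; exact: chart_dom_open.
have : nbhs x (W `&` (fun y => dev y = A *m chart (h := h) i (proj y)) `&`
    (fun y => chart_dom (h := h) i (proj y))).
  by apply: filterI => //; exact: filterI.
rewrite nbhsE /= => -[U [oU Ux] UW].
have [] := @chart_open _ _ h i (@proj _ _ C @` U) (proj_open oU).
  by move=> _ [y Uy <-]; case: (UW y Uy).
move=> O oO OE.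
have uA := SO21_unit SA.
exists [set y | O (invmx A *m y)].
  apply: (@continuous_mulmx R (invmx A)); apply: open_nbhs_nbhs; split=> //.
  have : (O `&` @hyperboloid R) (chart (h := h) i (proj x)).
    by rewrite -OE; exists (proj x) => //; exists x.
  move=> [+ _]; congr O.
  by rewrite (nbhs_singleton dA : dev x = _) mulKmx.
move=> y /= Oy hy.
have : (O `&` @hyperboloid R) (invmx A *m y).
  by split=> //; apply: hyp_mul => //; exact: SO21_inv.
rewrite -OE => -[_ [z Uz <-] ez]; exists z; first by case: (UW z Uz) => -[].
by case: (UW z Uz) => -[_ /= -> _]; rewrite ez mulKVmx.
Qed.

(** Inverting the developing map on the whole cone, by homogeneity, makes the
    continuity of lifts of curves a matter of continuity in a vector space. *)
Lemma dev_inverse : exists psi : 'cV[R]_3 -> cover_space C,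
  [/\ forall y, cone y -> dev (psi y) = normalize y,
      forall x, psi (dev x) = x
    & forall y, cone y -> {for y, continuous psi}].
Proof.
have [x0 _] := dev_surj (@apex_hyp R).
have /choice[f fP] : forall y, exists x, hyperboloid y -> dev x = y.
  move=> y; have [/dev_surj[x <-]|n] := pselect (hyperboloid y); first by exists x.
  by exists x0.
have psiE y : cone y -> dev (f (normalize y)) = normalize y.
  by move=> cy; apply: fP; exact: normalize_hyp.
exists (f \o @normalize R); split=> [//|x|y cy W yW].
  have hx := dev_hyp x; apply: dev_inj.
  by rewrite /= psiE ?normalize_id //; exact: hyp_cone.
have [B yO OW] := dev_open yW; rewrite /= psiE // in yO.
have nO1 := continuous_normalize cy yO; have nO2 := near_cone cy.
have nO : nbhs y (fun z => B (normalize z) /\ cone z) by exact: (@filterI _ _ (nbhs_filter y) _ _ nO1 nO2).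
apply: (@filterS _ _ (nbhs_filter y) _ _ _ nO) => z [Oz cz] /=.
have [w Ww e] := OW _ Oz (normalize_hyp cz).
have fz : f (normalize z) = w by apply: dev_inj; rewrite psiE.
by rewrite fz.
Qed.

Variable rho : pi1 C -> 'M[R]_3.
Hypothesis hrho : holonomy dev rho.

Lemma rho_SO a : SO21 (rho a). Proof. by case: hrho. Qed.
Lemma rhoM a b : rho (a * b)%g = rho a *m rho b. Proof. by case: hrho. Qed.
Lemma dev_deck a x : dev (deck a x) = rho a *m dev x. Proof. by case: hrho. Qed.

Lemma deck_inj a b (x : cover_space C) : deck a x = deck b x -> a = b.
Proof.
move=> e; have : deck (b^-1 * a)%g x = x by rewrite deckM e -deckM mulVg deck1.
by move/deck_free => e1; rewrite -[b]mulg1 -e1 mulgA mulgV mul1g.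
Qed.

Lemma rho_free a y : hyperboloid y -> rho a *m y = y -> a = 1%g.
Proof.
by move=> /dev_surj[x <-]; rewrite -dev_deck => /dev_inj; exact: deck_free.
Qed.

(** Proper discontinuity: a sheet of the covering meets the orbit at most once,
    and finitely many sheets cover a ball. *)
Lemma cdist_finite x r : hyperboloid x -> finite_set [set a | cdist rho a x < r].
Proof.
move=> hx.
have fin0 s : finite_set [set a | cdist rho a (@apex R) < s].
  have [K [cK KH Ks]] := ball_compact s.
  have [x0 ex0] := dev_surj (@apex_hyp R).
  apply: (@sub_finite_set _ _ [set a | K (rho a *m @apex R)]).
    move=> a /= as_; apply: Ks; first exact: (orbit_hyp rho_SO).
    by move: as_; rewrite /cdist minkC mink_apex opprK => /ltW.
  apply: compact_finite cK _ => y /KH /dev_surj[z <-].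
  have [V [oV Vz injV _]] := sheet z.
  have [B zO OV] := dev_open (open_nbhs_nbhs (conj oV Vz)).
  exists B => //.
  have [[b Ob]|nO] := pselect (exists b, B (rho b *m @apex R)); last first.
    by apply: (sub_finite_set _ (finite_set0 _)) => a Oa; apply: nO; exists a.
  apply: (sub_finite_set _ (finite_set1 b)) => a /= Oa.
  have [za Va] := OV _ Oa (orbit_hyp rho_SO a).
  have [zb Vb] := OV _ Ob (orbit_hyp rho_SO b).
  rewrite -ex0 -!dev_deck => /dev_inj eb /dev_inj ea.
  apply: (@deck_inj _ _ x0); rewrite -ea -eb.
  by apply: injV; rewrite ?inE // ea eb !proj_deck.
apply: sub_finite_set (fin0 (2 * r * x ord_max 0)) => a /= ar.
have := hyp_triangle (orbit_hyp rho_SO a) hx (@apex_hyp R).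
rewrite -/(cdist rho a x) (minkC x) mink_apex opprK -/(cdist rho a _).
move=> /le_lt_trans; apply.
by case: hx => _ x0; rewrite ltr_pM2r // ltr_pM2l.
Qed.

Hypothesis S_compact : compact [set: S].

(** The images in the surface of the balls around the apex form an increasing open
    cover. *)
Lemma cobounded : exists r0, forall x, hyperboloid x -> exists a, cdist rho a x < r0.
Proof.
pose P (n : nat) s := exists2 x, proj x = s & dev x ord_max 0 < n%:R.
have /compact_near_coveringP/(_ _ \oo P) cS := S_compact.
have [|n _ /(_ n (leqnn n)) nP] := cS _.
  move=> s _; have [_ /(_ s)[x <-] _] := proj_covering C.
  pose n := (Num.truncn (dev x ord_max 0)).+1.
  have xn : dev x ord_max 0 < n%:R by exact: Num.Theory.truncnS_gt.
  exists (@proj _ _ C @` [set y | dev y ord_max 0 < n%:R]%O, [set m | (n <= m)%N]).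
    split=> /=; last by exists n.
    apply: open_nbhs_nbhs; split; last by exists x.
    apply: proj_open.
    apply: (@open_comp _ _ dev [set z : 'cV[R]_3 | z ord_max 0 < n%:R]).
      by move=> ? _; exact: dev_continuous.
    apply: (@open_comp _ _ (fun z : 'cV[R]_3 => z ord_max 0) [set z : R | z < n%:R]).
      by move=> ? _; exact: coord_continuous.
    exact: open_lt.
  move=> [_ m] /= [[y yn <-] nm]; exists y => //.
  by apply: (lt_le_trans yn); rewrite ler_nat.
exists n%:R => _ /dev_surj[x <-].
have [x' e x'n] := nP (proj x) I.
have [a ->] := deck_transitive e.
by exists a; rewrite dev_deck -[a in cdist rho a]mulg1 (cdistM rho_SO rhoM) (cdist1 rho_SO rhoM).
Qed.

End Covering.

(** * The power diagram of a cocycle *)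

Lemma seq_argmax (R : realType) (T : eqType) (f : T -> R) (s : seq T) a : a \in s ->
  exists2 b, b \in s & forall c, c \in s -> f c <= f b.
Proof.
elim: s a => // a s IH _ _.
case: s IH => [_|d s /(_ d (mem_head _ _))[b bs bmax]].
  by exists a; rewrite ?mem_head // => c; rewrite inE => /eqP->.
have [ab|/ltW ba] := lerP (f a) (f b).
  by exists b; [rewrite inE bs orbT | move=> c; rewrite inE => /predU1P[->//|/bmax]].
exists a; first exact: mem_head.
by move=> c; rewrite inE => /predU1P[->//|/bmax/le_trans]; exact.
Qed.

Section PowerDiagram.
Variables (R : realType) (Gam : groupType) (rho : Gam -> 'M[R]_3).
Hypothesis rho_SO : forall a, SO21 (rho a).
Hypothesis rhoM : forall a b, rho (a * b)%g = rho a *m rho b.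
Hypothesis fin : forall x r, hyperboloid x -> finite_set [set a | cdist rho a x < r].
Variable r0 : R.
Hypothesis cob : forall x, hyperboloid x -> exists a, cdist rho a x < r0.
Variable v : Gam -> 'cV[R]_3.
Hypothesis vM : forall a b, v (a * b)%g = rho a *m v b + v a.
Implicit Types (x y z : 'cV[R]_3) (a b c : Gam).

Let cd := cdist rho.

(** The orbit of [K *: apex] under the affine action of the group. *)
Definition site (K : R) a : 'cV[R]_3 := K *: (rho a *m @apex R) + v a.

Lemma siteM K a b : site K (a * b)%g = rho a *m site K b + v a.
Proof. by rewrite /site vM rhoM mulmxDr -scalemxAr mulmxA addrA. Qed.

Lemma mink_siteM K a b x :
  mink (site K (a * b)%g) (rho a *m x) = mink (site K b) x + mink (v a) (rho a *m x).
Proof. by rewrite siteM minkDl SO21_mink. Qed.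

Lemma cocycle1 : v 1%g = 0.
Proof.
have := vM 1%g 1%g; rewrite mulg1 (rho1 rho_SO rhoM) mul1mx => e.
by apply: (addIr (v 1%g)); rewrite add0r -e.
Qed.

Definition cell_radius : R := r0 + 1.
Definition rival_radius : R := 4 * cell_radius ^+ 3.

Lemma cell_radius_ge2 : 2 <= cell_radius.
Proof.
have [a ha] := cob (@apex_hyp R).
have := cdist_ge1 rho_SO a (@apex_hyp R); rewrite /cell_radius; lra.
Qed.

Lemma cell_rival_radius : 4 * cell_radius <= rival_radius.
Proof. by have r2_ := cell_radius_ge2; rewrite /rival_radius !exprS expr0; nra. Qed.

(** For [K] large, adding the vectors [v a] does not let a far site beat a near
    one. By equivariance the near orbit point may be taken to be the apex, and
    then only finitely many [v a] have to be bounded. *)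
Lemma site_domination : exists K, forall x b, hyperboloid x ->
  cell_radius <= cd b x < rival_radius ->
  exists2 a, cd a x < r0 & mink (site K b) x < mink (site K a) x.
Proof.
have := fin (2 * rival_radius * r0) (@apex_hyp R) => /finite_seqP[s sE].
pose N a := `|v a 0 0| + `|v a 1 0| + `|v a ord_max 0|.
pose B := \sum_(a <- s) N a.
have N0 a : 0 <= N a by rewrite !addr_ge0.
have NB a : cd a (@apex R) < 2 * rival_radius * r0 -> N a <= B.
  move=> ha; have : a \in s by have : [set` s] a by rewrite -sE.
  by move=> /(big_rem a) E; rewrite /B E lerDl sumr_ge0.
have B0 : 0 <= B by rewrite sumr_ge0.
have r00 : 0 < r0 by have := cell_radius_ge2; rewrite /cell_radius; lra.
exists (B * r0 + 1).
have vx a x : hyperboloid x -> mink (v a) x <= N a * x ord_max 0.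
  move=> [xx x0]; rewrite minkE in xx; rewrite minkE /N.
  have H (k t u : R) : 0 <= u -> t ^+ 2 <= u ^+ 2 -> k * t <= `|k| * u.
    move=> u0 tu; apply: le_trans (ler_norm _) _; rewrite normrM ler_wpM2l //.
    by rewrite -(ler_pXn2r (ltn0Sn 1)) ?nnegrE // real_normK ?num_real.
  have sq1 := sqr_ge0 (x 0 0); have sq2 := sqr_ge0 (x 1 0).
  have h1 : v a 0 0 * x 0 0 <= `|v a 0 0| * x ord_max 0 by apply: H; lra.
  have h2 : v a 1 0 * x 1 0 <= `|v a 1 0| * x ord_max 0 by apply: H; lra.
  have h3 : - v a ord_max 0 * x ord_max 0 <= `|v a ord_max 0| * x ord_max 0.
    by rewrite -normrN; apply: H; lra.
  by rewrite !mulrDl; lra.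
suff main x b : hyperboloid x -> cd 1%g x < r0 -> cell_radius <= cd b x < rival_radius ->
    mink (site (B * r0 + 1) b) x < mink (site (B * r0 + 1) 1%g) x.
  move=> x b hx hb; have [a ha] := cob hx; exists a => //.
  pose x' := rho a^-1%g *m x.
  have ex : x = rho a *m x' by rewrite /x' rhoVK.
  have hx' : hyperboloid x' by apply: hyp_mul.
  pose b' := (a^-1 * b)%g; have eb : b = (a * b')%g by rewrite mulgA mulgV mul1g.
  have ea : a = (a * 1)%g by rewrite mulg1.
  clearbody x' b'; have e1 : cd b x = cd b' x' by rewrite ex eb /cd (cdistM rho_SO rhoM).
  have e2 : cd a x = cd 1%g x' by rewrite ex {1}ea /cd (cdistM rho_SO rhoM).
  have e3 c : mink (site (B * r0 + 1) (a * c)%g) x =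
      mink (site (B * r0 + 1) c) x' + mink (v a) x by rewrite ex mink_siteM.
  by rewrite eb [in X in _ < X]ea !e3 ltrD2r; apply: main; rewrite -?e1 -?e2.
move=> hx h1x /andP[hb1 hb2].
have x3 : x ord_max 0 < r0 by rewrite -(cdist1 rho_SO rhoM).
have x31 : 0 < x ord_max 0 by case: hx.
have hbN : N b <= B.
  apply: NB; apply: le_lt_trans (cdist_triangle rho_SO b hx (@apex_hyp R)) _.
  rewrite minkC mink_apex opprK -/(cd b x).
  apply: (@lt_trans _ _ (2 * rival_radius * x ord_max 0)).
    by rewrite ltr_pM2r // ltr_pM2l.
  by rewrite ltr_pM2l //; have := cell_rival_radius; have := cell_radius_ge2; lra.
rewrite /site (rho1 rho_SO rhoM) cocycle1 mul1mx addr0 !minklin -/(cd b x).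
rewrite mink_apex -[mink (rho b *m _) x]opprK -/(cdist rho b x) -/(cd b x).
have := vx b x hx; have : N b * x ord_max 0 <= B * r0.
  by apply: ler_pM => //; exact: ltW.
have : (B * r0 + 1) * (x ord_max 0 + 1) < (B * r0 + 1) * cd b x.
  rewrite ltr_pM2l; last by rewrite ltr_wpDl // mulr_ge0 // ltW.
  by move: hb1; rewrite /cell_radius; lra.
lra.
Qed.

Variable K : R.
Hypothesis dom : forall x b, hyperboloid x -> cell_radius <= cd b x < rival_radius ->
  exists2 a, cd a x < r0 & mink (site K b) x < mink (site K a) x.
Let q := site K.

(** The cell of [a] is where [a] is active. Competition is restricted to the
    sites within reach of [rival_radius]: the growth of [v] is not controlled, so
    a very far site could have a larger pairing. *)
Definition act a x := cd a x < rival_radius /\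
  forall b, cd b x < rival_radius -> mink (q b) x <= mink (q a) x.

Lemma r0_cell_radius : r0 < cell_radius. Proof. by rewrite /cell_radius; lra. Qed.
Lemma cell_radius_lt : cell_radius < rival_radius.
Proof. by have := cell_rival_radius; have := cell_radius_ge2; lra. Qed.

(** By domination, a site winning from too far would be beaten by a near one. *)
Lemma act_bound a x : hyperboloid x -> act a x -> cd a x < cell_radius.
Proof.
move=> hx [ar2 amax]; rewrite ltNge; apply/negP => ar1.
have [|b br0 ab] := dom hx (_ : cell_radius <= cd a x < rival_radius); first by rewrite ar1.
have := amax b; rewrite leNgt ab => /(_ _)/negP; case => //.
by have := r0_cell_radius; have := cell_radius_lt; lra.
Qed.

Lemma act_ex x : hyperboloid x -> exists a, act a x.
Proof.
move=> hx; have [a ha] := cob hx.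
have /finite_seqP[s sE] := fin rival_radius hx.
have inS b : (b \in s) <-> cd b x < rival_radius.
  by change ([set` s] b <-> [set a | cdist rho a x < rival_radius] b); rewrite sE.
have /(@seq_argmax R _ (fun b => mink (q b) x))[b /inS bs bmax] : a \in s.
  by apply/inS; have := r0_cell_radius; have := cell_radius_lt; rewrite /cd; lra.
by exists b; split=> // c /inS; exact: bmax.
Qed.

Lemma actM a b x : act b x -> act (a * b)%g (rho a *m x).
Proof.
move=> [br2 bmax]; split; first by rewrite /cd cdistM.
move=> c; have -> : c = (a * (a^-1 * c))%g by rewrite mulgA mulgV mul1g.
by rewrite /cd cdistM // /q !mink_siteM lerD2r; exact: bmax.
Qed.

Lemma actM_iff a b x : act (a * b)%g (rho a *m x) <-> act b x.
Proof.
split=> [|]; last exact: actM.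
by move=> /(actM a^-1%g); rewrite mulgA mulVg mul1g rhoK.
Qed.

Lemma act_promote a b x : act b x -> cd a x < rival_radius -> mink (q b) x <= mink (q a) x ->
  act a x.
Proof. by move=> [_ bmax] ar2 ba; split=> // c /bmax /le_trans; apply. Qed.

(** A point of the cell of [a] is at a bounded distance from any other one, so a
    site [b] sharing [z] with [a] is among the rivals of [a] at [x]. *)
Lemma act_compete a b x z : hyperboloid x -> hyperboloid z ->
  act a z -> act b z -> act a x ->
  mink (q b) x <= mink (q a) x /\ (mink (q b) x = mink (q a) x -> act b x).
Proof.
move=> hx hz az bz ax.
have zx : - mink z x <= 2 * cell_radius * cell_radius.
  have := hyp_triangle hz (orbit_hyp rho_SO a) hx.
  move=> /le_trans; apply.
  rewrite (minkC z) -/(cdist rho a z) -/(cdist rho a x).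
  have h1 := cdist_ge1 rho_SO a hx; have h2 := cdist_ge1 rho_SO a hz.
  have h3 := act_bound hx ax; have h4 := act_bound hz az; rewrite /cd in h3 h4.
  by apply: ler_pM; lra.
have br2 : cd b x < rival_radius.
  apply: le_lt_trans (cdist_triangle rho_SO b hz hx) _.
  have r1g := cell_radius_ge2; have h1 := cdist_ge1 rho_SO b hz; have h2 := hyp_mink_le hz hx.
  have h3 := act_bound hz bz.
  rewrite /rival_radius (_ : 4 * cell_radius ^+ 3 = 2 * cell_radius * (2 * cell_radius * cell_radius)); last ring.
  apply: (@lt_le_trans _ _ (2 * cell_radius * - mink z x)).
    by rewrite ltr_pM2r ?ltr_pM2l //; lra.
  by rewrite ler_pM2l //; lra.
split; first by case: ax => _; apply.
by move=> e; apply: (act_promote ax); rewrite ?e.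
Qed.

Lemma act_convex a x y s t : hyperboloid x -> hyperboloid y ->
  0 <= s -> 0 <= t -> hyperboloid (s *: x + t *: y) ->
  act a x -> act a y -> act a (s *: x + t *: y).
Proof.
move=> hx hy s0 t0 hz ax ay; set z := s *: x + t *: y in hz *.
have rx := act_bound hx ax; have ry := act_bound hy ay.
have xy := hyp_mink_le hx hy.
have st1 : s + t <= 1 by exact: hyp_conv_le1 hx hy s0 t0 hz.
have r10 : 0 < cell_radius by have := cell_radius_ge2; lra.
have cz w : mink w z = s * mink w x + t * mink w y by rewrite /z !minklin.
have az : cd a z <= cell_radius.
  rewrite /cd /cdist cz opprD -!mulrN -/(cdist rho a x) -/(cdist rho a y).
  apply: (@le_trans _ _ (s * cell_radius + t * cell_radius)).
    by apply: lerD; apply: ler_wpM2l => //; exact: ltW.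
  by rewrite -mulrDl; apply: ler_piMl => //; exact: ltW.
have [b bz] := act_ex hz; have bzr := act_bound hz bz.
(* the site [b] active at [z] is near [a], hence competes with it at [x], [y] *)
have near w : hyperboloid w -> cd a w < cell_radius -> cd b w < rival_radius.
  move=> hw aw; apply: le_lt_trans (cdist_triangle rho_SO b hz hw) _.
  have h1 := cdist_ge1 rho_SO b hz; have h2 := hyp_mink_le hz hw.
  have h3 := cdist_ge1 rho_SO a hw; have h4 := cdist_ge1 rho_SO a hz.
  have zw : - mink z w <= 2 * cell_radius * cell_radius.
    apply: le_trans (hyp_triangle hz (orbit_hyp rho_SO a) hw) _.
    rewrite (minkC z) -/(cdist rho a z) -/(cdist rho a w).
    by rewrite /cd in az aw; apply: ler_pM; lra.
  rewrite /rival_radius (_ : 4 * cell_radius ^+ 3 = 2 * cell_radius * (2 * cell_radius * cell_radius)); last ring.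
  apply: (@lt_le_trans _ _ (2 * cell_radius * - mink z w)).
    by rewrite ltr_pM2r ?ltr_pM2l //; lra.
  by rewrite ler_pM2l //; lra.
apply: (act_promote bz); first by apply: le_lt_trans az _; exact: cell_radius_lt.
rewrite !cz; apply: lerD; apply: ler_wpM2l => //.
  by case: (ax) => _; apply; exact: near.
by case: (ay) => _; apply; exact: near.
Qed.

Lemma near_cdist a x r : cd a x < r -> \forall y \near x, cd a y < r.
Proof.
move=> h; have := @continuous_mink R (rho a *m @apex R) x.
move=> /cvgr_gt/(_ (- r)); rewrite ltrNl => /(_ h).
by apply: (@filterS _ _ (nbhs_filter x)) => y /=; rewrite /cd /cdist ltrNl.
Qed.

Lemma near_mink_lt (w w' x : 'cV[R]_3) : mink w x < mink w' x ->
  \forall y \near x, mink w y < mink w' y.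
Proof.
rewrite -subr_gt0 -minkNl -minkDl => h.
have := @continuous_mink R (w' - w) x.
move=> /cvgr_gt/(_ _ h).
by apply: (@filterS _ _ (nbhs_filter x)) => y /=; rewrite minkDl minkNl subr_gt0.
Qed.

(** Only finitely many cells come close to [x], and the strict inequalities which
    exclude a cell at [x] persist near [x]. *)
Lemma act_local x : hyperboloid x ->
  \forall y \near x, hyperboloid y -> forall a, act a y -> act a x.
Proof.
move=> hx; have /finite_seqP[s sE] := fin rival_radius hx.
have inS b : (b \in s) <-> cd b x < rival_radius.
  by change ([set` s] b <-> [set a | cdist rho a x < rival_radius] b); rewrite sE.
have n0 : \forall y \near x, - 2 < mink x y.
  have := @continuous_mink R x x.
  by move=> /cvgr_gt/(_ (- 2)); rewrite hx.1; apply; lra.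
have n1 a : \forall y \near x, hyperboloid y -> act a y -> cd a x < rival_radius -> act a x.
  have [ax|nax] := pselect (act a x); first by near=> y.
  have [ar2|nar2] := pselect (cd a x < rival_radius); last by near=> y.
  have [b bx] := act_ex hx.
  have ab : mink (q a) x < mink (q b) x.
    by rewrite ltNge; apply/negP => ?; apply: nax; exact: act_promote bx ar2 _.
  have nb := near_cdist bx.1; have nab := near_mink_lt ab.
  apply: (@filterS _ _ (nbhs_filter x) _ _ _ (@filterI _ _ (nbhs_filter x) _ _ nb nab)).
  move=> y [cby aby] hy [_ /(_ b cby)]; rewrite leNgt => /negP; case.
  exact: aby.
have n2 : \forall y \near x, forall a, a \in s -> hyperboloid y -> act a y ->
    cd a x < rival_radius -> act a x.
  elim: {sE inS} s => [|a s IH]; first by near=> y => ?; rewrite in_nil.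
  apply: (@filterS _ _ (nbhs_filter x) _ _ _ (@filterI _ _ (nbhs_filter x) _ _ (n1 a) IH)).
  by move=> y [ha hs] b; rewrite inE => /predU1P[->//|/hs].
apply: (@filterS _ _ (nbhs_filter x) _ _ _ (@filterI _ _ (nbhs_filter x) _ _ n0 n2)).
move=> y [xy hs] hy a ay.
have ar2 : cd a x < rival_radius.
  apply: le_lt_trans (cdist_triangle rho_SO a hy hx) _; rewrite minkC.
  have := act_bound hy ay; have := cdist_ge1 rho_SO a hy; have := cell_rival_radius.
  rewrite /cd; have := hyp_mink_le hx hy; nra.
by apply: (hs a) => //; apply/inS.
Unshelve. all: by end_near. Qed.

End PowerDiagram.

(** The geometric properties of the power diagram, from which radii and the
    constant [K] have disappeared. The site of [a] is [q a]. The field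
    [vor_compete] says that two sites which are active together somewhere are
    comparable on the whole cell of either of them. *)
Record voronoi (R : realType) (Gam : groupType) (rho : Gam -> 'M[R]_3)
    (v q : Gam -> 'cV[R]_3) (act : Gam -> 'cV[R]_3 -> Prop) : Prop := Voronoi {
  vor_siteM : forall a b, q (a * b)%g = rho a *m q b + v a;
  vor_ex : forall x, hyperboloid x -> exists a, act a x;
  vor_bound : exists r, forall a x, hyperboloid x -> act a x -> cdist rho a x < r;
  vor_M : forall a b x, act (a * b)%g (rho a *m x) <-> act b x;
  vor_convex : forall a x y s t, hyperboloid x -> hyperboloid y ->
    0 <= s -> 0 <= t -> hyperboloid (s *: x + t *: y) ->
    act a x -> act a y -> act a (s *: x + t *: y);
  vor_compete : forall a b x z, hyperboloid x -> hyperboloid z ->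
    act a z -> act b z -> act a x ->
    mink (q b) x <= mink (q a) x /\ (mink (q b) x = mink (q a) x -> act b x);
  vor_local : forall x, hyperboloid x ->
    \forall y \near x, hyperboloid y -> forall a, act a y -> act a x
}.

Theorem voronoi_ex (R : realType) (Gam : groupType) (rho : Gam -> 'M[R]_3)
    (v : Gam -> 'cV[R]_3) :
  (forall a, SO21 (rho a)) ->
  (forall a b, rho (a * b)%g = rho a *m rho b) ->
  (forall x r, hyperboloid x -> finite_set [set a | cdist rho a x < r]) ->
  (exists r0, forall x, hyperboloid x -> exists a, cdist rho a x < r0) ->
  (forall a b, v (a * b)%g = rho a *m v b + v a) ->
  exists q act, voronoi rho v q act.
Proof.
move=> rho_SO rhoM fin [r0 cob] vM.
have [K dom] := site_domination rho_SO rhoM fin cob vM.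
exists (site rho v K), (act rho r0 v K); split.
- exact: siteM.
- exact: act_ex.
- by exists (cell_radius r0) => a x; exact: act_bound dom a x.
- exact: actM_iff.
- exact: (act_convex rho_SO fin cob dom).
- exact: (act_compete rho_SO cob dom).
- exact: (act_local rho_SO fin cob dom).
Qed.

(** * The cell complex of a power diagram *)

Lemma finite_argmax (R : realType) (T : choiceType) (P : set T) (f : T -> R) a :
  finite_set P -> P a -> exists2 b, P b & forall c, P c -> f c <= f b.
Proof.
move=> /finite_seqP[s ->] sa; have [b bs bmax] := @seq_argmax R _ f s a sa.
by exists b.
Qed.

Section Cells.
Variables (R : realType) (Gam : groupType) (rho : Gam -> 'M[R]_3).
Hypothesis rho_SO : forall a, SO21 (rho a).
Hypothesis rhoM : forall a b, rho (a * b)%g = rho a *m rho b.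
Hypothesis fin : forall x r, hyperboloid x -> finite_set [set a | cdist rho a x < r].
Variables (v q : Gam -> 'cV[R]_3) (act : Gam -> 'cV[R]_3 -> Prop).
Hypothesis vor : voronoi rho v q act.
Implicit Types (x y z p u : 'cV[R]_3) (a b c : Gam) (l s t : R).

Lemma vor_eq a b x : hyperboloid x -> act a x -> act b x ->
  mink (q a) x = mink (q b) x.
Proof.
move=> hx ax bx; apply/eqP; rewrite eq_le.
by rewrite (vor_compete vor hx hx ax bx ax).1 (vor_compete vor hx hx bx ax bx).1.
Qed.

Lemma vor_fin x : hyperboloid x -> finite_set [set a | act a x].
Proof.
move=> hx; have [r hr] := vor_bound vor.
by apply: sub_finite_set (fin r hx) => a; exact: hr.
Qed.

Definition on_seg p u l x := exists2 t, 0 <= t <= l & x = geodesic p u t.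

(** Edges are indexed by a starting point, a direction and a length rather than
    by pairs of cells, since three or more sites may be aligned and share the
    same edge. *)
Definition cell_edge p u l := [/\ unit_tangent p u, 0 < l &
  exists a b, q a <> q b /\
    forall x, hyperboloid x -> (act a x /\ act b x <-> on_seg p u l x)].

Lemma geodesic_convex a p u s t r : unit_tangent p u -> s <= r <= t ->
  act a (geodesic p u s) -> act a (geodesic p u t) -> act a (geodesic p u r).
Proof.
move=> pu srt; have [st|ts] := ltrP s t; last first.
  move: srt => /andP[sr rt]; rewrite (_ : r = s) //.
  by apply/eqP; rewrite eq_le sr (le_trans rt ts).
have [k [m [k0 m0 _ _ e]]] := geodesic_conv pu srt st.
have hr := geodesic_hyp pu r; rewrite e in hr *.
by apply: (vor_convex vor) => //; exact: geodesic_hyp.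
Qed.

Lemma geodesic_closed a p u t : unit_tangent p u ->
  (forall e, 0 < e -> exists2 s, `|t - s| < e & act a (geodesic p u s)) ->
  act a (geodesic p u t).
Proof.
move=> pu H; have := vor_local vor (geodesic_hyp pu t).
move=> /(@continuous_geodesic R p u t)/nbhs_ballP[e /= e0 eP].
have [s ts sa] := H e e0.
by apply: (eP s) => //; exact: geodesic_hyp.
Qed.

Lemma geodesic_bounded a p u : unit_tangent p u ->
  exists M, forall t, act a (geodesic p u t) -> `|t| <= M.
Proof.
move=> pu; have [r hr] := vor_bound vor.
have [[s0 as0]|no] := pselect (exists s, act a (geodesic p u s)); last first.
  by exists 0 => t ta; case: no; exists t.
have [hp _ _] := pu.
pose M := 2 * cdist rho a p * r.
exists (2 * M) => t ta.
have ht := geodesic_hyp pu t.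
have r1_ := hr _ _ ht ta.
have cp := cdist_ge1 rho_SO a hp.
have : cosh t <= M.
  have := hyp_triangle hp (orbit_hyp rho_SO a) ht.
  have -> : mink p (geodesic p u t) = - cosh t.
    by rewrite /geodesic !minklin !(ut_mink pu); ring.
  rewrite opprK (minkC p) => /le_trans; apply.
  by rewrite /M -/(cdist rho a p) -/(cdist rho a _); apply: ler_wpM2l; lra.
rewrite /cosh => cM.
have := expR_ge1Dx t; have := expR_ge1Dx (- t); have := expR_gt0 t; have := expR_gt0 (- t).
by rewrite ler_norml => *; apply/andP; split; lra.
Qed.

Lemma normal_dir w x : hyperboloid x -> mink w x = 0 -> w <> 0 ->
  exists2 k, 0 < k & exists2 u, unit_tangent x u & w = k *: lcross x u.
Proof.
move=> hx wx w0; have := mink_orth_ge0 (hyp_cone hx) wx.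
rewrite le_eqVlt => /predU1P[/esym/(mink_orth_eq0 (hyp_cone hx) wx)//|ww].
pose k := Num.sqrt (mink w w); have k0 : 0 < k by rewrite sqrtr_gt0.
have k2 : k ^+ 2 = mink w w by rewrite sqr_sqrtr // ltW.
have [xx _] := hx.
have xw := minkC x w; rewrite wx in xw.
exists k => //; exists (- k^-1 *: lcross x w); first split=> //.
- by rewrite minklin minkC mink_lcrossl mulr0.
- rewrite !minklin mink_lcross2 xx wx xw -k2; field; exact: lt0r_neq0.
rewrite lcrossZr (lcrossC x (lcross x w)) lcrossA wx xx scale0r sub0r scaleN1r.
by rewrite opprK scalerN scaleNr opprK scalerA divff ?scale1r // lt0r_neq0.
Qed.

(** The common part of two cells is convex and closed, and lies on the geodesic
    orthogonal to the difference of the sites, where it is an interval. *)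
Lemma coactive_edge a b x y : hyperboloid x -> hyperboloid y -> x <> y ->
  q a <> q b -> act a x -> act b x -> act a y -> act b y ->
  exists p u l, cell_edge p u l /\
    forall z, hyperboloid z -> (act a z /\ act b z <-> on_seg p u l z).
Proof.
move=> hx hy xy qab ax bx ay by_.
have wz z : hyperboloid z -> act a z -> act b z -> mink (q a - q b) z = 0.
  by move=> hz az bz; rewrite !minklin (vor_eq hz az bz) subrr.
have [|k k0 [u0 ut0 ew]] := normal_dir hx (wz _ hx ax bx).
  by move/eqP; rewrite subr_eq0 => /eqP.
pose g := geodesic x u0.
pose I := [set t | act a (g t) /\ act b (g t)].
have I0 : I 0 by rewrite /I /g /= geodesic0.
have Iz z : hyperboloid z -> act a z -> act b z -> exists2 t, I t & z = g t.
  move=> hz az bz; have := wz _ hz az bz.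
  rewrite ew minklin => /eqP; rewrite mulf_eq0 gt_eqF //= => /eqP.
  by move=> /(geodesicP ut0 hz)[t et]; exists t => //; rewrite /I /g /= -et.
have Iconv s t r : I s -> I t -> s <= r <= t -> I r.
  by move=> [? ?] [? ?] ?; split; apply: (geodesic_convex (s:=s) (t:=t)).
have [M IM] := geodesic_bounded a ut0.
have hsup : has_sup I.
  split; first by exists 0.
  by exists M => t [ta _]; apply: le_trans (ler_norm _) (IM _ ta).
have hinf : has_inf I.
  split; first by exists 0.
  by exists (- M) => t [ta _]; have := IM _ ta; rewrite ler_norml => /andP[].
have Icl t : (forall e, 0 < e -> exists2 s, `|t - s| < e & I s) -> I t.
  by move=> H; split; apply: geodesic_closed => // e /H[s ts [sa sb]]; exists s.
have Isup : I (sup I).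
  apply: Icl => e e0; have [s Is es] := sup_adherent e0 hsup; exists s => //.
  by rewrite ger0_norm ?subr_ge0; [lra | exact: ub_le_sup hsup.2 _ Is].
have Iinf : I (inf I).
  apply: Icl => e e0; have [s Is es] := inf_adherent e0 hinf; exists s => //.
  by rewrite ler0_norm ?subr_le0; [lra | exact: ge_inf hinf.2 _ Is].
have [t1 It1 et1] := Iz _ hy ay by_.
have t10 : t1 != 0 by apply/eqP => t10; apply: xy; rewrite et1 t10 /g geodesic0.
have ll : inf I < sup I.
  rewrite lt_neqAle; apply/andP; split; last first.
    by apply: (@le_trans _ _ 0); [exact: ge_inf hinf.2 _ I0 | exact: ub_le_sup hsup.2 _ I0].
  apply/eqP => e; move/eqP: t10; apply.
  have h1 : inf I <= 0 by exact: ge_inf hinf.2 _ I0.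
  have h2 : 0 <= sup I by exact: ub_le_sup hsup.2 _ I0.
  have h3 : inf I <= t1 by exact: ge_inf hinf.2 _ It1.
  have h4 : t1 <= sup I by exact: ub_le_sup hsup.2 _ It1.
  by lra.
have main z : hyperboloid z ->
    (act a z /\ act b z <-> on_seg (g (inf I)) (gtan x u0 (inf I)) (sup I - inf I) z).
  move=> hz; split.
    move=> [az bz]; have [t It et] := Iz _ hz az bz.
    exists (t - inf I); last by rewrite geodesicD // et; congr geodesic; lra.
    have h3 : inf I <= t by exact: ge_inf hinf.2 _ It.
    have h4 : t <= sup I by exact: ub_le_sup hsup.2 _ It.
    by apply/andP; split; lra.
  move=> [t /andP[t0 tl] ->]; rewrite geodesicD //.
  by apply: (Iconv (inf I) (sup I)) => //; apply/andP; split; lra.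
exists (g (inf I)), (gtan x u0 (inf I)), (sup I - inf I); split=> //; split.
- exact: gtan_ut.
- by rewrite subr_gt0.
- by exists a, b.
Qed.

Section Edge.
Variables (p u : 'cV[R]_3) (l : R).
Hypothesis E : cell_edge p u l.
Let n := lcross p u.
Let g := geodesic p u.

Lemma edge_ut : unit_tangent p u. Proof. by case: E. Qed.
Lemma edge_gt0 : 0 < l. Proof. by case: E. Qed.
Hint Resolve edge_ut edge_gt0 : core.

Definition edge_act a := forall t, 0 <= t <= l -> act a (g t).

Lemma edge_act_ends a : act a (g 0) -> act a (g l) -> edge_act a.
Proof. by move=> a0 al t ht; exact: (geodesic_convex edge_ut ht a0 al). Qed.

Lemma edge_act2 : exists a b, [/\ edge_act a, edge_act b & q a <> q b].
Proof.
case: E => pu _ [a [b [qab ab]]]; exists a, b.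
by split=> // t ht; have /(ab _ (geodesic_hyp pu t))[] : on_seg p u l (g t) by exists t.
Qed.

(** The site of [c] loses weakly at both ends and ties in between, so by
    linearity it ties at both ends. *)
Lemma edge_act_interior c t : 0 < t < l -> act c (g t) -> edge_act c.
Proof.
move=> /andP[t0 tl] ct; have [a [_ [aE _ _]]] := edge_act2.
have t0l : 0 <= t <= l by rewrite !ltW.
have h s : hyperboloid (g s) by exact: geodesic_hyp.
have a0 : act a (g 0) by apply: aE; rewrite lexx ltW.
have al : act a (g l) by apply: aE; rewrite lexx ltW.
have [le0 eq0] := vor_compete vor (h 0) (h t) (aE t t0l) ct a0.
have [lel eql] := vor_compete vor (h l) (h t) (aE t t0l) ct al.
have [k [m [k0 m0 mp kp e]]] := geodesic_conv edge_ut t0l edge_gt0.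
have gt w : mink w (g t) = k * mink w (g 0) + m * mink w (g l).
  by rewrite /g e minkDr !minkZr.
have := vor_eq (h t) (aE t t0l) ct; rewrite !gt => e2.
have {}kp := kp tl; have {}mp := mp t0.
have d0 : k * (mink (q a) (g 0) - mink (q c) (g 0)) = 0.
  have : 0 <= k * (mink (q a) (g 0) - mink (q c) (g 0)) by rewrite mulr_ge0 ?subr_ge0.
  have : 0 <= m * (mink (q a) (g l) - mink (q c) (g l)) by rewrite mulr_ge0 ?subr_ge0.
  by rewrite !mulrBr; lra.
have dl : m * (mink (q a) (g l) - mink (q c) (g l)) = 0.
  by move: d0 e2; rewrite !mulrBr; lra.
apply: edge_act_ends.
  by apply: eq0; move/eqP: d0; rewrite mulf_eq0 gt_eqF //= subr_eq0 => /eqP.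
by apply: eql; move/eqP: dl; rewrite mulf_eq0 gt_eqF //= subr_eq0 => /eqP.
Qed.

Lemma edge_normal w : mink w (g 0) = 0 -> mink w (g l) = 0 -> w = mink w n *: n.
Proof.
rewrite /g geodesic0 // => w0; rewrite /geodesic !minklin w0 mulr0 add0r.
move/eqP; rewrite mulf_eq0 gt_eqF ?sinh_gt0 //= => /eqP wu.
by rewrite [LHS](frame_decomp edge_ut) w0 wu oppr0 !scale0r !add0r.
Qed.

Lemma edge_act_sub a b : edge_act a -> edge_act b ->
  q a - q b = (mink (q a) n - mink (q b) n) *: n.
Proof.
move=> aE bE; rewrite -minkNl -minkDl; apply: edge_normal.
  have r0 : 0 <= (0 : R) <= l by rewrite lexx ltW.
  by rewrite minkDl minkNl (vor_eq (geodesic_hyp edge_ut 0) (aE 0 r0) (bE 0 r0)) subrr.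
have rl : 0 <= l <= l by rewrite ltW /=.
by rewrite minkDl minkNl (vor_eq (geodesic_hyp edge_ut l) (aE l rl) (bE l rl)) subrr.
Qed.

(** The two extreme sites of an edge, for [k] equal to [1] and [-1], are those of
    the cells on its two sides. *)
Definition edge_side (k : R) a :=
  edge_act a /\ forall b, edge_act b -> k * mink (q b) n <= k * mink (q a) n.

Lemma edge_side_ex k : exists a, edge_side k a.
Proof.
have [a0 [_ [a0E _ _]]] := edge_act2.
have [|//|a aE amax] := @finite_argmax _ Gam edge_act (fun a => k * mink (q a) n) a0.
  apply: sub_finite_set (vor_fin (geodesic_hyp edge_ut 0)) => a aE /=.
  by apply: aE; rewrite lexx ltW.
by exists a.
Qed.

Lemma edge_side_eq k a b : k != 0 -> edge_side k a -> edge_side k b -> q a = q b.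
Proof.
move=> k0 [aE amax] [bE bmax]; apply/eqP; rewrite -subr_eq0 edge_act_sub //.
have /(mulfI k0) -> : k * mink (q a) n = k * mink (q b) n.
  by apply/eqP; rewrite eq_le amax // bmax.
by rewrite subrr scale0r.
Qed.

(** The jump across the edge; its coefficient is positive since the two cells which
    define the edge have different sites. *)
Lemma edge_jump a b : edge_side 1 a -> edge_side (-1) b ->
  exists2 w, 0 < w & q a - q b = w *: n.
Proof.
move=> [aE amax] [bE bmax]; exists (mink (q a) n - mink (q b) n); last exact: edge_act_sub.
have [c [d [cE dE cd]]] := edge_act2.
rewrite lt_neqAle subr_ge0; have := amax _ bE; rewrite !mul1r => ->; rewrite andbT.
apply/eqP => e; apply: cd; apply/eqP; rewrite -subr_eq0 edge_act_sub //.
have := amax _ cE; have := amax _ dE; have := bmax _ cE; have := bmax _ dE.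
rewrite !mul1r !mulN1r => *; suff -> : mink (q c) n - mink (q d) n = 0 by rewrite scale0r.
by lra.
Qed.

(** Cells near the point [g t] already contain [g t], so their sites are aligned,
    and the winner on one side is the extreme one. *)
Lemma edge_local k t a : k != 0 -> 0 < t < l -> edge_side k a ->
  \forall y \near g t, hyperboloid y -> 0 < k * mink n y ->
    forall b, act b y -> q b = q a.
Proof.
move=> k0 tl [aE amax].
have loc := vor_local vor (geodesic_hyp edge_ut t).
apply: (@filterS _ _ (nbhs_filter (g t)) _ _ _ loc) => y yl hy ny b bY.
have bt := yl hy b bY; have bE := edge_act_interior tl bt.
apply: (edge_side_eq k0) => //; split=> // c cE.
apply: le_trans (amax _ cE) _.
have at_ : act a (g t) by apply: aE; case/andP: tl => *; rewrite !ltW.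
have [] := vor_compete vor hy (geodesic_hyp edge_ut t) bt at_ bY.
rewrite -subr_ge0 -minkNl -minkDl edge_act_sub // minkZl => h _.
have : 0 <= k ^+ 2 * ((mink (q b) n - mink (q a) n) * mink n y).
  by rewrite mulr_ge0 // sqr_ge0.
rewrite (_ : _ * _ = (k * (mink (q b) n - mink (q a) n)) * (k * mink n y)); last by ring.
by rewrite pmulr_lge0 // mulrBr subr_ge0.
Qed.

End Edge.

Lemma on_seg_hyp p u l x : unit_tangent p u -> on_seg p u l x -> hyperboloid x.
Proof. by move=> pu [t _ ->]; exact: geodesic_hyp. Qed.

Lemma q_inj_mul c a b : q (c * a)%g = q (c * b)%g -> q a = q b.
Proof.
rewrite !(vor_siteM vor) => /addIr; apply: can_inj.
exact: (mulKmx (SO21_unit (rho_SO c))).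
Qed.

(** At the common point the sites of both edges are aligned, and so the sites of
    either edge tie along the whole other one. *)
Lemma edge_overlap p u l p' u' l' t : cell_edge p u l -> cell_edge p' u' l' ->
  0 < t < l -> on_seg p' u' l' (geodesic p u t) ->
  forall y, on_seg p u l y <-> on_seg p' u' l' y.
Proof.
move=> E E' tl xE' y.
have [pu l0 [a [b [qab ab]]]] := E; have [pu' l0' [a' [b' [qab' ab']]]] := E'.
have hx := geodesic_hyp pu t.
have [a'x b'x] := (ab' _ hx).2 xE'.
have a'E := edge_act_interior E tl a'x; have b'E := edge_act_interior E tl b'x.
split=> yE.
  have hy := on_seg_hyp pu yE; case: yE => s sl ey.
  by apply/(ab' _ hy); rewrite ey; split; [exact: a'E|exact: b'E].
have hy := on_seg_hyp pu' yE; have [a'y b'y] := (ab' _ hy).2 yE.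
have xE : on_seg p u l (geodesic p u t).
  by exists t => //; case/andP: tl => *; rewrite !ltW.
have [ax bx] := (ab _ hx).2 xE.
have ny : mink (lcross p u) y = 0.
  have := vor_eq hy a'y b'y => /eqP; rewrite -subr_eq0 -minkNl -minkDl.
  rewrite (edge_act_sub E a'E b'E) minkZl mulf_eq0 => /orP[/eqP e|/eqP//].
  case: qab'; apply/eqP; rewrite -subr_eq0 (edge_act_sub E a'E b'E).
  by rewrite e scale0r.
have prom c : act c (geodesic p u t) -> act c y.
  move=> cx; have cE := edge_act_interior E tl cx.
  apply: (vor_compete vor hy hx a'x cx a'y).2.
  apply/eqP; rewrite -subr_eq0 -minkNl -minkDl (edge_act_sub E cE a'E).
  by rewrite minkZl ny mulr0.
by apply/(ab _ hy); split; exact: prom.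
Qed.

Section Translate.
Variables (c : Gam) (p u : 'cV[R]_3) (l : R).
Hypothesis E : cell_edge p u l.

Lemma on_segM x : on_seg (rho c *m p) (rho c *m u) l (rho c *m x) <-> on_seg p u l x.
Proof.
split=> -[t tl e]; exists t => //; last by rewrite e geodesic_mul.
apply: (can_inj (mulKmx (SO21_unit (rho_SO c)))).
by rewrite e geodesic_mul.
Qed.

Lemma cell_edgeM : cell_edge (rho c *m p) (rho c *m u) l.
Proof.
case: E => pu l0 [a [b [qab ab]]]; split=> //; first exact: unit_tangent_mul.
exists (c * a)%g, (c * b)%g; split; first by move=> /q_inj_mul.
move=> x hx; have ex : x = rho c *m (rho c^-1%g *m x) by rewrite (rhoVK rho_SO rhoM).
rewrite ex !(vor_M vor) on_segM; apply: ab.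
by apply: hyp_mul.
Qed.

Lemma edge_sideM k a : edge_side p u l k a ->
  edge_side (rho c *m p) (rho c *m u) l k (c * a)%g.
Proof.
move=> [aE amax]; split=> [t tl|b bE].
  by rewrite -geodesic_mul (vor_M vor); exact: aE.
have eb : b = (c * (c^-1 * b))%g by rewrite mulgA mulgV mul1g.
rewrite eb (vor_siteM vor) (vor_siteM vor) !(SO21_lcross (rho_SO c)) !minkDl.
rewrite !(SO21_mink (rho_SO c)) !mulrDr lerD2r; apply: amax => t tl.
by apply/(vor_M vor c); rewrite -eb geodesic_mul; exact: bE.
Qed.

End Translate.

Section Flip.
Variables (p u : 'cV[R]_3) (l : R).
Hypothesis E : cell_edge p u l.
Let p' := geodesic p u l.
Let u' := - gtan p u l.

Lemma geodesic_flip t : geodesic p' u' t = geodesic p u (l - t).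
Proof. by rewrite /p' /u' geodesicNE geodesicD. Qed.

Lemma on_seg_flip x : on_seg p' u' l x <-> on_seg p u l x.
Proof.
split=> -[t /andP[t0 tl] ->].
  by exists (l - t); [apply/andP; split; lra | rewrite geodesic_flip].
exists (l - t); first by apply/andP; split; lra.
by rewrite geodesic_flip; congr geodesic; lra.
Qed.

Lemma cell_edge_flip : cell_edge p' u' l.
Proof.
case: E => pu l0 [a [b [qab ab]]]; split=> //.
  exact/unit_tangent_N/gtan_ut.
by exists a, b; split=> // x hx; rewrite on_seg_flip; exact: ab.
Qed.

Lemma lcross_flip : lcross p' u' = - lcross p u.
Proof. by case: E => pu _ _; rewrite /p' /u' lcrossNr lcross_gtan. Qed.

Lemma edge_act_flip a : edge_act p' u' l a <-> edge_act p u l a.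
Proof.
split=> aE t /andP[t0 tl].
  rewrite (_ : t = l - (l - t)); last by lra.
  by rewrite -geodesic_flip; apply: aE; apply/andP; split; lra.
by rewrite geodesic_flip; apply: aE; apply/andP; split; lra.
Qed.

Lemma edge_side_flip k a : edge_side p u l k a -> edge_side p' u' l (- k) a.
Proof.
move=> [aE amax]; split; first exact/edge_act_flip.
move=> b /edge_act_flip bE; rewrite lcross_flip !minkNr !mulNr !mulrN !opprK.
exact: amax.
Qed.

End Flip.

(** ** The link of a point *)

(** Here [w] will be a tangent direction and [n] a normal of it: the tie-break
    selects one end of the edge of the polygon of sites which is extreme in the
    direction [w]. *)
Definition lexmax x w n a := act a x /\ forall b, act b x ->
  mink (q b) w <= mink (q a) w /\
  (mink (q b) w = mink (q a) w -> mink (q b) n <= mink (q a) n).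

Lemma lexmax_ex x w n : hyperboloid x -> exists a, lexmax x w n a.
Proof.
move=> hx; have [a0 a0x] := vor_ex vor hx; have fx := vor_fin hx.
have [a1 a1x a1max] := finite_argmax (fun a => mink (q a) w) fx a0x.
have f1 : finite_set [set a | act a x /\ mink (q a) w = mink (q a1) w].
  by apply: sub_finite_set fx => a [].
have [a [ax e] amax] := finite_argmax (fun a => mink (q a) n) f1 (conj a1x erefl).
exists a; split=> // b bx; rewrite e; split; first exact: a1max.
by move=> eb; apply: amax.
Qed.

Lemma lexmax_eq x w k a b : unit_tangent x w -> k != 0 ->
  lexmax x w (k *: lcross x w) a -> lexmax x w (k *: lcross x w) b -> q a = q b.
Proof.
move=> xw k0 [ax amax] [bx bmax]; have [hx _ _] := xw.
have [ab ab'] := amax _ bx; have [ba ba'] := bmax _ ax.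
have e : mink (q a) w = mink (q b) w by apply/eqP; rewrite eq_le ab ba.
have := conj (ab' (esym e)) (ba' e); rewrite !minkZr => -[h1 h2].
have /(mulfI k0) en : k * mink (q a) (lcross x w) = k * mink (q b) (lcross x w).
  by apply/eqP; rewrite eq_le h1 h2.
rewrite (frame_decomp xw (q a)) (frame_decomp xw (q b)).
by rewrite (vor_eq hx ax bx) e en.
Qed.

(** Compare the sites at both ends of the edge: the site of a cell at [p]
    cannot beat those of the edge at the other end, and if it ties there its cell
    contains the edge. *)
Lemma edge_lexmax p u l k a : cell_edge p u l -> edge_side p u l k a ->
  lexmax p u (k *: lcross p u) a.
Proof.
move=> E [aE amax]; have [pu l0 _] := E; have [hp _ _] := pu.
have hl := geodesic_hyp pu l; have sl : 0 < sinh l by rewrite sinh_gt0.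
have ap : act a p by rewrite -[p](geodesic0 p u); apply: aE; rewrite lexx ltW.
have al : act a (geodesic p u l) by apply: aE; rewrite lexx ltW.
have gl w : mink w (geodesic p u l) = cosh l * mink w p + sinh l * mink w u.
  by rewrite /geodesic minkDr !minkZr.
split=> // b bp; have [ba ba'] := vor_compete vor hl hp ap bp al.
rewrite !gl (vor_eq hp ap bp) in ba ba'; split.
  by move: ba; rewrite lerD2l ler_pM2l.
move=> e; have bl : act b (geodesic p u l) by apply: ba'; rewrite e.
rewrite !minkZr; apply: amax; apply: edge_act_ends => //.
by rewrite geodesic0.
Qed.

(** Near [x] only the cells at [x] matter, and those extreme in the direction [w]
    win at the points just after [x] in this direction. *)
Lemma tie_edge x w a b : unit_tangent x w -> act a x -> act b x -> q a <> q b ->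
  mink (q a) w = mink (q b) w ->
  (forall c, act c x -> mink (q c) w <= mink (q a) w) ->
  exists p u l, [/\ cell_edge p u l, on_seg p u l x &
    \forall t \near 0^'+, on_seg p u l (geodesic x w t)].
Proof.
move=> xw ax bx qab eab amax; have [hx _ _] := xw.
have loc := vor_local vor hx.
have near_act : \forall t \near 0^'+, act a (geodesic x w t) /\ act b (geodesic x w t).
  have n0 : \forall t \near (0 : R), forall c, act c (geodesic x w t) -> act c x.
    have cg := @continuous_geodesic R x w 0; rewrite /continuous_at geodesic0 in cg.
    apply: (@filterS _ _ (nbhs_filter (0 : R)) _ _ _ (cg _ loc)) => t /= H.
    exact: H (geodesic_hyp xw t).
  have nl : \forall t \near 0^'+, forall c, act c (geodesic x w t) -> act c x.
    exact: cvg_within n0.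
  near=> t.
  have t0 : 0 < t by near: t; exact: nbhs_right_gt.
  have tx : forall c, act c (geodesic x w t) -> act c x by near: t; exact: nl.
  have ht := geodesic_hyp xw t; have [c ct] := vor_ex vor ht; have cx := tx _ ct.
  have gt y : mink y (geodesic x w t) = cosh t * mink y x + sinh t * mink y w.
    by rewrite /geodesic minkDr !minkZr.
  have prom d : act d x -> mink (q d) w = mink (q a) w -> act d (geodesic x w t).
    move=> dx ed; have [le eq] := vor_compete vor ht hx cx dx ct.
    apply: eq; apply/eqP; rewrite eq_le le !gt (vor_eq hx dx cx) lerD2l.
    by rewrite ler_pM2l ?sinh_gt0 // ed amax.
  by split; apply: prom.
have [t [[at_ bt] t0]] : exists t, (act a (geodesic x w t) /\ act b (geodesic x w t)) /\ 0 < t.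
  have [t [abt t0]] := @filter_ex _ _ (at_right_proper_filter (0 : R)) _
    (filterI near_act (@nbhs_right_gt R 0)).
  by exists t.
have ht := geodesic_hyp xw t.
have xt : x <> geodesic x w t.
  rewrite -{1}[x](geodesic0 x w) => /(geodesic_inj xw) e.
  by rewrite e ltxx in t0.
have [p [u [l [E pulE]]]] := coactive_edge hx ht xt qab ax bx at_ bt.
exists p, u, l; split=> //; first exact/pulE.
by apply: filterS near_act => s abs; apply/pulE => //; exact: geodesic_hyp.
Unshelve. all: by end_near. Qed.

End Cells.

Section Link.
Variables (R : realType) (Gam : groupType) (rho : Gam -> 'M[R]_3).
Hypothesis rho_SO : forall a, SO21 (rho a).
Hypothesis rhoM : forall a b, rho (a * b)%g = rho a *m rho b.
Hypothesis fin : forall x r, hyperboloid x -> finite_set [set a | cdist rho a x < r].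
Variables (v q : Gam -> 'cV[R]_3) (act : Gam -> 'cV[R]_3 -> Prop).
Hypothesis vor : voronoi rho v q act.
Implicit Types (x y z p u : 'cV[R]_3) (a b c : Gam) (l s t : R).
Local Notation cell_edge := (cell_edge q act).
Local Notation lexmax := (lexmax q act).

Lemma tangent_frame x w : unit_tangent x w ->
  let n := lcross x w in
  [/\ unit_tangent x n, lcross x n = - w, mink w n = 0 & mink n n = 1].
Proof.
move=> xw n; have [hx _ _] := xw.
have N := normal_mink xw; rewrite -/n in N.
split; rewrite ?N //.
- by split; rewrite ?N.
- by rewrite lcrossC /n lcrossA !(ut_mink xw) scale0r sub0r scaleN1r opprK.
Qed.

(** A corner [a] of the polygon of sites at [x] which ends the edge extreme in
    the direction [w], or is the only extreme corner there, starts the edge which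
    is met first when [w] rotates towards its normal. *)
Lemma rotate_to_tie x w a b0 : unit_tangent x w -> lexmax x w (lcross x w) a ->
  act b0 x -> q b0 <> q a ->
  exists w' b, [/\ unit_tangent x w', lexmax x w' (- lcross x w') a, act b x,
    q b <> q a & mink (q b) w' = mink (q a) w'].
Proof.
move=> xw [ax amax] b0x qb0; have [hx _ _] := xw.
set n := lcross x w in amax *.
have [xn xxn wn nn] := tangent_frame xw; rewrite -/n in xn xxn wn nn.
have sep b : act b x -> mink (q b) w = mink (q a) w -> mink (q b) n = mink (q a) n ->
    q b = q a.
  move=> bx ew en; rewrite (frame_decomp xw (q a)) (frame_decomp xw (q b)) -/n.
  by rewrite (vor_eq vor hx ax bx) ew en.
have [[b1 [b1x b1w]]|none] := pselect (exists b, act b x /\ mink (q b) w < mink (q a) w).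
  (* the directions [n + k *: w] with [k] decreasing rotate away from [w]; the
     first tie occurs at the largest slope *)
  pose P := [set b | act b x /\ mink (q b) w < mink (q a) w].
  have fP : finite_set P by apply: sub_finite_set (vor_fin fin vor hx) => b [].
  pose f b := (mink (q b) n - mink (q a) n) / (mink (q a) w - mink (q b) w).
  have [b [bx bw] bmax] := finite_argmax f fP (conj b1x b1w).
  pose k := f b; pose r := Num.sqrt (1 + k ^+ 2).
  have r2 : r ^+ 2 = 1 + k ^+ 2 by rewrite sqr_sqrtr // addr_ge0 // sqr_ge0.
  have r0 : 0 < r by rewrite sqrtr_gt0 ltr_pwDl // sqr_ge0.
  have rV : r^-1 ^+ 2 * (1 + k ^+ 2) = 1 by rewrite -r2 -exprMn mulVf ?expr1n // gt_eqF.
  pose w' := r^-1 *: (n + k *: w).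
  have xw' : unit_tangent x w'.
    have [_ xw0 ww] := xw; have [_ xn0 _] := xn.
    split=> //; rewrite /w' !minklin.
      by rewrite xw0 xn0; ring.
    by rewrite (minkC n w) wn nn ww -[RHS]rV; ring.
  have nw' : lcross x w' = r^-1 *: (k *: n - w).
    by rewrite /w' !lcrosslin xxn -/n addrC.
  have fw c : mink (q c) w' = r^-1 * (mink (q c) n + k * mink (q c) w).
    by rewrite /w' !minklin.
  have fk c : act c x -> mink (q c) n + k * mink (q c) w <= mink (q a) n + k * mink (q a) w.
    move=> cx; have [le eq] := amax _ cx; move: le; rewrite le_eqVlt => /predU1P[e|lt].
      by rewrite e lerD2r; exact: eq.
    have : f c <= k by exact: bmax.
    by rewrite /f ler_pdivrMr ?subr_gt0 //; lra.
  have ek c : mink (q c) n + k * mink (q c) w = mink (q a) n + k * mink (q a) w ->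
      mink (q c) n - mink (q a) n = k * (mink (q a) w - mink (q c) w) by lra.
  exists w', b; split=> //.
  - split=> // c cx; rewrite !fw ler_pM2l ?invr_gt0 //; split; first exact: fk.
    move=> /(mulfI (_ : r^-1 != 0))-/(_ (invr_neq0 (lt0r_neq0 r0)))/ek e.
    rewrite nw' !minkNr !minkZr lerN2 ler_pM2l ?invr_gt0 // !minklin.
    have [le _] := amax _ cx.
    have e2 : k * (mink (q c) n - mink (q a) n) = k ^+ 2 * (mink (q a) w - mink (q c) w).
      by rewrite e; ring.
    have : 0 <= k ^+ 2 * (mink (q a) w - mink (q c) w) by rewrite mulr_ge0 ?sqr_ge0 ?subr_ge0.
    by rewrite -e2; lra.
  - by move=> e; move: bw; rewrite e ltxx.
  rewrite !fw; congr (_ * _).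
  have : k * (mink (q a) w - mink (q b) w) = mink (q b) n - mink (q a) n.
    by rewrite /k /f divfK // subr_eq0 gt_eqF.
  lra.
(* all sites are on one line orthogonal to [w]: the next tie is opposite *)
have ew c : act c x -> mink (q c) w = mink (q a) w.
  move=> cx; apply/eqP; rewrite eq_le (amax _ cx).1 /= leNgt; apply/negP => lt.
  by apply: none; exists c.
exists (- w), b0; split=> //.
- exact: unit_tangent_N.
- split=> // c cx; rewrite lcrossNr opprK !minkNr ew //; split=> // _.
  by apply: (amax _ cx).2; exact: ew.
- by rewrite !minkNr ew.
Qed.

Lemma unit_tangent_ex x : hyperboloid x -> exists w, unit_tangent x w.
Proof.
move=> hx; pose w := vec3 (x ord_max 0) 0 (x 0 0).
have wx : mink w x = 0 by rewrite minkE !vec3E; ring.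
have w0 : w <> 0.
  move=> /matrixP/(_ 0 0); rewrite vec3E mxE => e.
  by case: hx => _; rewrite e ltxx.
by have [k _ [u xu _]] := normal_dir hx wx w0; exists u.
Qed.

(** There is a tie in some direction at such a point, hence an edge leaving it.
    So the edges alone separate the cells with different sites. *)
Lemma coactive_on_edge x a b : hyperboloid x -> act a x -> act b x -> q a <> q b ->
  exists p u l, cell_edge p u l /\ on_seg p u l x.
Proof.
move=> hx ax bx qab; have [w xw] := unit_tangent_ex hx.
have [c cmax] := lexmax_ex fin vor w (lcross x w) hx.
have [d [dx qd]] : exists d, act d x /\ q d <> q c.
  have [e|] := pselect (q a = q c); last by exists a.
  by exists b; split=> // e'; apply: qab; rewrite e e'.
have [w' [d' [xw' [cx c'max] d'x qd' ed']]] := rotate_to_tie xw cmax dx qd.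
have qcd' : q c <> q d' by move=> e; apply: qd'.
have [p [u [l [E xE _]]]] := tie_edge rho_SO vor xw' cx d'x qcd' (esym ed') (fun e ex => (c'max e ex).1).
by exists p, u, l.
Qed.

(** Minkowski's relation for the polygon of sites at [x]. Distinct edges end at
    distinct corners, and by [rotate_to_tie] the corner ending an edge starts
    another one; so starting and ending corners have the same sum. *)
Lemma balanced_link (I : finType) x (w : I -> 'cV[R]_3) (k : I -> R) (a b : I -> Gam) :
  hyperboloid x -> (forall i, unit_tangent x (w i)) -> injective w ->
  (forall i, lexmax x (w i) (lcross x (w i)) (a i)) ->
  (forall i, lexmax x (w i) (- lcross x (w i)) (b i)) ->
  (forall i, 0 < k i) ->
  (forall i, q (a i) - q (b i) = k i *: lcross x (w i)) ->
  (forall w' c d, unit_tangent x w' -> act c x -> act d x -> q c <> q d ->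
     mink (q c) w' = mink (q d) w' ->
     (forall e, act e x -> mink (q e) w' <= mink (q c) w') -> exists i, w' = w i) ->
  \sum_i k i *: w i = 0.
Proof.
move=> hx xw winj amax bmax k0 ab complete.
pose n i := lcross x (w i).
have ax i : act (a i) x := (amax i).1.
have bx i : act (b i) x := (bmax i).1.
have qa_inj i j : q (a i) = q (a j) -> i = j.
  move=> e.
  have eb m : q (b m) = q (a m) - k m *: n m by rewrite -ab opprB addrC subrK.
  have h i' j' : q (a i') = q (a j') -> 0 <= mink (n j') (w i').
    move=> e'; have [le _] := (amax i').2 _ (bx j').
    move: le; rewrite eb -e' minklin minkNl minkZl gerDl oppr_le0.
    by rewrite pmulr_rge0.
  have anti : mink (n j) (w i) = - mink (n i) (w j).
    by rewrite /n !mink_lcrossC -minkNr lcrossC.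
  have nij : mink (n i) (w j) = 0.
    have := h _ _ e; have := h _ _ (esym e); rewrite anti; lra.
  have [hx' xwj wwj] := xw j.
  have := frame_decomp (xw i) (w j); rewrite -/(n i).
  rewrite (minkC _ (n i)) nij (minkC _ x) xwj oppr0 !scale0r add0r addr0.
  set m := mink (w j) (w i) => ew.
  have : m ^+ 2 = 1.
    have [_ _ wwi] := xw i.
    by have := wwj; rewrite {1}ew minkZl ew minkZr wwi mulr1 expr2.
  move/eqP; rewrite sqrf_eq1 => /orP[] /eqP em; rewrite em ?scale1r ?scaleN1r in ew.
    by apply: winj.
  have nj : n j = - n i by rewrite /n ew lcrossNr.
  have [_ le] := (amax i).2 _ (bx j).
  have [_ _ _ nn] := tangent_frame (xw i); rewrite -/(n i) in nn.
  have [_ _ nw _] := tangent_frame (xw i); rewrite -/(n i) in nw.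
  have := le _; rewrite eb nj -e scalerN opprK !minkDl !minkZl (minkC (n i) (w i)).
  rewrite nw mulr0 addr0 => /(_ erefl); rewrite -/(n i) nn gerDl mulr1.
  by rewrite leNgt k0.
have next i : exists j, q (b j) = q (a i).
  have qba : q (b i) <> q (a i).
    move=> e; have := ab i; rewrite e subrr => /esym/eqP; rewrite scaler_eq0 gt_eqF //=.
    have [_ _ _ nn] := tangent_frame (xw i).
    by move=> /eqP n0; move: nn; rewrite n0 mink0l => /esym/eqP; rewrite oner_eq0.
  have [w' [c [xw' a'max cx qc ec]]] := rotate_to_tie (xw i) (amax i) (bx i) qba.
  have [|j ej] := complete w' (a i) c xw' (ax i) cx _ (esym ec) (fun e ex => (a'max.2 e ex).1).
    by move=> e; exact: qc.
  exists j; rewrite ej in xw' a'max.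
  have m1 : (- 1 : R) != 0 by rewrite oppr_eq0 oner_eq0.
  by apply: (lexmax_eq vor xw' m1); rewrite scaleN1r.
have [f fP] := choice next.
have finj : injective f.
  by move=> i j e; apply: qa_inj; rewrite -!fP e.
have sum0 : \sum_i k i *: n i = 0.
  rewrite -(eq_bigr _ (fun i _ => ab i)) sumrB.
  rewrite [X in _ - X](reindex f) /=; last first.
    by exists (invF finj) => i _; [exact: invF_f | exact: f_invF].
  by rewrite (eq_bigr _ (fun i _ => fP i)) subrr.
have lc (F : I -> 'cV[R]_3) : lcross x (\sum_i F i) = \sum_i lcross x (F i).
  apply: (big_morph (lcross x)) => [y z|]; first by rewrite lcrossDr.
  by rewrite -[X in lcross x X](scale0r x) lcrossZr scale0r.
have : lcross x (\sum_i k i *: n i) = - \sum_i k i *: w i.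
  rewrite lc -sumrN; apply: eq_bigr => i _.
  by have [_ e _ _] := tangent_frame (xw i); rewrite lcrossZr e scalerN.
rewrite sum0 -[X in lcross x X](scale0r x) lcrossZr scale0r => /esym/eqP.
by rewrite oppr_eq0 => /eqP.
Qed.

End Link.

(** * Finitely many orbits of edges *)

Lemma seq_representatives (T : eqType) (r : T -> T -> Prop) (s : seq T) :
  (forall x, r x x) -> (forall x y z, r x y -> r y z -> r x z) ->
  (forall x y, r x y -> r y x) ->
  exists s' : seq T, [/\ {subset s' <= s}, forall x, x \in s -> exists2 y, y \in s' & r x y &
    forall x y, x \in s' -> y \in s' -> r x y -> x = y].
Proof.
move=> rr rt rs; elim: s => [|x s [s' [ss' cov sep]]]; first by exists [::].
have [[y ys' xy]|no] := pselect (exists2 y, y \in s' & r x y).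
  exists s'; split=> // [z /ss'|z]; first by rewrite inE orbC => ->.
  by rewrite inE => /predU1P[->|/cov//]; exists y.
exists (x :: s'); split=> [z|z|z t].
- by rewrite !inE => /predU1P[->|/ss' ->]; rewrite ?eqxx ?orbT.
- rewrite inE => /predU1P[->|/cov[y ys' zy]]; first by exists x; rewrite ?mem_head.
  by exists y; rewrite // inE ys' orbT.
rewrite !inE => /predU1P[->|zs] /predU1P[->|ts] // zt; last exact: sep.
  by case: no; exists t.
by case: no; exists z => //; exact: rs.
Qed.

Section Orbits.
Variables (R : realType) (Gam : groupType) (rho : Gam -> 'M[R]_3).
Hypothesis rho_SO : forall a, SO21 (rho a).
Hypothesis rhoM : forall a b, rho (a * b)%g = rho a *m rho b.
Hypothesis fin : forall x r, hyperboloid x -> finite_set [set a | cdist rho a x < r].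
Variables (v q : Gam -> 'cV[R]_3) (act : Gam -> 'cV[R]_3 -> Prop).
Hypothesis vor : voronoi rho v q act.
Implicit Types (x y z p u : 'cV[R]_3) (a b c : Gam) (l s t : R).
Local Notation cell_edge := (cell_edge q act).

(** The starting point, the direction and the length. *)
Definition segment : Type := 'cV[R]_3 * 'cV[R]_3 * R.
Implicit Type D : segment.

Definition translate a D : segment := (rho a *m D.1.1, rho a *m D.1.2, D.2).
Definition seg_edge D := cell_edge D.1.1 D.1.2 D.2.
Definition in_seg D x := on_seg D.1.1 D.1.2 D.2 x.

Lemma translate1 D : translate 1%g D = D.
Proof. by case: D => [[p u] l]; rewrite /translate (rho1 rho_SO rhoM) !mul1mx. Qed.

Lemma translateM a b D : translate (a * b)%g D = translate a (translate b D).
Proof. by rewrite /translate rhoM -!mulmxA. Qed.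

Lemma in_segM a D x : in_seg (translate a D) (rho a *m x) <-> in_seg D x.
Proof. exact: on_segM. Qed.

Lemma in_segV a D x : in_seg (translate a D) x <-> in_seg D (rho a^-1%g *m x).
Proof. by rewrite -[x in in_seg (translate a D) x](rhoVK rho_SO rhoM a) in_segM. Qed.

Lemma seg_edgeM a D : seg_edge D -> seg_edge (translate a D).
Proof. exact: (cell_edgeM rho_SO rhoM vor). Qed.

Definition equiv_seg D D' := exists a, forall x, in_seg (translate a D) x <-> in_seg D' x.

Lemma equiv_seg_refl D : equiv_seg D D.
Proof. by exists 1%g => x; rewrite translate1. Qed.

Lemma equiv_seg_sym D D' : equiv_seg D D' -> equiv_seg D' D.
Proof.
move=> [a aP]; exists a^-1%g => x.
by rewrite -(in_segM a D x) in_segV invgK aP.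
Qed.

Lemma equiv_seg_trans D D' D'' : equiv_seg D D' -> equiv_seg D' D'' -> equiv_seg D D''.
Proof.
move=> [a aP] [b bP]; exists (b * a)%g => x.
by rewrite translateM in_segV aP -bP in_segV.
Qed.

(** Translate each edge so that the identity labels a cell containing it; the
    other cell defining it then has finitely many possible labels. *)
Lemma edge_orbits : exists s : seq segment,
  [/\ forall D, D \in s -> seg_edge D,
      forall D, seg_edge D -> exists2 D', D' \in s & equiv_seg D D'
    & forall D D', D \in s -> D' \in s -> equiv_seg D D' -> D = D'].
Proof.
have [r hr] := vor_bound vor.
have /finite_seqP[sd sdE] := fin (2 * r ^+ 2) (@apex_hyp R).
pose common d D := seg_edge D /\
  forall x, hyperboloid x -> (act 1%g x /\ act d x <-> in_seg D x).
have /choice[D DP] : forall d, exists D, (exists D', common d D') -> common d D.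
  move=> d; have [[D ?]|no] := pselect (exists D', common d D'); first by exists D.
  by exists (0, 0, 0) => -[D' ?]; case: no; exists D'.
pose s0 := [seq D d | d <- sd & `[< exists D', common d D' >]].
have [s [ss cov sep]] := seq_representatives s0 equiv_seg_refl equiv_seg_trans equiv_seg_sym.
exists s; split=> // [D' /ss /mapP[d]|D' ED'].
  by rewrite mem_filter => /andP[/asboolP ex _] ->; case: (DP d ex).
have [pu l0 [a [b [qab ab]]]] := ED'.
pose d := (a^-1 * b)%g; pose D1 := translate a^-1%g D'.
have comm : common d D1.
  split=> [|x hx]; first exact: seg_edgeM.
  rewrite in_segV invgK; have eb : b = (a * d)%g by rewrite mulgA mulgV mul1g.
  have := ab _ (hyp_mul (rho_SO a) hx).
  by rewrite eb -{1}(mulg1 a) !(vor_M vor).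
have dsd : d \in sd.
  have : [set` sd] d; last by [].
  rewrite -sdE /=; have [h1 h2] : act 1%g D1.1.1 /\ act d D1.1.1.
    have [[pu1 l01 _] H] := comm; apply/(H _); first by case: pu1.
    by exists 0; [rewrite lexx ltW | rewrite geodesic0].
  have [[pu1 _ _] _] := comm; have [hp _ _] := pu1.
  have := hr _ _ hp h1; rewrite (cdist1 rho_SO rhoM) => h3.
  have h4 := hr _ _ hp h2.
  apply: le_lt_trans (cdist_triangle rho_SO d hp (@apex_hyp R)) _.
  rewrite minkC mink_apex opprK expr2 mulrA.
  have := cdist_ge1 rho_SO d hp; case: hp => _ p0 h5.
  apply: ltr_pM => //; last by rewrite ltr_pM2l.
    by rewrite mulr_ge0 //; lra.
  exact: ltW.
have ex : exists D', common d D' by exists D1.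
have [D'' D''s DD''] : exists2 D'', D'' \in s & equiv_seg (D d) D''.
  by apply: cov; apply/mapP; exists d => //; rewrite mem_filter dsd andbT; exact/asboolP.
exists D'' => //; apply: equiv_seg_trans DD''; apply: (@equiv_seg_trans _ D1).
  by exists a^-1%g.
have [[pu2 _ _] H2] := DP d ex; have [[pu1 _ _] H1] := comm.
exists 1%g => x; rewrite translate1; split=> xD.
  by have hx := on_seg_hyp pu1 xD; apply/(H2 _ hx)/(H1 _ hx).
by have hx := on_seg_hyp pu2 xD; apply/(H1 _ hx)/(H2 _ hx).
Qed.

Lemma cosh_eq s t : cosh s = cosh t :> R -> s = t \/ s = - t.
Proof.
move=> e; have := cosh2_sinh2 s; have := cosh2_sinh2 t; rewrite e => h1 h2.
have : sinh s ^+ 2 = sinh t ^+ 2 :> R by lra.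
move/eqP; rewrite eqf_sqr => /orP[]/eqP es; [left|right].
  have : sinh (s - t) = 0 :> R by rewrite sinhD coshN sinhN e es; ring.
  by move/sinh_eq0 => /eqP; rewrite subr_eq0 => /eqP.
have : sinh (s + t) = 0 :> R by rewrite sinhD e es; ring.
by move/sinh_eq0 => /eqP; rewrite addr_eq0 => /eqP.
Qed.

Hypothesis free : forall a x, hyperboloid x -> rho a *m x = x -> a = 1%g.

(** Such an isometry fixes or swaps the end points, and in both cases fixes the
    midpoint. *)
Lemma segment_stab D a : seg_edge D ->
  (forall x, in_seg (translate a D) x <-> in_seg D x) -> a = 1%g.
Proof.
case: D => [[p u] l] [/= pu l0 _] aP.
have l0' : 0 <= l by exact: ltW.
pose g := geodesic p u.
have pt t : 0 <= t <= l -> exists2 s, 0 <= s <= l & rho a *m g t = g s.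
  move=> tl; have /aP[s sl e] : in_seg (translate a (p, u, l)) (rho a *m g t).
    by apply/in_segM; exists t.
  by exists s.
have [|s0 s0l e0] := pt 0; first by rewrite lexx.
have [|s1 s1l e1] := pt l; first by rewrite lexx andbT.
have gg s t : mink (g s) (g t) = - cosh (t - s).
  have [_ pu0 uu] := pu.
  by rewrite /g /geodesic !minklin !(ut_mink pu) coshD coshN sinhN; ring.
have : cosh (s1 - s0) = cosh l :> R.
  by apply: oppr_inj; rewrite -gg -e0 -e1 (SO21_mink (rho_SO a)) gg subr0.
move/cosh_eq => H.
have sw : rho a *m (g 0 + g l) = g 0 + g l.
  rewrite mulmxDr e0 e1; move: s0l s1l => /andP[? ?] /andP[? ?]; case: H => H.
    have -> : s0 = 0 by lra.
    by have -> : s1 = l by lra.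
  have -> : s0 = l by lra.
  have -> : s1 = 0 by lra.
  exact: addrC.
have cm : cone (g 0 + g l).
  by apply: coneD; apply: hyp_cone; exact: geodesic_hyp.
apply: (free (normalize_hyp cm)).
by rewrite /normalize -scalemxAr sw.
Qed.

(** The end points of the segment would both be ahead of [geodesic p u t] in the
    direction [w], although this point is between them. *)
Lemma start_not_interior p u l w l' t : unit_tangent p u ->
  unit_tangent (geodesic p u t) w -> 0 < t < l ->
  (forall y, on_seg p u l y -> on_seg (geodesic p u t) w l' y) -> False.
Proof.
move=> pu xw /andP[t0 tl] sub; have l0 : 0 < l by lra.
have [s0 /andP[s00 _] e0] : on_seg (geodesic p u t) w l' (geodesic p u 0).
  by apply: sub; exists 0; rewrite // lexx ltW.
have [s1 /andP[s10 _] e1] : on_seg (geodesic p u t) w l' (geodesic p u l).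
  by apply: sub; exists l; rewrite // lexx ltW.
have tl' : 0 <= t <= l by rewrite !ltW.
have [k [m [k0 m0 mp kp e]]] := geodesic_conv pu tl' l0.
have [_ xw0 _] := xw.
have gw s : mink (geodesic (geodesic p u t) w s) w = sinh s by exact: geodesic_u.
have sge0 s : 0 <= s -> 0 <= sinh s.
  by rewrite le_eqVlt => /predU1P[<-|s_]; rewrite ?sinh0 // ltW // sinh_gt0.
have : k * sinh s0 + m * sinh s1 = 0.
  by rewrite -!gw -e0 -e1 -!minkZl -minkDl -e.
have := mulr_ge0 k0 (sge0 _ s00); have := mulr_ge0 m0 (sge0 _ s10) => h1 h2 h3.
have : k * sinh s0 = 0 by lra.
have : m * sinh s1 = 0 by lra.
move=> /eqP; rewrite mulf_eq0 gt_eqF ?mp //= => /eqP/sinh_eq0 es1.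
move=> /eqP; rewrite mulf_eq0 gt_eqF ?kp //= => /eqP/sinh_eq0 es0.
have /(geodesic_inj pu) : geodesic p u 0 = geodesic p u l by rewrite e0 e1 es0 es1.
by lra.
Qed.

Lemma geodesic_dir x w w' s t : unit_tangent x w -> unit_tangent x w' ->
  0 < s -> 0 <= t -> geodesic x w s = geodesic x w' t -> w = w'.
Proof.
move=> xw xw' s0 t0 e.
have ec : cosh s = cosh t.
  have := congr1 (mink x) e; rewrite /geodesic !minklin !(ut_mink xw) !(ut_mink xw').
  lra.
have st : s = t by have [//|] := cosh_eq ec; lra.
have ss : sinh s != 0 :> R by rewrite gt_eqF // sinh_gt0.
by move: e; rewrite /geodesic -st => /addrI/(scalerI ss).
Qed.

End Orbits.

(** * Jumps of a function on an interval *)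

Section Telescope.
Variable R : realType.
Implicit Types t r : R.

(** The set where the function takes its initial value is open and closed in the
    interval. *)
Lemma locally_constant (T : Type) (f : R -> T) :
  (forall t, 0 <= t <= 1 -> \forall r \near t, 0 <= r <= 1 -> f r = f t) -> f 1 = f 0.
Proof.
move=> H.
pose I := `[0, 1]%classic : set R.
have IE t : I t <-> 0 <= t <= 1 by rewrite /I /= in_itv.
pose B := [set t | 0 <= t <= 1 /\ f t = f 0].
have : B = I.
  apply: (@segment_connected R 0 1).
  - by exists 0; split=> //; rewrite lexx ler01.
  - exists (interior [set r | 0 <= r <= 1 -> f r = f 0]); first exact: open_interior.
    apply/seteqP; split=> t /=.
      move=> [t01 e]; split; first exact/IE.
      by have := H _ t01; apply: filterS => r Hr /Hr ->.
    by move=> [/IE t01 /nbhs_singleton/(_ t01)].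
  - exists (~` interior [set r | 0 <= r <= 1 -> f r <> f 0]).
      by apply: open_closedC; exact: open_interior.
    apply/seteqP; split=> t /=.
      move=> [t01 e]; split; first exact/IE.
      by move=> /nbhs_singleton/(_ t01).
    move=> [/IE t01 nt]; split=> //; apply: contrapT => ne; apply: nt.
    by have := H _ t01; apply: filterS => r Hr /Hr ->.
move=> BI; have : B 1 by rewrite BI; apply/IE; rewrite ler01 lexx.
by case.
Qed.

(** Subtracting the jumps which precede [t] makes the function locally constant. *)
Lemma sum_of_jumps (V : zmodType) (f : R -> V) n (ts : 'I_n -> R) (L J : 'I_n -> V) :
  injective ts -> (forall k, 0 < ts k < 1) ->
  (forall t, 0 <= t <= 1 -> (forall k, t <> ts k) ->
     \forall r \near t, 0 <= r <= 1 -> f r = f t) ->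
  (forall k, \forall r \near (ts k)^'-, f r = L k) ->
  (forall k, \forall r \near (ts k)^'+, f r = L k + J k) ->
  f 1 - f 0 = \sum_k J k.
Proof.
move=> tinj t01 loc left right.
pose g t := if [pick k | ts k == t] is Some k then L k else f t.
pose H t := g t - \sum_(k | ts k < t) J k.
have g_ts k : g (ts k) = L k.
  by rewrite /g; case: pickP => [j /eqP/tinj->//|/(_ k)]; rewrite eqxx.
have g_nts t : (forall k, t <> ts k) -> g t = f t.
  by move=> nt; rewrite /g; case: pickP => // k /eqP e; case: (nt k).
have sep t k : t <> ts k -> \forall r \near t, (ts k < r) = (ts k < t) /\ r <> ts k.
  move=> /eqP; rewrite neq_lt => /orP[tk|tk].
    near=> r; have rk : r < ts k by near: r; exact: lt_nbhsl.
    by rewrite ltNge (ltW rk) ltNge (ltW tk); split=> // e; rewrite e ltxx in rk.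
  near=> r; have rk : ts k < r by near: r; exact: lt_nbhsr.
  by rewrite rk tk; split=> // e; rewrite e ltxx in rk.
have : H 1 = H 0.
  apply: locally_constant => t tI.
  have [[k0 tk0]|nt] := pselect (exists k, t = ts k); last first.
    have {}nt k : t <> ts k by move=> e; apply: nt; exists k.
    have sepA : \forall r \near t, forall k, (ts k < r) = (ts k < t) /\ r <> ts k.
      by apply: (@filter_forall _ _ _ _ (nbhs_filter t)) => k; exact: sep.
    move: (loc t tI nt) sepA; apply: filterS2 => r fr sepr rI.
    rewrite /H !g_nts // => [|k]; last by case: (sepr k).
    by rewrite fr //; congr (_ - _); apply: eq_bigl => k; case: (sepr k).
  have sep' k : \forall r \near t, k != k0 -> (ts k < r) = (ts k < t) /\ r <> ts k.
    have [->|kk0] := eqVneq k k0; first by apply: (@filterE _ _ (nbhs_filter t)) => r; rewrite ?eqxx.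
    have tk : t <> ts k by rewrite tk0 => /tinj e; rewrite e eqxx in kk0.
    by have := sep t k tk; apply: filterS.
  have lt_ : \forall r \near t, r < t -> f r = L k0 by rewrite tk0; exact: left.
  have rt_ : \forall r \near t, t < r -> f r = L k0 + J k0 by rewrite tk0; exact: right.
  have sepA : \forall r \near t, forall k,
      k != k0 -> (ts k < r) = (ts k < t) /\ r <> ts k.
    by apply: (@filter_forall _ _ _ _ (nbhs_filter t)) => k; exact: sep'.
  move: lt_ rt_ sepA; apply: filterS3 => r fl fr sepr rI.
  have [rt|tr|->//] := ltgtP r t.
    rewrite /H g_nts => [|k]; last first.
      have [->|/sepr[]//] := eqVneq k k0.
      by rewrite -tk0 => e; rewrite e ltxx in rt.
    rewrite fl // tk0 g_ts; congr (_ - _); apply: eq_bigl => k.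
    have [->|/sepr[e _]] := eqVneq k k0; last by rewrite e tk0.
    by rewrite -tk0 ltxx ltNge (ltW rt).
  rewrite /H g_nts => [|k]; last first.
    have [->|/sepr[]//] := eqVneq k k0.
    by rewrite -tk0 => e; rewrite e ltxx in tr.
  rewrite fr // tk0 g_ts (bigD1 k0) /=; last by rewrite -tk0.
  rewrite opprD addrA addrK; congr (_ - _); apply: eq_bigl => k.
  have [->|/sepr[e _]] := eqVneq k k0; first by rewrite andbF ltxx.
  by rewrite andbT e tk0.
rewrite /H !g_nts => [|k e|k e]; last 2 first.
- by have := t01 k; rewrite -e ltxx.
- by have := t01 k; rewrite -e ltxx andbF.
rewrite [X in _ - X = _ -> _](eq_bigl xpredT) => [|k]; last by case/andP: (t01 k).
rewrite [X in _ = _ - X -> _]big1 => [|k]; last first.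
  by case/andP: (t01 k) => t0 _ /lt_trans/(_ t0); rewrite ltxx.
by rewrite subr0 => <-; rewrite opprB addrC subrK.
Unshelve. all: by end_near. Qed.

End Telescope.

(** * The graph on the surface *)

(** The segment followed from either of its ends, so that both ends of an edge
    can be treated as a starting point. *)
Definition oriented (R : realType) (b : bool) (D : segment R) : segment R :=
  if b then (geodesic D.1.1 D.1.2 D.2, - gtan D.1.1 D.1.2 D.2, D.2) else D.

Lemma cvg_geodesic_dir (R : realType) (A : 'M[R]_3) (x w : 'cV[R]_3) :
  (fun s => s^-1 *: (A *m geodesic x w s - A *m x)) @ 0^'+ --> A *m w.
Proof.
have lim (f : R -> R) df : is_derive (0 : R) 1 f df ->
    (fun s => s^-1 * (f s - f 0)) @ 0^'+ --> df.
  move=> [dfx <-]; apply: cvg_dnbhs_at_right.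
  have : (fun s => s^-1 *: ((f \o shift 0) (s *: 1) - f 0)) @ 0^' --> 'D_1 f 0.
    exact: dfx.
  by under eq_fun do rewrite /= addr0 /GRing.scale /= mulr1.
have lc := lim _ _ (is_derive_cosh0 R); have ls := lim _ _ (is_derive_sinh0 R).
rewrite cosh0 in lc; rewrite sinh0 in ls.
have -> : A *m w = 0 *: (A *m x) + 1 *: (A *m w) by rewrite scale0r add0r scale1r.
have -> : (fun s => s^-1 *: (A *m geodesic x w s - A *m x)) =
    (fun s => (s^-1 * (cosh s - 1)) *: (A *m x) + (s^-1 * (sinh s - 0)) *: (A *m w)).
  apply/funext => s; rewrite /geodesic mulmxDr -!scalemxAr.
  by apply/matrixP => i j; rewrite !mxE; ring.
apply: cvg_add; apply: cvg_scale; by [exact: lc | exact: ls | exact: cvg_cst].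
Qed.

Section SurfaceGraph.
Variables (R : realType) (S : topologicalType) (h : hyperbolic_structure R S).
Variables (C : universal_cover R S) (dev : cover_space C -> 'cV[R]_3).
Hypothesis hdev : developing_map h dev.
Variable rho : pi1 C -> 'M[R]_3.
Hypothesis hrho : holonomy dev rho.
Variable psi : 'cV[R]_3 -> cover_space C.
Hypothesis psiK : forall y, cone y -> dev (psi y) = normalize y.
Hypothesis devK : forall x, psi (dev x) = x.
Hypothesis psi_cont : forall y, cone y -> {for y, continuous psi}.
Hypothesis fin : forall x r, hyperboloid x -> finite_set [set a | cdist rho a x < r].
Variables (v q : pi1 C -> 'cV[R]_3) (act : pi1 C -> 'cV[R]_3 -> Prop).
Hypothesis vor : voronoi rho v q act.
Variable s : seq (segment R).
Implicit Types D E : segment R.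
Hypothesis s_uniq : uniq s.
Hypothesis s_edge : forall D, D \in s -> seg_edge q act D.
Hypothesis s_cover : forall D, seg_edge q act D -> exists2 D', D' \in s & equiv_seg rho D D'.
Hypothesis s_sep : forall D D', D \in s -> D' \in s -> equiv_seg rho D D' -> D = D'.
Variable wt : segment R -> R.
Hypothesis wt_gt0 : forall D, D \in s -> 0 < wt D.
Hypothesis wt_jump : forall D, D \in s -> exists a b,
  [/\ edge_side q act D.1.1 D.1.2 D.2 1 a, edge_side q act D.1.1 D.1.2 D.2 (-1) b
    & q a - q b = wt D *: lcross D.1.1 D.1.2].

Let rS := rho_SO hrho.
Let rM := rhoM hrho.

Definition seg_curve (D : segment R) t : cover_space C := psi (geodesic D.1.1 D.1.2 t).

(** The sign comes from the orientation of crossings: they go from the positive to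
    the negative side of the normal, against the jump. *)
Definition seg_to_edge (D : segment R) : edge R S :=
  Edge D.2 (fun t => proj (seg_curve D t)) (- wt D).

Definition graph : seq (edge R S) := [seq seg_to_edge D | D <- s].

Lemma seg_ut D : seg_edge q act D -> unit_tangent D.1.1 D.1.2.
Proof. by case. Qed.

Lemma dev_curve D t : unit_tangent D.1.1 D.1.2 ->
  dev (seg_curve D t) = geodesic D.1.1 D.1.2 t.
Proof.
move=> ut; have ht := geodesic_hyp ut t.
by rewrite psiK ?normalize_id //; exact: hyp_cone.
Qed.

Lemma deck_curve a D t : unit_tangent D.1.1 D.1.2 ->
  deck a (seg_curve D t) = seg_curve (translate rho a D) t.
Proof.
move=> ut; apply: (dev_inj hdev).
rewrite (dev_deck hrho) !dev_curve ?geodesic_mul //=.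
exact: (unit_tangent_mul (rS a)).
Qed.

Lemma continuous_curve D : unit_tangent D.1.1 D.1.2 -> continuous (seg_curve D).
Proof.
move=> ut t; apply: continuous_comp; first exact: continuous_geodesic.
by apply: psi_cont; apply: hyp_cone; exact: geodesic_hyp.
Qed.

Lemma mem_graphP e : reflect (exists2 D, D \in s & e = seg_to_edge D) (e \in graph).
Proof. exact: mapP. Qed.

Lemma lifted_graphP x : lifted_graph graph x <->
  exists D, seg_edge q act D /\ in_seg D (dev x).
Proof.
split=> [[e [t [/mem_graphP[D Ds ->] /= tl xt]]]|[D [ED [t tl ext]]]].
  have ED := s_edge Ds; have ut := seg_ut ED.
  have [a ->] := deck_transitive (esym xt).
  exists (translate rho a D); split; first exact: (seg_edgeM rS rM vor).
  by exists t => //; rewrite deck_curve // dev_curve //; exact: (unit_tangent_mul (rS a)).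
have [D' D's [a aP]] := s_cover ED; have ut := seg_ut ED; have ED' := s_edge D's.
have [t' tl' e] : in_seg D' (rho a *m dev x).
  by apply/aP/(in_segM rS); exists t.
exists (seg_to_edge D'), t'; split=> //=; first by apply/mem_graphP; exists D'.
rewrite -(proj_deck a); congr proj; apply: (dev_inj hdev).
by rewrite (dev_deck hrho) e dev_curve //; exact: seg_ut.
Qed.

(** The developing map and the chart differ by an isometry [A] near the point. *)
Lemma chart_curve_at D t i A : unit_tangent D.1.1 D.1.2 ->
  chart_dom (h := h) i (proj (seg_curve D t)) -> SO21 A ->
  (\forall y \near seg_curve D t, dev y = A *m chart (h := h) i (proj y)) ->
  \forall r \near t, chart_dom (h := h) i (proj (seg_curve D r)) /\
    chart (h := h) i (proj (seg_curve D r)) = invmx A *m geodesic D.1.1 D.1.2 r.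
Proof.
move=> ut ti SA dA.
have ct := continuous_curve ut (x := t).
have n1 : \forall r \near t, dev (seg_curve D r) = A *m chart (h := h) i (proj (seg_curve D r)).
  exact: ct dA.
have n2 : \forall r \near t, chart_dom (h := h) i (proj (seg_curve D r)).
  have nd : nbhs (proj (seg_curve D t)) (chart_dom (h := h) i).
    by apply: open_nbhs_nbhs; split=> //; exact: chart_dom_open.
  have nd2 : nbhs (seg_curve D t) (fun y => chart_dom (h := h) i (proj y)).
    exact: (@cover_proj_continuous _ _ C _ _ nd).
  exact: (ct _ nd2).
apply: filterS2 n1 n2 => r e ri; split=> //.
by rewrite -(dev_curve r ut) e mulKmx //; exact: SO21_unit.
Qed.

Lemma chart_curve D t i : unit_tangent D.1.1 D.1.2 ->
  chart_dom (h := h) i (proj (seg_curve D t)) ->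
  exists2 A, SO21 A & \forall r \near t, chart_dom (h := h) i (proj (seg_curve D r)) /\
    chart (h := h) i (proj (seg_curve D r)) = A *m geodesic D.1.1 D.1.2 r.
Proof.
move=> ut ti; have [A SA dA] := dev_local hdev ti.
by exists (invmx A); [exact: SO21_inv | exact: chart_curve_at].
Qed.

Lemma graph_geodesic e : e \in graph -> geodesic_edge h e.
Proof.
move=> /mem_graphP[D Ds ->]; have ED := s_edge Ds; have ut := seg_ut ED.
split=> /=; first by case: ED.
move=> t i tl ti; have [A SA near_t] := chart_curve ut ti.
exists (A *m gtan D.1.1 D.1.2 t).
  rewrite (nbhs_singleton near_t).2; apply: unit_tangent_mul => //.
  exact: gtan_ut.
have e0 := (nbhs_singleton near_t).2.
apply: filterS near_t => r [ri er] _; split=> //.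
rewrite er e0 -geodesic_mul geodesicD; congr (_ *m geodesic _ _ _); lra.
Qed.

(** A common point comes from a common point of one lift and a translate of the
    other; these coincide, and so do the edges since there is one edge per orbit.
    The times agree because no element of the group flips an edge. *)
Lemma graph_interior D D' t t' : D \in s -> D' \in s -> 0 < t < D.2 -> 0 <= t' <= D'.2 ->
  proj (seg_curve D t) = proj (seg_curve D' t') -> D = D' /\ t = t'.
Proof.
move=> Ds D's tl tl' e; have [a] := deck_transitive e.
have ED := s_edge Ds; have ED' := s_edge D's; have ut := seg_ut ED; have ut' := seg_ut ED'.
rewrite deck_curve // => /(congr1 dev).
rewrite !dev_curve //; last exact: (unit_tangent_mul (rS a)).
move=> eg; have EaD := seg_edgeM rS rM vor a ED.
have aP : forall x, in_seg (translate rho a D) x <-> in_seg D' x.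
  by apply: (edge_overlap vor EaD ED' tl); exists t'.
have DD' : D = D' by apply: s_sep => //; exists a.
split=> //; rewrite -DD' in aP eg.
have a1 := segment_stab rS (rho_free hdev hrho) ED aP.
move: eg; rewrite a1 (translate1 rS rM) => /esym; exact: geodesic_inj.
Qed.

Lemma graph_embedded : embedded graph.
Proof.
split.
  rewrite map_inj_in_uniq // => D D' Ds D's e.
  have l0 : 0 < D.2 by case: (s_edge Ds).
  have el : D.2 = D'.2 by have := congr1 (@elen _ _) e.
  have ec := congr1 (fun e => ecurve e (D.2 / 2)) e.
  have [||//] := graph_interior Ds D's _ _ ec.
    by apply/andP; split; lra.
  by rewrite -el; apply/andP; split; lra.
move=> _ _ t t' /mem_graphP[D Ds ->] /mem_graphP[D' D's ->] /= tl tl' e.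
by have [-> ->] := graph_interior Ds D's tl tl' e.
Qed.

Lemma oriented_edge b D : seg_edge q act D -> seg_edge q act (oriented b D).
Proof. by case: b => //; exact: cell_edge_flip. Qed.

Lemma in_seg_oriented b D x : in_seg (oriented b D) x <-> in_seg D x.
Proof. by case: b => //; exact: on_seg_flip. Qed.

Lemma curve_from_oriented b D r :
  curve_from (seg_to_edge D) b r = proj (seg_curve (oriented b D) r).
Proof.
rewrite /curve_from /seg_curve; case: b => //=.
by rewrite geodesic_flip.
Qed.

Lemma endpoint_oriented b D :
  endpoint (seg_to_edge D) b = proj (seg_curve (oriented b D) 0).
Proof.
rewrite /endpoint /seg_curve; case: b => //=.
by rewrite geodesic_flip subr0.
Qed.

(** The jump across an edge, expressed at its end of index [b] once this end has
    been moved to a prescribed point by [c]. *)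
Lemma oriented_lexmax b D c : D \in s ->
  let E := translate rho c (oriented b D) in exists a a',
  [/\ lexmax q act E.1.1 E.1.2 (lcross E.1.1 E.1.2) a,
      lexmax q act E.1.1 E.1.2 (- lcross E.1.1 E.1.2) a'
    & q a - q a' = wt D *: lcross E.1.1 E.1.2].
Proof.
move=> Ds E; have ED := s_edge Ds.
have EO := oriented_edge b ED; have EE := seg_edgeM rS rM vor c EO.
have [a [a' [sa sa' e]]] : exists a a',
  [/\ edge_side q act (oriented b D).1.1 (oriented b D).1.2 (oriented b D).2 1 a,
      edge_side q act (oriented b D).1.1 (oriented b D).1.2 (oriented b D).2 (-1) a'
    & q a - q a' = wt D *: lcross (oriented b D).1.1 (oriented b D).1.2].
  have [a [a' [sa sa' e]]] := wt_jump Ds; case: b {E EO EE} => /=; last by exists a, a'.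
  exists a', a; split.
  - by have := edge_side_flip ED sa'; rewrite opprK.
  - exact: (edge_side_flip ED sa).
  - by rewrite (lcross_flip ED) scalerN -e opprB.
have sE := edge_sideM rS vor c; exists (c * a)%g, (c * a')%g; split.
- by rewrite -[lcross _ _]scale1r; apply: (edge_lexmax vor EE); exact: sE.
- by rewrite -scaleN1r; apply: (edge_lexmax vor EE); exact: sE.
rewrite !(vor_siteM vor) opprD addrACA subrr addr0 -mulmxBr e -scalemxAr.
by rewrite /E /= (SO21_lcross (rS c)).
Qed.

(** In the chart, the edge is the image of a geodesic by [invmx A], whose tangent
    vector is unique as a limit. *)
Lemma oriented_tangent b D c x i A w : D \in s ->
  deck c (seg_curve (oriented b D) 0) = x -> chart_dom (h := h) i (proj x) -> SO21 A ->
  (\forall y \near x, dev y = A *m chart (h := h) i (proj y)) ->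
  edge_tangent (h := h) i (seg_to_edge D) b w ->
  w = invmx A *m (translate rho c (oriented b D)).1.2.
Proof.
move=> Ds ex xi SA dA; set E := translate rho c _.
have EO := oriented_edge b (s_edge Ds); have utO := seg_ut EO.
have EE := seg_edgeM rS rM vor c EO; have utE := seg_ut EE.
have cE r : proj (seg_curve E r) = curve_from (seg_to_edge D) b r.
  by rewrite curve_from_oriented -deck_curve // proj_deck.
have eE : proj (seg_curve E 0) = endpoint (seg_to_edge D) b.
  by rewrite endpoint_oriented -deck_curve // proj_deck.
have xE : seg_curve E 0 = x by rewrite -deck_curve.
rewrite -xE in xi dA.
have near0 := chart_curve_at utE xi SA dA.
have [_ e0] := nbhs_singleton near0.
rewrite /edge_tangent => tan.
have lim := @cvg_geodesic_dir R (invmx A) E.1.1 E.1.2.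
have tan' : (fun r => r^-1 *: (invmx A *m geodesic E.1.1 E.1.2 r - invmx A *m E.1.1)) @ 0^'+ --> w.
  apply: cvg_trans tan; apply: near_eq_cvg.
  have near0' : \forall r \near 0^'+, chart_dom (h := h) i (proj (seg_curve E r)) /\
    chart (h := h) i (proj (seg_curve E r)) = invmx A *m geodesic E.1.1 E.1.2 r.
    exact: cvg_within near0.
  apply: filterS near0' => r [_ er].
  by rewrite -cE -eE er e0 geodesic0.
exact: (cvg_unique (@norm_hausdorff _ _) tan' lim).
Qed.

(** Edges leaving a point in the same direction overlap. This makes the ends of
    edges of the graph at a vertex correspond to directions at a lift of it. *)
Lemma oriented_inj b D c b' D' c' : D \in s -> D' \in s ->
  (translate rho c (oriented b D)).1 = (translate rho c' (oriented b' D')).1 ->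
  [/\ D = D', b = b' & c = c'].
Proof.
move=> Ds D's e; have ED := s_edge Ds; have ED' := s_edge D's.
have EE := seg_edgeM rS rM vor c (oriented_edge b ED).
have EE' := seg_edgeM rS rM vor c' (oriented_edge b' ED').
set E := translate rho c _ in e EE; set E' := translate rho c' _ in e EE'.
have [_ l0 _] := EE; have [_ l0' _] := EE'.
pose t := Num.min E.2 E'.2 / 2.
have t0 : 0 < t by rewrite divr_gt0 // lt_min l0.
have [tl tl'] : t < E.2 /\ t < E'.2.
  by split; rewrite /t ltr_pdivrMr // gt_min; apply/orP; [left|right]; lra.
have tE : 0 < t < E.2 by rewrite t0.
have tE' : on_seg E'.1.1 E'.1.2 E'.2 (geodesic E.1.1 E.1.2 t).
  by rewrite e; exists t => //; rewrite !ltW.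
have seg := edge_overlap vor EE EE' tE tE'.
have cc x : in_seg (translate rho c D) x <-> in_seg (translate rho c' D') x.
  rewrite !(in_segV rS rM) -(in_seg_oriented b D) -(in_seg_oriented b' D').
  by rewrite -!(in_segV rS rM); exact: seg.
have DcD' x : in_seg (translate rho (c'^-1 * c)%g D) x <-> in_seg D' x.
  by rewrite (translateM rM) (in_segV rS rM) invgK cc (in_segM rS).
have DD' : D = D' by apply: s_sep => //; exists (c'^-1 * c)%g.
have c1 : (c'^-1 * c)%g = 1%g.
  by apply: (segment_stab rS (rho_free hdev hrho) ED); rewrite {2}DD'.
have c_c' : c = c' by rewrite -[c']mulg1 -c1 mulgA mulgV mul1g.
split=> //; move: (congr1 fst e) ED; rewrite /E /E' c_c' -DD' => /(can_inj (rhoK rS rM c')).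
case: D {Ds e ED' EE EE' E E' l0 l0' t t0 tl tl' tE tE' seg cc DcD' DD'} => [[p u] l] + [/= pu l0 _].
have ne : geodesic p u 0 <> geodesic p u l by move=> /(geodesic_inj pu) e0; move: l0; rewrite -e0 ltxx.
by case: b; case: b' => //= e0; case: ne; rewrite geodesic0 //; exact: esym.
Qed.

(** Lift the vertex to a point [x]. Each end of an edge at the vertex has exactly
    one lift ending at [x], so that the condition becomes [balanced_link] at
    [x], read in the chart. *)
Lemma graph_balanced : balanced h graph.
Proof.
move=> p0 i w pi tan.
have [_ /(_ p0)[x xp] _] := proj_covering C.
rewrite -xp in pi tan *; have [A SA dA] := dev_local hdev pi.
pose seg (k : 'I_(size s)) := tnth (in_tuple s) k.
have segs k : seg k \in s by exact: mem_tnth.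
pose P : pred ('I_(size s) * bool) :=
  fun kb => endpoint (seg_to_edge (seg kb.1)) kb.2 == proj x.
rewrite /graph big_map big_tnth /= (pair_big_dep xpredT (fun k b => P (k, b))) /=.
rewrite (eq_bigl (mem P)); last by case.
rewrite big_sub.
have /choice[c cP] : forall kb : {kb in P}, exists c,
    deck c (seg_curve (oriented (val kb).2 (seg (val kb).1)) 0) = x.
  move=> [[k b] /= /eqP]; rewrite endpoint_oriented => /deck_transitive[c ->].
  by exists c.
pose E (kb : {kb in P}) := translate rho (c kb) (oriented (val kb).2 (seg (val kb).1)).
have EE kb : seg_edge q act (E kb).
  by apply: (seg_edgeM rS rM vor); apply: oriented_edge; exact: s_edge.
have Ex kb : (E kb).1.1 = dev x.
  have utO := seg_ut (oriented_edge (val kb).2 (s_edge (segs (val kb).1))).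
  by rewrite -(cP kb) deck_curve // dev_curve ?geodesic0 //; exact: seg_ut (EE kb).
pose W kb := (E kb).1.2.
have xW kb : unit_tangent (dev x) (W kb) by rewrite -(Ex kb); exact: seg_ut (EE kb).
have wW kb : w (seg_to_edge (seg (val kb).1)) (val kb).2 = invmx A *m W kb.
  apply: (oriented_tangent (segs _) (cP kb) pi SA dA).
  apply: tan; first by apply/mem_graphP; exists (seg (val kb).1).
  by apply/eqP; case: kb.
rewrite (eq_bigr (fun kb => invmx A *m (- wt (seg (val kb).1) *: W kb))); last first.
  by move=> kb _; rewrite wW -scalemxAr.
rewrite -mulmx_sumr.
suff sum0 : \sum_kb wt (seg (val kb).1) *: W kb = 0.
  rewrite (eq_bigr (fun kb => - (wt (seg (val kb).1) *: W kb))); last first.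
    by move=> kb _; rewrite scaleNr.
  by rewrite sumrN sum0 oppr0 mulmx0.
have /choice[a /choice[a' aP]] : forall kb, exists a a',
  [/\ lexmax q act (dev x) (W kb) (lcross (dev x) (W kb)) a,
      lexmax q act (dev x) (W kb) (- lcross (dev x) (W kb)) a'
    & q a - q a' = wt (seg (val kb).1) *: lcross (dev x) (W kb)].
  move=> kb; rewrite -(Ex kb); exact: oriented_lexmax.
have [kb0|none] := pselect (exists kb : {kb in P}, True); last first.
  by rewrite big1 // => kb _; case: none; exists kb.
have hx := dev_hyp hdev x.
have inj : injective W.
  move=> kb kb' e.
  have e1 : (E kb).1 = (E kb').1.
    rewrite [LHS]surjective_pairing [RHS]surjective_pairing !Ex.
    by congr (_, _); exact: e.
  have [eD eb _] := oriented_inj (segs _) (segs _) e1.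
  apply: val_inj; rewrite [LHS]surjective_pairing [RHS]surjective_pairing eb.
  congr (_, _); apply/val_inj/eqP; move: eD; rewrite /seg !(tnth_nth (seg (val kb).1)) /=.
  by move/eqP; rewrite nth_uniq.
apply: (@balanced_link _ _ _ fin v q act vor _ (dev x) W (fun kb => wt (seg (val kb).1)) a a' hx xW inj).
- by move=> kb; case: (aP kb).
- by move=> kb; case: (aP kb).
- by move=> kb; apply: wt_gt0.
- by move=> kb; case: (aP kb).
move=> w' d d' xw' dx d'x qdd' edd' dmax.
have [p [u [l [Epul xpul near_t]]]] := tie_edge rS vor xw' dx d'x qdd' edd' dmax.
have [D Ds [c0 c0P]] := s_cover (Epul : seg_edge q act (p, u, l)).
pose c1 := c0^-1%g; have ED := s_edge Ds.
have c1P y : in_seg (translate rho c1 D) y <-> in_seg (p, u, l) y.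
  by rewrite (in_segV rS rM) /c1 invgK -c0P (in_segM rS).
have Ec1 := seg_edgeM rS rM vor c1 ED.
have [t /andP[t0 tl] et] : in_seg (translate rho c1 D) (dev x) by apply/c1P.
(* the edge cannot go through [x], as another edge ends there *)
have [b tb] : exists b : bool, t = if b then D.2 else 0.
  have [->|tn0] := eqVneq t 0; first by exists false.
  have [->|tnl] := eqVneq t D.2; first by exists true.
  have tin : 0 < t < D.2 by rewrite !lt_neqAle eq_sym tn0 t0 tnl.
  exfalso; have [kb _] := kb0.
  have xkb : on_seg (E kb).1.1 (E kb).1.2 (E kb).2
      (geodesic (translate rho c1 D).1.1 (translate rho c1 D).1.2 t).
    by rewrite -et Ex; exists 0; [rewrite lexx ltW //; case: (EE kb) | rewrite geodesic0].
  have ov := edge_overlap vor Ec1 (EE kb) tin xkb.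
  apply: (@start_not_interior _ _ _ D.2 (W kb) (E kb).2 t (seg_ut Ec1) _ tin).
    by rewrite -et.
  by move=> y /ov; rewrite Ex et.
have start : deck c1 (seg_curve (oriented b D) 0) = x.
  apply: (dev_inj hdev); rewrite (dev_deck hrho).
  have utO := seg_ut (oriented_edge b ED).
  rewrite dev_curve // geodesic0 et tb -geodesic_mul.
  by case: (b) => /=; rewrite ?geodesic0.
have Dk : (index D s < size s)%N by rewrite index_mem.
pose k0 := Ordinal Dk.
have kD : seg k0 = D by rewrite /seg (tnth_nth D) /= nth_index.
have Pk : (k0, b) \in P.
  have /eqP : endpoint (seg_to_edge (seg k0)) b = proj x.
    by rewrite kD endpoint_oriented -start proj_deck.
  by [].
pose kb1 : {kb in P} := exist _ (k0, b) Pk.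
exists kb1.
have ck : c kb1 = c1.
  apply: (@deck_inj _ _ C _ _ (seg_curve (oriented b D) 0)).
  by rewrite start -[RHS](cP kb1) /= kD.
have [r [xr r0]] := @filter_ex _ _ (at_right_proper_filter (0 : R)) _
    (filterI near_t (@nbhs_right_gt R 0)).
have /c1P := xr.
rewrite (in_segV rS rM) -(in_seg_oriented b D) -(in_segV rS rM).
have Ekb1 : E kb1 = translate rho c1 (oriented b D) by rewrite /E ck /= kD.
rewrite -Ekb1 => -[r' /andP[r'0 _] er]; rewrite Ex in er.
exact: (geodesic_dir xw' (xW kb1) r0 r'0 er).
Qed.

(** ** Crossings *)

Variable cell : 'cV[R]_3 -> pi1 C.
Hypothesis cellP : forall y, hyperboloid y -> act (cell y) y.

(** On an edge this depends on the choice of a cell; only the values off the graph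
    matter. *)
Definition site_at (x : cover_space C) : 'cV[R]_3 := q (cell (dev x)).

Lemma cell_act x : act (cell (dev x)) (dev x).
Proof. by apply: cellP; exact: (dev_hyp hdev). Qed.

(** Otherwise the point would be on an edge, by [coactive_on_edge]. *)
Lemma off_graph x a b : ~ lifted_graph graph x ->
  act a (dev x) -> act b (dev x) -> q a = q b.
Proof.
move=> nx ax bx; apply: contrapT => qab; apply: nx; apply/lifted_graphP.
have [p [u [l [E xE]]]] := coactive_on_edge rS fin vor (dev_hyp hdev x) ax bx qab.
by exists (p, u, l).
Qed.

Lemma site_at_local x : ~ lifted_graph graph x ->
  \forall y \near x, site_at y = site_at x.
Proof.
move=> nx.
have loc : nbhs x (fun y => hyperboloid (dev y) ->
    forall a, act a (dev y) -> act a (dev x)).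
  exact: (dev_continuous hdev (vor_local vor (dev_hyp hdev x))).
apply: filterS loc => y /= yl; apply: (off_graph nx); last exact: cell_act.
by apply: yl; [exact: (dev_hyp hdev) | exact: cell_act].
Qed.

Lemma within_cvg (sigma : R -> cover_space C) a b t :
  {within `[a, b]%classic, continuous sigma} -> a <= t <= b ->
  forall W, nbhs (sigma t) W -> \forall r \near t, a <= r <= b -> W (sigma r).
Proof.
move=> /subspace_continuousP cs tI W tW.
have tI' : `[a, b]%classic t by rewrite /= in_itv.
have nW : \forall r \near t, `[a, b]%classic r -> W (sigma r) := cs t tI' W tW.
by apply: filterS nW => r H rI; apply: H; rewrite /= in_itv.
Qed.

(** Lifts are unique within a sheet. Agreement at two points is enough, as these
    determine the geodesic which carries the lift. *)
Lemma lift_local D (c : R -> cover_space C) t : D \in s ->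
  lift_of (seg_to_edge D) c -> 0 < t < D.2 ->
  exists2 a, c t = seg_curve (translate rho a D) t &
    exists2 r, 0 <= r <= D.2 & r <> t /\ c r = seg_curve (translate rho a D) r.
Proof.
move=> Ds [/= cc pc] tl; have ut := seg_ut (s_edge Ds).
have tl' : 0 <= t <= D.2 by case/andP: tl => *; rewrite !ltW.
have [a ea] := deck_transitive (esym (pc t tl')).
have utE : unit_tangent (translate rho a D).1.1 (translate rho a D).1.2.
  exact: (unit_tangent_mul (rS a)).
rewrite deck_curve // in ea; exists a => //.
have [V [oV Vx injV _]] := sheet (c t).
have nV : nbhs (c t) V by apply: open_nbhs_nbhs.
have n1 := within_cvg cc tl' nV.
have n2 : \forall r \near t, V (seg_curve (translate rho a D) r).
  by apply: (continuous_curve utE); rewrite -ea.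
have n3 : \forall r \near t, r < D.2 by apply: lt_nbhsl; case/andP: tl.
have n123 : \forall r \near t^'+,
    [/\ 0 <= r <= D.2 -> V (c r), V (seg_curve (translate rho a D) r) & r < D.2].
  apply: cvg_within; apply: filterS3 n1 n2 n3 => r *; by split.
have [r [[h1 h2 h3] tr]] := @filter_ex _ _ (at_right_proper_filter t) _
    (filterI n123 (@nbhs_right_gt R t)).
have rl : 0 <= r <= D.2.
  by rewrite (ltW h3) andbT; apply: ltW; apply: lt_trans tr; case/andP: tl.
exists r => //; split; first by move=> e; rewrite e ltxx in tr.
apply: injV; rewrite ?inE; [exact: h1 | exact: h2 |].
by rewrite pc // -deck_curve // proj_deck.
Qed.

(** The geodesic [(p, u)] of the crossing is the one of a translate of the standard
    lift of the edge, with either orientation. Both the normal and the order of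
    the two sides change with the orientation. *)
Lemma crossing_jump (sigma : R -> cover_space C) t e p u :
  {within `[0, 1]%classic, continuous sigma} -> 0 < t < 1 -> e \in graph ->
  crossing dev sigma t e p u ->
  exists L, (\forall r \near t^'-, site_at (sigma r) = L) /\
    (\forall r \near t^'+, site_at (sigma r) = L + eweight e *: lcross p u).
Proof.
move=> cs t01 /mem_graphP[D Ds ->] [c [r0 [lc rl cr [pu cpu] [left right]]]] /=.
have [a ea [r rl' [rr0 er]]] := lift_local Ds lc rl.
set E := translate rho a D in ea er.
have EE : seg_edge q act E by apply: (seg_edgeM rS rM vor); exact: s_edge.
have utE := seg_ut EE.
have rl0 : 0 <= r0 <= D.2 by case/andP: rl => *; rewrite !ltW.
have [r1 e1] := cpu _ rl0; have [r2 e2] := cpu _ rl'.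
rewrite ea dev_curve // in e1; rewrite er dev_curve // in e2.
have r0r : r0 != r by apply/eqP => e0; apply: rr0.
have nn := geodesic_normal utE pu r0r e1 e2.
have [b [b' [sb sb' jump]]] := wt_jump Ds.
have sE := edge_sideM rS vor a sb; have sE' := edge_sideM rS vor a sb'.
have jumpE : q (a * b)%g - q (a * b')%g = wt D *: lcross E.1.1 E.1.2.
  rewrite !(vor_siteM vor) opprD addrACA subrr addr0 -mulmxBr jump -scalemxAr.
  by rewrite /E /= (SO21_lcross (rS a)).
have t01' : 0 <= t <= 1 by case/andP: t01 => *; rewrite !ltW.
have m1 : (- 1 : R) != 0 by rewrite oppr_eq0 oner_eq0.
have loc k d : k != 0 -> edge_side q act E.1.1 E.1.2 E.2 k d ->
    \forall r \near t, 0 < k * mink (lcross E.1.1 E.1.2) (dev (sigma r)) ->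
      site_at (sigma r) = q d.
  move=> k0 sd.
  have nd := edge_local vor EE k0 rl sd.
  have nsig : nbhs (sigma t) (fun y => hyperboloid (dev y) ->
      0 < k * mink (lcross E.1.1 E.1.2) (dev y) -> forall b, act b (dev y) -> q b = q d).
    have nd' : nbhs (dev (sigma t)) (fun z => hyperboloid z ->
      0 < k * mink (lcross E.1.1 E.1.2) z -> forall b, act b z -> q b = q d).
      by rewrite -cr ea dev_curve.
    exact: (dev_continuous hdev nd').
  have n1 := within_cvg cs t01' nsig.
  have n0 : \forall r \near t, 0 < r by apply: lt_nbhsr; case/andP: t01.
  have n2 : \forall r \near t, r < 1 by apply: lt_nbhsl; case/andP: t01.
  apply: filterS3 n0 n1 n2 => r' h0 H h1 pos.
  apply: H => //; first by rewrite !ltW.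
    exact: (dev_hyp hdev).
  exact: cell_act.
have locp := loc 1 _ (oner_neq0 R) sE; have locm := loc (- 1) _ m1 sE'.
have wl (P : R -> Prop) : (\forall r \near t, P r) -> \forall r \near t^'-, P r.
  exact: cvg_within.
have wr (P : R -> Prop) : (\forall r \near t, P r) -> \forall r \near t^'+, P r.
  exact: cvg_within.
case: nn => nE; rewrite nE in jumpE locp locm; [exists (q (a * b)%g)|exists (q (a * b')%g)].
  split.
    move: left (wl _ locp); apply: filterS2 => r' lt_ H; apply: H.
    by rewrite mul1r -sideE.
  move: right (wr _ locm); apply: filterS2 => r' lt_ H; rewrite H.
    by rewrite scaleNr -jumpE opprB addrC subrK.
  by rewrite mulN1r oppr_gt0 -sideE.
split.
  move: left (wl _ locm); apply: filterS2 => r' lt_ H; apply: H.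
  by rewrite mulN1r minkNl opprK -sideE.
move: right (wr _ locp); apply: filterS2 => r' lt_ H; rewrite H.
  by rewrite scaleNr -scalerN -jumpE addrC subrK.
by rewrite mul1r minkNl oppr_gt0 -sideE.
Qed.

(** The sum of the jumps along the path telescopes. *)
Lemma crossing_sumE x y X : ~ lifted_graph graph x -> ~ lifted_graph graph y ->
  crossing_sum dev graph x y X -> X = hat (site_at y) - hat (site_at x).
Proof.
move=> nx ny [sigma [n [ts [es [ps [us [cs [s0 s1] [tinj tsP] cr ->]]]]]]].
have lg k : 0 <= ts k <= 1 /\ lifted_graph graph (sigma (ts k)).
  by apply/tsP; exists k.
have t01 k : 0 < ts k < 1.
  have [/andP[t0 t1] l] := lg k; rewrite !lt_neqAle t0 t1 !andbT; apply/andP; split.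
    by apply/eqP => e; apply: nx; rewrite -s0 e.
  by apply/eqP => e; apply: ny; rewrite -s1 -e.
have /choice[L LP] : forall k, exists L,
    (\forall r \near (ts k)^'-, site_at (sigma r) = L) /\
    (\forall r \near (ts k)^'+, site_at (sigma r) = L + eweight (es k) *: lcross (ps k) (us k)).
  by move=> k; have [esk crk] := cr k; exact: (crossing_jump cs (t01 k) esk crk).
have := @sum_of_jumps R _ (site_at \o sigma) n ts L
  (fun k => eweight (es k) *: lcross (ps k) (us k)) tinj t01.
rewrite /= s0 s1 -hatN -hatD => ->.
- rewrite (big_morph (@hat R) (@hatD R) (id1 := 0)); last by rewrite -(scale0r 0) hatZ scale0r.
  by apply: eq_bigr => k _; rewrite inf_translationE hatZ.
- move=> t tI nt.
  have nl : ~ lifted_graph graph (sigma t).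
    by move=> l; have [k ek] := (tsP t).1 (conj tI l); exact: (nt k).
  exact: (within_cvg cs tI (site_at_local nl)).
- by move=> k; case: (LP k).
- by move=> k; case: (LP k).
Qed.

(** ** Existence of admissible paths *)

Lemma off_graph_open (x : cover_space C) : ~ lifted_graph graph x ->
  \forall y \near x, ~ lifted_graph graph y.
Proof.
move=> nx.
have loc : nbhs x (fun y => hyperboloid (dev y) ->
    forall a, act a (dev y) -> act a (dev x)).
  exact: (dev_continuous hdev (vor_local vor (dev_hyp hdev x))).
apply: filterS loc => y yl /lifted_graphP[E [EE yE]].
have hy := dev_hyp hdev y; have [_ _ [a [b [qab ab]]]] := EE.
have [ay by_] := (ab _ hy).2 yE.
by apply: qab; apply: (off_graph nx); exact: yl.
Qed.

(** Cells near [x] contain [x], hence have aligned sites, and two of them can only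
    tie on the line of the edge. *)
Lemma on_graph_local E t x : seg_edge q act E -> 0 < t < E.2 ->
  dev x = geodesic E.1.1 E.1.2 t ->
  \forall y \near x, lifted_graph graph y -> mink (lcross E.1.1 E.1.2) (dev y) = 0.
Proof.
move=> EE tl ex.
have loc : nbhs x (fun y => hyperboloid (dev y) ->
    forall a, act a (dev y) -> act a (dev x)).
  exact: (dev_continuous hdev (vor_local vor (dev_hyp hdev x))).
apply: filterS loc => y yl /lifted_graphP[E' [EE' yE']].
have hy := dev_hyp hdev y; have [_ _ [a [b [qab ab]]]] := EE'.
have [ay by_] := (ab _ hy).2 yE'.
have ax := yl hy a ay; have bx := yl hy b by_; rewrite ex in ax bx.
have aE := edge_act_interior vor EE tl ax; have bE := edge_act_interior vor EE tl bx.
have := vor_eq vor hy ay by_ => /eqP; rewrite -subr_eq0 -minkNl -minkDl.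
rewrite (edge_act_sub vor EE aE bE) minkZl mulf_eq0 => /orP[/eqP e|/eqP//].
case: qab; apply/eqP; rewrite -subr_eq0 (edge_act_sub vor EE aE bE).
by rewrite e scale0r.
Qed.

Lemma lifted_graph_curve (x : cover_space C) : lifted_graph graph x ->
  exists D c t, [/\ D \in s, 0 <= t <= D.2 & x = seg_curve (translate rho c D) t].
Proof.
move=> [e [t [/mem_graphP[D Ds ->] /= tl xt]]].
have [a ea] := deck_transitive (esym xt).
by exists D, a, t; split=> //; rewrite ea deck_curve //; exact: seg_ut (s_edge Ds).
Qed.

(** Transversality makes the crossing times isolated, hence finite in number by
    compactness of the interval, and makes the path change sides at each of
    them. *)
Lemma path_crossing_sum (gam : R -> 'cV[R]_3) : continuous gam ->
  (forall r, 0 <= r <= 1 -> cone (gam r)) ->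
  ~ lifted_graph graph (psi (gam 0)) -> ~ lifted_graph graph (psi (gam 1)) ->
  (forall t D c t0, 0 < t < 1 -> D \in s -> 0 <= t0 <= D.2 ->
     let E := translate rho c D in normalize (gam t) = geodesic E.1.1 E.1.2 t0 ->
     0 < t0 < D.2 /\ exists2 d, (\forall r \near t, gam r = gam t + (r - t) *: d) &
       mink (lcross E.1.1 E.1.2) d <> 0) ->
  exists X, crossing_sum dev graph (psi (gam 0)) (psi (gam 1)) X.
Proof.
move=> cgam gcone n0 n1 trans; pose sigma t := psi (gam t).
have csig t : 0 <= t <= 1 -> {for t, continuous sigma}.
  move=> tI; apply: continuous_comp; first exact: cgam.
  exact: psi_cont (gcone t tI).
have wsig : {within `[0, 1]%classic, continuous sigma}.
  apply/subspace_continuousP => t; rewrite /= in_itv => /csig ct.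
  by apply: cvg_trans ct; apply: cvg_app; exact: cvg_within.
have dsig t : 0 <= t <= 1 -> dev (sigma t) = normalize (gam t).
  by move=> tI; rewrite psiK //; exact: gcone.
have in01 t : 0 <= t <= 1 -> lifted_graph graph (sigma t) -> 0 < t < 1.
  move=> /andP[t0 t1] l; rewrite !lt_neqAle t0 t1 !andbT; apply/andP; split.
    by apply/eqP => e; apply: n0; rewrite e.
  by apply/eqP => e; apply: n1; rewrite -e.
(* up to a positive factor, the pairing with the normal is affine near [t] *)
have side_near t D c t0 d : 0 < t < 1 -> D \in s ->
    let E := translate rho c D in sigma t = seg_curve E t0 ->
    (\forall r \near t, gam r = gam t + (r - t) *: d) ->
    \forall r \near t, exists2 k, 0 < k &
      mink (lcross E.1.1 E.1.2) (dev (sigma r)) = k * ((r - t) * mink (lcross E.1.1 E.1.2) d).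
  move=> t01 Ds E et affine; have [tt0 tt1] := andP t01.
  have tI : 0 <= t <= 1 by rewrite !ltW.
  have utE := seg_ut (seg_edgeM rS rM vor c (s_edge Ds)).
  have m0 : mink (lcross E.1.1 E.1.2) (gam t) = 0.
    have := dsig t tI; rewrite et dev_curve // => e.
    have := normal_geodesic utE t0; rewrite e minkZr => /eqP.
    by rewrite mulf_eq0 gt_eqF ?normalize_gt0 //=; [move/eqP | exact: gcone].
  have r0 : \forall r \near t, 0 < r by exact: lt_nbhsr.
  have r1 : \forall r \near t, r < 1 by exact: lt_nbhsl.
  apply: filterS3 affine r0 r1 => r ar r0 r1.
  have rI : 0 <= r <= 1 by rewrite !ltW.
  exists (Num.sqrt (- mink (gam r) (gam r)))^-1.
    by apply: normalize_gt0; exact: gcone.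
  have mr : mink (lcross E.1.1 E.1.2) (gam r) = (r - t) * mink (lcross E.1.1 E.1.2) d.
    by rewrite ar minkDr minkZr m0 add0r.
  by rewrite dsig // minkZr mr.
pose T := {t : R | lifted_graph graph (sigma t)}.
have fT : finite_set [set t : T | `[0, 1]%classic (sval t)].
  apply: compact_finite; first exact: segment_compact.
  move=> t; rewrite /= in_itv => /= tI.
  have [l|nl] := pselect (lifted_graph graph (sigma t)); last first.
    exists [set r | ~ lifted_graph graph (sigma r)].
      exact: (csig t tI _ (off_graph_open nl)).
    by apply: (sub_finite_set _ (finite_set0 _)) => -[r lr] /=.
  have t01 := in01 t tI l; have [D [c [t0 [Ds t0D et]]]] := lifted_graph_curve l.
  have EE := seg_edgeM rS rM vor c (s_edge Ds); have utE := seg_ut EE.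
  have dt : normalize (gam t) = geodesic (translate rho c D).1.1 (translate rho c D).1.2 t0.
    by rewrite -dsig // et dev_curve.
  have [t0in [d affine md]] := trans t D c t0 t01 Ds t0D dt.
  have e0 := dsig t tI; rewrite dt in e0.
  have n1' : \forall r \near t, lifted_graph graph (sigma r) ->
      mink (lcross (translate rho c D).1.1 (translate rho c D).1.2) (dev (sigma r)) = 0.
    exact: (csig t tI _ (on_graph_local EE t0in e0)).
  have n2 := side_near t D c t0 d t01 Ds et affine.
  exists [set r | lifted_graph graph (sigma r) -> r = t].
    apply: filterS2 n1' n2 => r h1 [k k0 h2] lr; move: (h1 lr); rewrite h2 => /eqP.
    rewrite !mulf_eq0 gt_eqF //= subr_eq0 => /orP[/eqP//|/eqP//].
  apply: (sub_finite_set _ (finite_set1 (exist _ t l : T))) => -[r lr] /= /(_ lr) e.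
  by subst r; congr exist; exact: Prop_irrelevance.
have /finite_seqP[ts0 ts0E] : finite_set [set t | 0 <= t <= 1 /\ lifted_graph graph (sigma t)].
  apply: (@sub_finite_set _ _ (sval @` [set t : T | `[0, 1]%classic (sval t)])).
    move=> t [tI l]; have tI' : `[0, 1]%classic t by rewrite /= in_itv.
    by exists (exist _ t l).
  exact: finite_image.
pose ts1 := undup ts0.
have tsP t : (0 <= t <= 1 /\ lifted_graph graph (sigma t)) <-> t \in ts1.
  rewrite mem_undup; change ([set t | 0 <= t <= 1 /\ lifted_graph graph (sigma t)] t <-> [set` ts0] t).
  by rewrite ts0E.
pose ts (k : 'I_(size ts1)) := tnth (in_tuple ts1) k.
have tsk k : 0 <= ts k <= 1 /\ lifted_graph graph (sigma (ts k)).
  by apply/tsP; exact: mem_tnth.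
have /choice[ek ekP] : forall k, exists epu : edge R S * 'cV[R]_3 * 'cV[R]_3,
    epu.1.1 \in graph /\ crossing dev sigma (ts k) epu.1.1 epu.1.2 epu.2.
  move=> k; move: (ts k) (tsk k) => t [tI l].
  have t01 := in01 t tI l; have [D [c [t0 [Ds t0D et]]]] := lifted_graph_curve l.
  have EE := seg_edgeM rS rM vor c (s_edge Ds); have utE := seg_ut EE.
  set E := translate rho c D in et EE utE.
  have dt : normalize (gam t) = geodesic E.1.1 E.1.2 t0 by rewrite -dsig // et dev_curve.
  have [t0in [d affine md]] := trans t D c t0 t01 Ds t0D dt; rewrite -/E in md.
  have n2 := side_near t D c t0 d t01 Ds et affine; rewrite -/E in n2.
  have lift : lift_of (seg_to_edge D) (seg_curve E).
    split; first by apply: continuous_subspaceT; exact: continuous_curve.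
    by move=> r rl; rewrite /E -deck_curve ?proj_deck //; exact: seg_ut (s_edge Ds).
  have wl (P : R -> Prop) : (\forall r \near t, P r) -> \forall r \near t^'-, P r.
    exact: cvg_within.
  have wr (P : R -> Prop) : (\forall r \near t, P r) -> \forall r \near t^'+, P r.
    exact: cvg_within.
  have gtt : \forall r \near t^'+, t < r by exact: nbhs_right_gt.
  have ltt : \forall r \near t^'-, r < t by exact: nbhs_left_lt.
  have [mneg|mpos] := ltrP (mink (lcross E.1.1 E.1.2) d) 0.
    exists (seg_to_edge D, E.1.1, E.1.2) => /=; split; first by apply/mem_graphP; exists D.
    exists (seg_curve E), t0; split=> //.
      by split=> // r rl; exists r; rewrite dev_curve.
    split.
      move: ltt (wl _ n2); apply: filterS2 => r rt [k' k0 e]; rewrite sideE e.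
      by rewrite mulr_gt0 // nmulr_rgt0 // subr_lt0.
    move: gtt (wr _ n2); apply: filterS2 => r rt [k' k0 e]; rewrite sideE e.
    by rewrite pmulr_rlt0 // nmulr_llt0 // subr_gt0.
  have {mpos}mpos : 0 < mink (lcross E.1.1 E.1.2) d by rewrite lt_neqAle mpos andbT eq_sym; apply/eqP.
  exists (seg_to_edge D, E.1.1, - E.1.2) => /=; split; first by apply/mem_graphP; exists D.
  exists (seg_curve E), t0; split=> //.
    split; first exact: unit_tangent_N.
    by move=> r rl; exists (- r); rewrite dev_curve // geodesicNE opprK.
  split.
    move: ltt (wl _ n2); apply: filterS2 => r rt [k' k0 e].
    by rewrite sideE lcrossNr minkNl e oppr_gt0 pmulr_rlt0 // pmulr_llt0 // subr_lt0.
  move: gtt (wr _ n2); apply: filterS2 => r rt [k' k0 e].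
  by rewrite sideE lcrossNr minkNl e oppr_lt0 mulr_gt0 // mulr_gt0 // subr_gt0.
exists (\sum_k eweight (ek k).1.1 *: inf_translation (ek k).1.2 (ek k).2).
exists sigma, (size ts1), ts, (fun k => (ek k).1.1), (fun k => (ek k).1.2), (fun k => (ek k).2).
split=> //; split.
  by move=> k k'; rewrite /ts => e; apply/val_inj/eqP; move: e;
    rewrite !(tnth_nth 0) /= => /eqP; rewrite nth_uniq // undup_uniq.
move=> t; rewrite tsP; split=> [tin|[k ->]]; last exact: mem_tnth.
have tk : (index t ts1 < size ts1)%N by rewrite index_mem.
by exists (Ordinal tk); rewrite /ts (tnth_nth 0) /= nth_index.
Qed.

(** The edge [translate c D] is contained in the cell of [c * f D], where [f D]
    is a fixed cell containing [D]; only finitely many cells meet a ball. *)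
Lemma edges_in_ball M : exists L : seq (segment R),
  (forall E, E \in L -> seg_edge q act E) /\
  forall D c y, D \in s -> hyperboloid y -> y ord_max 0 <= M ->
    in_seg (translate rho c D) y -> translate rho c D \in L.
Proof.
have [r hr] := vor_bound vor.
have /choice[f fP] : forall D, exists a, D \in s -> edge_act act D.1.1 D.1.2 D.2 a.
  move=> D; have [Ds|nDs] := boolP (D \in s); last by exists 1%g.
  by have [a [_ [aE _ _]]] := edge_act2 (s_edge Ds); exists a.
have /finite_seqP[F FE] := fin (2 * r * M + 1) (@apex_hyp R).
exists [seq translate rho (b * (f D)^-1)%g D | D <- s, b <- F]; split.
  move=> _ /allpairsP[[D b] [/= Ds _ ->]]; apply: (seg_edgeM rS rM vor).
  exact: s_edge.
move=> D c y Ds hy yM yD; apply/allpairsP; exists (D, (c * f D)%g) => /=.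
rewrite Ds; split=> //; last by rewrite -mulgA mulgV mulg1.
have ay : act (c * f D)%g y.
  case: yD => t tl ->; rewrite /= -geodesic_mul; apply/(vor_M vor).
  exact: fP.
have : [set` F] (c * f D)%g; last by [].
rewrite -FE /=; have ar := hr _ _ hy ay.
apply: le_lt_trans (cdist_triangle rS _ hy (@apex_hyp R)) _.
rewrite minkC mink_apex opprK; have a1 := cdist_ge1 rS (c * f D)%g hy.
apply: (@le_lt_trans _ _ (2 * r * M)); last by rewrite ltrDl.
have y0 : 0 < y ord_max 0 by case: hy.
by apply: ler_pM => //; [lra | exact: ltW | rewrite ler_pM2l // ltW].
Qed.

(** Join both points by segments to a third point [z]. Choosing [z] outside the
    planes of the finitely many edges which can be met makes the crossings
    transverse; choosing it outside the planes through a vertex and an end of the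
    path makes them avoid the vertices. *)
Lemma crossing_sum_ex (x y : cover_space C) :
  ~ lifted_graph graph x -> ~ lifted_graph graph y ->
  exists X, crossing_sum dev graph x y X.
Proof.
move=> nx ny; set a := dev x; set b := dev y.
have ha : hyperboloid a := dev_hyp hdev x; have hb : hyperboloid b := dev_hyp hdev y.
have a0 : 0 < a ord_max 0 by case: ha.
have b0 : 0 < b ord_max 0 by case: hb.
pose M := a ord_max 0 + b ord_max 0 + 2.
have [L [LE LM]] := edges_in_ball M.
pose fend (E : segment R) := geodesic E.1.1 E.1.2 E.2.
pose fs : seq (segment R -> 'cV[R]_3) :=
  [:: fun E => lcross E.1.1 E.1.2; fun E => lcross a E.1.1; fun E => lcross a (fend E);
      fun E => lcross b E.1.1; fun E => lcross b (fend E)].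
pose ms := [seq f E | f <- fs, E <- L].
have off (w : cover_space C) z E : ~ lifted_graph graph w -> E \in L -> in_seg E z -> dev w <> z.
  move=> nw EL zE e; apply: nw; apply/lifted_graphP; exists E; split; first exact: LE.
  by rewrite e.
have start E : E \in L -> in_seg E E.1.1.
  by move=> /LE[pu l0 _]; exists 0; rewrite ?geodesic0 // lexx ltW.
have fin_ E : E \in L -> in_seg E (fend E).
  by move=> /LE[pu l0 _]; exists E.2; rewrite // lexx ltW.
have hyp_on E z : E \in L -> in_seg E z -> hyperboloid z.
  by move=> /LE[pu _ _]; exact: on_seg_hyp.
have ms0 m : m \in ms -> m != 0.
  move=> /allpairsP[[f E] [/= ffs EL ->]]; apply/eqP.
  have cr w z : ~ lifted_graph graph w -> in_seg E z -> lcross (dev w) z <> 0.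
    move=> nw zE; apply: hyp_lcross_neq0; first exact: (dev_hyp hdev).
      exact: hyp_on zE.
    exact: (off _ _ E).
  move: ffs; rewrite !inE => /or4P[/eqP->|/eqP->|/eqP->|/orP[/eqP->|/eqP->]].
  - have nn : mink (lcross E.1.1 E.1.2) (lcross E.1.1 E.1.2) = 1.
      by rewrite (normal_mink (seg_ut (LE _ EL))).
    by move=> n0; rewrite n0 mink0l in nn; lra.
  - by apply: cr => //; exact: start.
  - by apply: cr => //; exact: fin_.
  - by apply: cr => //; exact: start.
  - by apply: cr => //; exact: fin_.
have [z [hz z2 zms]] := generic_point ms0.
have z0 : 0 < z ord_max 0 by case: hz.
have zm f E : f \in fs -> E \in L -> mink (f E) z != 0.
  by move=> ffs EL; apply: zms; apply/allpairsP; exists (f, E).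
pose al r : R := ((1 - 2 * r) + `|1 - 2 * r|) / 2.
pose be r : R := ((2 * r - 1) + `|2 * r - 1|) / 2.
pose de r : R := 1 - `|1 - 2 * r|.
pose gam r := al r *: a + de r *: z + be r *: b.
have cgam : continuous gam.
  have cabs (k m : R) : continuous (fun r : R => `|k * r + m|).
    move=> r; apply: cvg_norm; apply: cvgD; last exact: cvg_cst.
    by apply: cvgM; [exact: cvg_cst | exact: cvg_id].
  have clin (k m : R) : continuous (fun r : R => k * r + m).
    move=> r; apply: cvgD; last exact: cvg_cst.
    by apply: cvgM; [exact: cvg_cst | exact: cvg_id].
  have eal : al = fun r => ((- 2 * r + 1) + `|- 2 * r + 1|) / 2.
    by apply/funext => r; rewrite /al (_ : 1 - 2 * r = - 2 * r + 1) //; ring.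
  have ebe : be = fun r => ((2 * r + - 1) + `|2 * r + - 1|) / 2 by [].
  have ede : de = fun r => 1 - `|- 2 * r + 1|.
    by apply/funext => r; rewrite /de (_ : 1 - 2 * r = - 2 * r + 1) //; ring.
  have cal : continuous al.
    rewrite eal => r; apply: cvgM; last exact: cvg_cst.
    by apply: cvgD; [exact: clin | exact: cabs].
  have cbe : continuous be.
    rewrite ebe => r; apply: cvgM; last exact: cvg_cst.
    by apply: cvgD; [exact: clin | exact: cabs].
  have cde : continuous de.
    by rewrite ede => r; apply: cvgB; [exact: cvg_cst | exact: cabs].
  move=> r; apply: cvg_add; first apply: cvg_add.
  - by apply: cvg_scale; [exact: cal | exact: cvg_cst].
  - by apply: cvg_scale; [exact: cde | exact: cvg_cst].
  - by apply: cvg_scale; [exact: cbe | exact: cvg_cst].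
have gaml r : r <= 2^-1 -> gam r = (1 - 2 * r) *: a + (2 * r) *: z.
  move=> r2; rewrite /gam /al /be /de ger0_norm ?ler0_norm; [|lra|lra].
  rewrite (_ : (1 - 2 * r + (1 - 2 * r)) / 2 = 1 - 2 * r); last by field.
  rewrite (_ : (2 * r - 1 - (2 * r - 1)) / 2 = 0); last by rewrite subrr mul0r.
  by rewrite scale0r addr0; congr (_ + _ *: _); ring.
have gamr r : 2^-1 <= r -> gam r = (2 * r - 1) *: b + (2 - 2 * r) *: z.
  move=> r2; rewrite /gam /al /be /de ler0_norm ?ger0_norm; [|lra|lra].
  rewrite (_ : (1 - 2 * r - (1 - 2 * r)) / 2 = 0); last by rewrite subrr mul0r.
  rewrite (_ : (2 * r - 1 + (2 * r - 1)) / 2 = 2 * r - 1); last by field.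
  by rewrite scale0r add0r addrC; congr (_ + _ *: _); ring.
have g0 : psi (gam 0) = x.
  rewrite gaml; last by rewrite invr_ge0.
  by rewrite mulr0 subr0 scale1r scale0r addr0 devK.
have g1 : psi (gam 1) = y.
  rewrite gamr; last by rewrite invf_le1; lra.
  by rewrite mulr1 subrr scale0r addr0 (_ : 2 - 1 = 1) ?scale1r ?devK //; ring.
rewrite -g0 -g1; apply: path_crossing_sum => //; rewrite ?g0 ?g1 //.
  move=> r /andP[r0 r1]; have [r2|/ltW r2] := lerP r 2^-1.
    by rewrite gaml //; apply: cone_conv; try exact: hyp_cone; lra.
  by rewrite gamr //; apply: cone_conv; try exact: hyp_cone; lra.
have half (w : cover_space C) m n k t D c t0 : ~ lifted_graph graph w ->
    dev w ord_max 0 + 2 <= M ->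
    ((fun E => lcross (dev w) E.1.1) \in fs) -> ((fun E => lcross (dev w) (fend E)) \in fs) ->
    0 <= m -> 0 < n -> m + n = 1 -> gam t = m *: dev w + n *: z -> k != 0 ->
    (\forall r \near t, gam r = gam t + (r - t) *: (k *: (z - dev w))) ->
    D \in s -> 0 <= t0 <= D.2 ->
    let E := translate rho c D in normalize (gam t) = geodesic E.1.1 E.1.2 t0 ->
    0 < t0 < D.2 /\ exists2 d, (\forall r \near t, gam r = gam t + (r - t) *: d) &
       mink (lcross E.1.1 E.1.2) d <> 0.
  move=> nw wM fs0 fs1 m0 n0 mn gt k0 affine Ds t0D E eE.
  have hw := dev_hyp hdev w; have w0 : 0 < dev w ord_max 0 by case: hw.
  have EE := seg_edgeM rS rM vor c (s_edge Ds); have utE := seg_ut EE.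
  have cg : cone (gam t).
    by rewrite gt; apply: cone_conv; try exact: hyp_cone; lra.
  have hy := normalize_hyp cg; have nz := normalize_gt0 cg.
  set kap := (Num.sqrt _)^-1 in nz.
  have ey : normalize (gam t) = (kap * m) *: dev w + (kap * n) *: z.
    by rewrite /normalize -/kap {1}gt scalerDr !scalerA.
  have yM : normalize (gam t) ord_max 0 <= M.
    have k1 : 0 <= kap * m by rewrite mulr_ge0 // ltW.
    have k2 : 0 <= kap * n by rewrite mulr_ge0 // ltW.
    rewrite ey in hy *; have k12 := hyp_conv_le1 hw hz k1 k2 hy.
    rewrite !mxE; apply: le_trans wM.
    have : kap * m * dev w ord_max 0 <= dev w ord_max 0 by apply: ler_piMl; lra.
    have : kap * n * z ord_max 0 <= z ord_max 0 by apply: ler_piMl; lra.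
    by lra.
  have EL : E \in L.
    by apply: (LM D c _ Ds hy yM); exists t0.
  have vec f : mink f (normalize (gam t)) = 0 -> m * mink f (dev w) + n * mink f z = 0.
    rewrite minkZr -/kap => /eqP; rewrite mulf_eq0 gt_eqF //= => /eqP.
    by rewrite gt minkDr !minkZr.
  have vert e : mink (lcross (dev w) e) z != 0 -> normalize (gam t) <> e.
    move=> ez ee; have : mink (lcross (dev w) e) (normalize (gam t)) = 0.
      by rewrite ee mink_lcrossr.
    move=> /vec; rewrite mink_lcrossl mulr0 add0r => /eqP.
    by rewrite mulf_eq0 gt_eqF //= (negbTE ez).
  have nE := zm (fun E => lcross E.1.1 E.1.2) E (mem_head _ _) EL.
  split.
    rewrite !lt_neqAle; case/andP: t0D => t00 t0D; rewrite t00 t0D !andbT.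
    apply/andP; split; apply/eqP => e.
      by apply: (vert _ (zm _ E fs0 EL)); rewrite eE -e geodesic0.
    by apply: (vert _ (zm _ E fs1 EL)); rewrite eE e.
  exists (k *: (z - dev w)) => //.
  have := normal_geodesic utE t0; rewrite -eE => /vec nm.
  rewrite minkZr minkDr minkNr => /eqP; rewrite mulf_eq0 (negbTE k0) /= subr_eq0 => /eqP e.
  move: nm; rewrite -e -mulrDl mn mul1r => /eqP.
  by rewrite (negbTE nE).
have fsE k : (k < 5)%N -> nth (fun=> 0) fs k \in fs by move=> ?; rewrite mem_nth.
move=> t D c t0 /andP[tt0 tt1] Ds t0D E eE.
have [t2|t2|t2] := ltgtP t 2^-1.
- apply: (half x (1 - 2 * t) (2 * t) 2 t D c t0) => //.
  + by rewrite /M -/a; lra.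
  + exact: (fsE 1%N).
  + exact: (fsE 2%N).
  + by lra.
  + by lra.
  + by lra.
  + by rewrite gaml // ltW.
  have tn : \forall r \near t, r < 2^-1 by exact: lt_nbhsl.
  apply: filterS tn => r r2; rewrite !gaml ?ltW // -/a.
  by apply/matrixP => i j; rewrite !mxE; ring.
- apply: (half y (2 * t - 1) (2 - 2 * t) (- 2) t D c t0) => //.
  + by rewrite /M -/b; lra.
  + exact: (fsE 3%N).
  + exact: (fsE 4%N).
  + by lra.
  + by lra.
  + by lra.
  + by rewrite gamr // ltW.
  have tn : \forall r \near t, 2^-1 < r by exact: lt_nbhsr.
  apply: filterS tn => r r2; rewrite !gamr ?ltW // -/b.
  by apply/matrixP => i j; rewrite !mxE; ring.
(* the corner [z] is off the graph, by the choice of [z] *)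
exfalso; move: eE; rewrite t2 gaml // mulfV // subrr scale0r add0r scale1r normalize_id // => eE.
have EL : E \in L.
  by apply: (LM D c z Ds hz); [rewrite /M; lra | exists t0].
have utE := seg_ut (LE _ EL).
have := zm (fun E => lcross E.1.1 E.1.2) E (mem_head _ _) EL.
by rewrite eE normal_geodesic // eqxx.
Qed.

Lemma off_graph_ex : exists x : cover_space C, ~ lifted_graph graph x.
Proof.
have [L [LE LM]] := edges_in_ball 2.
have [|z [hz z2 zL]] := @generic_point R [seq lcross E.1.1 E.1.2 | E <- L].
  move=> _ /mapP[E EL ->]; apply/eqP => n0.
  have nn : mink (lcross E.1.1 E.1.2) (lcross E.1.1 E.1.2) = 1.
    by rewrite (normal_mink (seg_ut (LE _ EL))).
  by move/eqP: nn; rewrite n0 mink0l eq_sym oner_eq0.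
have cz := hyp_cone hz.
exists (psi z) => /lifted_graph_curve[D [c [t [Ds tD e]]]].
have EE := seg_edgeM rS rM vor c (s_edge Ds); have utE := seg_ut EE.
have ez : z = geodesic (translate rho c D).1.1 (translate rho c D).1.2 t.
  by rewrite -(normalize_id hz) -psiK // e dev_curve.
have EL : translate rho c D \in L by apply: LM hz z2 _ => //; exists t.
have /zL : lcross (translate rho c D).1.1 (translate rho c D).1.2 \in
    [seq lcross E.1.1 E.1.2 | E <- L] by apply/mapP; exists (translate rho c D).
by rewrite ez normal_geodesic // eqxx.
Qed.

Lemma lifted_graph_deck a (x : cover_space C) :
  lifted_graph graph (deck a x) <-> lifted_graph graph x.
Proof.
by split=> -[e [t [eG tl ex]]]; exists e, t; split=> //; rewrite -ex proj_deck.
Qed.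

(** Sites and cells are equivariant. *)
Lemma site_at_deck a (x : cover_space C) : ~ lifted_graph graph x ->
  site_at (deck a x) = rho a *m site_at x + v a.
Proof.
move=> nx; have nax : ~ lifted_graph graph (deck a x) by rewrite lifted_graph_deck.
rewrite -(vor_siteM vor); apply: (off_graph nax); first exact: cell_act.
by rewrite (dev_deck hrho); apply/(vor_M vor); exact: cell_act.
Qed.

End SurfaceGraph.

(** * Surjectivity *)

Section Cocycles.
Variable R : realType.

Lemma hat_inj : injective (@hat R).
Proof.
move=> v w e; have E x : lcross v x = lcross w x by rewrite -!hatE e.
have := (E (vec3 1 0 0), E (vec3 0 1 0)) => -[/matrixP e0 /matrixP e1].
have := (e0 1 0, e0 ord_max 0, e1 ord_max 0).
by rewrite !vec3E => -[[h2 h1] h0]; apply: vec3P; lra.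
Qed.

Lemma AdD (A X Y : 'M[R]_3) : Ad A (X + Y) = Ad A X + Ad A Y.
Proof. by rewrite /Ad mulmxDr mulmxDl. Qed.

Lemma AdN (A X : 'M[R]_3) : Ad A (- X) = - Ad A X.
Proof. by rewrite /Ad mulmxN mulNmx. Qed.

Lemma quotient_eq (T : Type) (r : T -> T -> Prop) x C p :
  r x = C -> class_of r x = exist _ C p.
Proof. by move=> e; subst C; congr exist; exact: Prop_irrelevance. Qed.

End Cocycles.

Lemma disc_compact (R : realType) : compact (@disc R).
Proof.
have sq : compact (`[-1, 1]%classic `*` `[-1, 1]%classic : set (R * R)).
  by apply: compact_setX; exact: segment_compact.
apply: subclosed_compact sq _.
  have cf : continuous (fun x : R * R => x.1 ^+ 2 + x.2 ^+ 2).
    move=> x; have c1 : fst y @[y --> x] --> x.1 by exact: cvg_fst.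
    have c2 : snd y @[y --> x] --> x.2 by exact: cvg_snd.
    apply: cvgD; under eq_fun do rewrite expr2; rewrite expr2; exact: cvgM.
  exact: (closed_comp (fun x _ => cf x) (@closed_le R 1)).
move=> x; rewrite /disc /= => x1.
have sq1 := sqr_ge0 x.1; have sq2 := sqr_ge0 x.2.
by split; rewrite /= in_itv /= -ler_norml -(@ler_pXn2r _ 2) ?nnegrE //
  real_normK ?num_real // expr1n; lra.
Qed.

(** The surface is the image of the disc. *)
Lemma surface_compact (R : realType) g (S : topologicalType) :
  closed_surface_of_genus R g S -> compact [set: S].
Proof.
move=> [_ [q [cq sq _]]]; have -> : [set: S] = q @` @disc R.
  by apply/seteqP; split=> // p _; have [x dx <-] := sq p; exists x.
exact: continuous_compact (@disc_compact R).
Qed.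

Theorem proposition5p2 (R : realType) (g : nat) (S : topologicalType)
    (h : hyperbolic_structure R S) (C : universal_cover R S)
    (dev : cover_space C -> 'cV[R]_3) (rho : pi1 C -> 'M[R]_3)
    (hg : (2 <= g)%N) (hS : closed_surface_of_genus R g S)
    (hdev : developing_map h dev) (hrho : holonomy dev rho) :
  forall c : H1 rho, exists b : BG h, Phi dev b c.
Proof.
move=> [T [[tau [tau_so tauM]] eT]].
have rS := rho_SO hrho; have rM := rhoM hrho.
have [psi [psiK devK psi_cont]] := dev_inverse hdev.
have fin := @cdist_finite _ _ _ _ _ hdev _ hrho.
have cob := cobounded hdev hrho (surface_compact hS).
have /choice[v tauE] : forall a, exists v, tau a = hat v by move=> a; exact: so21_hatP.
have vM a b : v (a * b)%g = rho a *m v b + v a.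
  by apply: hat_inj; rewrite hatD -(Ad_hat (rS a)) -!tauE.
have [q [act vor]] := voronoi_ex rS rM fin cob vM.
have [s0 [s_edge0 s_cover0 s_sep0]] := edge_orbits rS rM fin vor.
pose s := undup s0; have s_uniq : uniq s := undup_uniq s0.
have s_edge D : D \in s -> seg_edge q act D by rewrite mem_undup; exact: s_edge0.
have s_cover D : seg_edge q act D -> exists2 D', D' \in s & equiv_seg rho D D'.
  by move=> /s_cover0[D' D's DD']; exists D'; rewrite ?mem_undup.
have s_sep D D' : D \in s -> D' \in s -> equiv_seg rho D D' -> D = D'.
  by rewrite !mem_undup; exact: s_sep0.
have /choice[wt wtP] : forall D, exists w, D \in s -> 0 < w /\ exists a b,
  [/\ edge_side q act D.1.1 D.1.2 D.2 1 a, edge_side q act D.1.1 D.1.2 D.2 (-1) b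
    & q a - q b = w *: lcross D.1.1 D.1.2].
  move=> D; have [/s_edge ED|nD] := boolP (D \in s); last by exists 0.
  have [a sa] := edge_side_ex fin vor ED 1; have [b sb] := edge_side_ex fin vor ED (-1).
  have [w w0 e] := edge_jump vor ED sa sb.
  by exists w => _; split=> //; exists a, b.
have wt_gt0 D : D \in s -> 0 < wt D by move=> /wtP[].
have wt_jump D (Ds : D \in s) := (wtP D Ds).2.
have /choice[cell cellP] : forall y, exists a, hyperboloid y -> act a y.
  move=> y; have [hy|nhy] := pselect (hyperboloid y); last by exists 1%g.
  by have [a ay] := vor_ex vor hy; exists a.
pose G := graph psi s wt.
have GP : balanced_geodesic_graph h G.
  split.
  - exact: (graph_geodesic hdev psiK psi_cont s_edge).
  - exact: (graph_embedded hdev hrho psiK vor s_uniq s_edge s_sep).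
  - exact: (graph_balanced hdev hrho psiK psi_cont fin vor s_uniq s_edge s_cover s_sep wt_gt0 wt_jump).
exists (class_of (@bgraph_equiv _ _ h) (exist _ G GP)).
exists (exist _ G GP) => //=; split.
  have [x0 nx0] := off_graph_ex hdev hrho psiK fin vor s_edge wt.
  have /choice[t tP] : forall a, exists X, crossing_sum dev G x0 (deck a x0) X.
    move=> a; apply: (crossing_sum_ex hdev hrho psiK devK psi_cont fin vor s_edge s_cover) => //.
    by rewrite lifted_graph_deck.
  by exists x0, t.
move=> x0 t [nx0 tP].
pose F := site_at dev q cell x0.
have tE a : t a = Ad (rho a) (hat F) - hat F + tau a.
  have nax : ~ lifted_graph G (deck a x0) by rewrite lifted_graph_deck.
  have := crossing_sumE hdev hrho psiK psi_cont fin vor s_edge s_cover wt_jump cellP nx0 nax (tP a).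
  move=> ->; rewrite (site_at_deck hdev hrho psiK fin vor s_edge s_cover cellP _ nx0).
  by rewrite -/F hatD (Ad_hat (rS a)) tauE addrAC.
have tC : is_cocycle rho t.
  split=> [a|a b].
    by rewrite tE tauE (Ad_hat (rS a)) -hatN -!hatD; exact: so21_hat.
  rewrite !tE tauM !AdD AdN rM.
  have -> : Ad (rho a *m rho b) (hat F) = Ad (rho a) (Ad (rho b) (hat F)).
    by rewrite (Ad_hat (rS b)) (Ad_hat (rS a)) -rM (Ad_hat (rS _)) rM mulmxA.
  have alg (P F0 U W Q : 'M[R]_3) : P - F0 + (U + W) = P - Q + U + (Q - F0 + W).
    by apply/matrixP => i j; rewrite !mxE; ring.
  exact: alg.
exists (exist _ t tC); split=> //.
apply: quotient_eq; rewrite eT; apply/funext => t'; apply/propext; split.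
  move=> [X soX XP]; exists (X + hat F) => [|a].
    by have [w ->] := so21_hatP soX; rewrite -hatD; exact: so21_hat.
  have := XP a; rewrite /= tE AdD => e.
  have alg (P F0 U W Q Y : 'M[R]_3) : P - (F0 - U + W) = Q - Y -> P - W = Q + F0 - (Y + U).
    by move=> /matrixP e'; apply/matrixP => i j; have := e' i j; rewrite !mxE; lra.
  exact: alg e.
move=> [X soX XP]; exists (X - hat F) => [|a].
  by have [w ->] := so21_hatP soX; rewrite -hatN -hatD; exact: so21_hat.
have := XP a; rewrite /= tE AdD AdN => e.
have alg (P F0 U W Q Y : 'M[R]_3) : P - W = Q - Y -> P - (F0 - U + W) = Q - F0 - (Y - U).
  by move=> /matrixP e'; apply/matrixP => i j; have := e' i j; rewrite !mxE; lra.
exact: alg e.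
Qed.
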